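(* Let $H=\sum_{i=1}^n\lambda_iq_ip_i\in\mathcal{O}_{\mathbb{C}^{2n},0}$, with $\lambda=(\lambda_1,\dots,\lambda_n)\in\mathbb{C}^n$, and let $I\subset\mathcal{O}_{\mathbb{C}^{2n},0}$ be the ideal generated by $q_ip_i$, $i=1,\dots,n$. If the vector $\lambda$ is diophantine, then for every function of the form $$H+R,\qquad R\in\mathcal{M}^3_{\mathbb{C}^{2n},0},$$ there exists a symplectic automorphism $\varphi\in\operatorname{Aut}(\mathcal{O}_{\mathbb{C}^{2n},0})$ such that $$\varphi(H+R)=H\pmod{I^2}.$$
   Context: $\mathcal{O}_{\mathbb{C}^{2n},0}$ is the ring of germs at the origin of holomorphic functions on $\mathbb{C}^{2n}$ with coordinates $(q,p)=(q_1,\dots,q_n,p_1,\dots,p_n)$, and $\mathcal{M}_{\mathbb{C}^{2n},0}$ is its maximal ideal. $\mathbb{C}^{2n}$ carries the standard symplectic form $\sum_i dq_i\wedge dp_i$ (up to sign convention); an automorphism of $\mathcal{O}_{\mathbb{C}^{2n},0}$ is symplectic if it is induced by a germ of biholomorphism preserving the symplectic form. For $\lambda\in\mathbb{C}^n$ and $i\in\mathbb{Z}^n$ put $(\lambda,i)=\sum_k\lambda_ki_k$ and $\sigma(i)=|i_1|+\dots+|i_n|$. The vector $\lambda$ is diophantine if there exist $C>0$ and $\tau\in\mathbb{N}$ such that $|(\lambda,i)|\ge C/\sigma(i)^\tau$ for all $i\in\mathbb{Z}^n\setminus\{0\}$. *)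

(* Defs.v *)
From HB Require Import structures.
From mathcomp Require Import all_boot all_order all_algebra.
From mathcomp Require Import generic_quotient ring_quotient.
From mathcomp Require Import all_classical all_reals all_analysis.
From mathcomp Require Import zify ring lra.
From mathcomp Require Import complex.

Set Implicit Arguments.
Unset Strict Implicit.
Unset Printing Implicit Defensive.

Import Order.TTheory GRing.Theory Num.Theory.
Import numFieldNormedType.Exports.

Local Open Scope classical_set_scope.
Local Open Scope ring_scope.

Section PowerSeries.
Variables (C : numClosedFieldType) (m : nat).
Local Notation mindex := {ffun 'I_m -> nat}.

Definition monomial (z : 'rV[C]_m) (alpha : mindex) : C :=
  \prod_(i < m) z 0 i ^+ alpha i.

Definition box_sum (N : nat) (u : mindex -> C) : C :=
  \sum_(alpha : {ffun 'I_m -> 'I_N}) u [ffun i => val (alpha i)].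

(* The family [u] is absolutely summable, with sum [s]; absolute summability  *)
(* makes the exhaustion of N^m by the boxes {0,...,N-1}^m immaterial.         *)
Definition abs_sum (u : mindex -> C) (s : C) : Prop :=
  (exists M : C, forall N, box_sum N (fun alpha => `|u alpha|) <= M) /\
  box_sum N u @[N --> \oo] --> s.

(* Weierstrass' definition of holomorphy in several variables: near every     *)
(* point of an open set, the function is the sum of a convergent power series *)
(* centred at that point.                                                     *)
Definition analytic_at (f : 'rV[C]_m -> C) (a : 'rV[C]_m) : Prop :=
  exists c : mindex -> C,
    \forall z \near a, abs_sum (fun alpha => c alpha * monomial (z - a) alpha) (f z).

Definition holomorphic_germ (f : 'rV[C]_m -> C) : Prop :=
  \forall a \near (0 : 'rV[C]_m), analytic_at f a.

Lemma box_sumD N u v :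
  box_sum N (fun alpha => u alpha + v alpha) = box_sum N u + box_sum N v.
Proof. by rewrite /box_sum big_split. Qed.

Lemma box_sumZ N k u :
  box_sum N (fun alpha => k * u alpha) = k * box_sum N u.
Proof. by rewrite /box_sum big_distrr. Qed.

Lemma abs_sumD u v s t : abs_sum u s -> abs_sum v t ->
  abs_sum (fun alpha => u alpha + v alpha) (s + t).
Proof.
move=> [[M uM] us] [[M' vM'] vt]; split.
  exists (M + M') => N; apply: le_trans (lerD (uM N) (vM' N)).
  by rewrite -box_sumD; apply: ler_sum => alpha _; exact: ler_normD.
under eq_cvg do rewrite box_sumD.
exact: cvgD.
Qed.

Lemma abs_sumN u s : abs_sum u s -> abs_sum (fun alpha => - u alpha) (- s).
Proof.
move=> [[M uM] us]; split.
  exists M => N; apply: le_trans (uM N).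
  by apply: ler_sum => alpha _; rewrite normrN.
rewrite (_ : (fun N => _) = (fun N => - box_sum N u)); first exact: cvgN.
by apply/funext => N; rewrite /box_sum sumrN.
Qed.

Definition widen_box N K (leNK : (N <= K)%N) (alpha : {ffun 'I_m -> 'I_N}) :
  {ffun 'I_m -> 'I_K} := [ffun i => widen_ord leNK (alpha i)].

Lemma widen_box_inj N K (leNK : (N <= K)%N) : injective (widen_box leNK).
Proof.
move=> a b /ffunP ab; apply/ffunP => i; apply/val_inj.
by have /(congr1 val) := ab i; rewrite !ffunE.
Qed.

Lemma big_box N K (leNK : (N <= K)%N) (P : pred mindex) (u : mindex -> C) :
  \sum_(alpha : {ffun 'I_m -> 'I_N} | P [ffun i => val (alpha i)])
     u [ffun i => val (alpha i)] =
  \sum_(alpha : {ffun 'I_m -> 'I_K} |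
     [forall i, (alpha i < N)%N] && P [ffun i => val (alpha i)])
     u [ffun i => val (alpha i)].
Proof.
pose Q := [set alpha : {ffun 'I_m -> 'I_N} | P [ffun i => val (alpha i)]]%SET.
have E alpha : [ffun i => val (widen_box leNK alpha i)] =
    [ffun i => val (alpha i)] :> mindex.
  by apply/ffunP => i; rewrite !ffunE.
transitivity (\sum_(alpha in (widen_box leNK @: Q)%SET)
                 u [ffun i => val (alpha i)]).
  rewrite big_imset /=; last by move=> a b _ _ /widen_box_inj.
  by apply: eq_big => alpha; [rewrite inE | rewrite E].
apply: eq_bigl => alpha; apply/imsetP/idP => [[b]|].
  rewrite inE => Pb ->; rewrite E Pb andbT.
  by apply/forallP => i; rewrite ffunE /=.
move=> /andP[/forallP aN Pa].
exists [ffun i => Ordinal (aN i)]; last first.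
  by apply/ffunP => i; apply/val_inj; rewrite !ffunE.
rewrite inE (_ : [ffun i => _] = [ffun i => val (alpha i)])//.
by apply/ffunP => i; rewrite !ffunE.
Qed.

Lemma abs_sum1 (a0 : mindex) (x : C) :
  abs_sum (fun alpha => if alpha == a0 then x else 0) x.
Proof.
pose K := (\max_(i < m) a0 i).+1.
have aK i : (a0 i < K)%N by rewrite ltnS leq_bigmax.
have sumE N y : (K <= N)%N ->
    box_sum N (fun alpha => if alpha == a0 then y else 0) = y.
  move=> KN; have aN i : (a0 i < N)%N by exact: leq_trans (aK i) KN.
  rewrite /box_sum (bigD1 [ffun i => Ordinal (aN i)])//= ifT ?big1 ?addr0//.
    move=> b bn; case: eqP => // be; case/eqP: bn.
    apply/ffunP => i; apply/val_inj; rewrite !ffunE /=.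
    by have /ffunP/(_ i) := be; rewrite ffunE.
  by apply/eqP/ffunP => i; rewrite !ffunE.
split; last first.
  by apply: cvg_near_cst; exists K => // N /= KN; rewrite sumE.
exists `|x| => N.
have -> : `|x| = box_sum (N + K) (fun alpha => if alpha == a0 then `|x| else 0).
  by rewrite sumE // leq_addl.
have NK : (N <= N + K)%N by rewrite leq_addr.
rewrite /box_sum (big_box NK xpredT (fun alpha => `|if alpha == a0 then x else 0|)).
rewrite big_mkcond /=; apply: ler_sum => alpha _.
by case: ifP => _; case: eqP; rewrite ?normr0.
Qed.


(* Coefficients of the product of two multivariate power series.              *)
Definition conv (u v : mindex -> C) (g : mindex) : C :=
  \sum_(alpha : {ffun 'I_m -> 'I_(\sum_i g i).+1} | [forall i, (alpha i <= g i)%N])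
    u [ffun i => val (alpha i)] * v [ffun i => g i - alpha i]%N.

Let le_mindex (a g : mindex) := [forall i, (a i <= g i)%N].

Let sub_mindex (g a : mindex) : mindex := [ffun i => g i - a i]%N.

Let val_box N (a : {ffun 'I_m -> 'I_N}) : mindex := [ffun i => val (a i)].

Lemma conv_box (u v : mindex -> C) N (g : {ffun 'I_m -> 'I_N}) :
  conv u v (val_box g) =
  \sum_(a : {ffun 'I_m -> 'I_N} | le_mindex (val_box a) (val_box g))
    u (val_box a) * v (sub_mindex (val_box g) (val_box a)).
Proof.
pose g' := val_box g.
pose F a := u a * v (sub_mindex g' a).
pose N0 := (\sum_i g' i).+1.
have aux K (HK : (K <= N + N0)%N) (gK : forall i, (g' i < K)%N) :
    \sum_(a : {ffun 'I_m -> 'I_K} | le_mindex (val_box a) g') F (val_box a) =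
    \sum_(a : {ffun 'I_m -> 'I_(N + N0)} | le_mindex (val_box a) g') F (val_box a).
  rewrite (big_box HK (le_mindex^~ g') F); apply: eq_bigl => a.
  case: (boolP (le_mindex _ _)) => [/forallP ag|]; last by rewrite andbF.
  rewrite andbT; apply/forallP => i; apply: leq_ltn_trans (gK i).
  by have := ag i; rewrite ffunE.
have -> : conv u v g' = \sum_(a : {ffun 'I_m -> 'I_N0} | le_mindex (val_box a) g')
    F (val_box a).
  apply: eq_big => [a|a _].
    by apply: eq_forallb => i /=; rewrite [in RHS]ffunE.
  by congr (_ * v _); apply/ffunP => i; rewrite !ffunE.
rewrite aux ?leq_addl//; last first.
  by move=> i; rewrite ltnS (bigD1 i)//= leq_addr.
have gN i : (g' i < N)%N by rewrite ffunE; exact: ltn_ord.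
by rewrite -(aux N (leq_addr _ _) gN).
Qed.

Lemma box_sum_conv (u v : mindex -> C) N :
  box_sum N (conv u v) =
  \sum_(a : {ffun 'I_m -> 'I_N}) \sum_(b : {ffun 'I_m -> 'I_N} |
    [forall i, (a i + b i < N)%N]) u (val_box a) * v (val_box b).
Proof.
rewrite /box_sum; under eq_bigr do rewrite conv_box.
rewrite (exchange_big_dep xpredT)//=; apply: eq_bigr => a _.
pose h (b : {ffun 'I_m -> 'I_N}) : {ffun 'I_m -> 'I_N} :=
  [ffun i => insubd (b i) (a i + b i)%N].
pose h' (g : {ffun 'I_m -> 'I_N}) : {ffun 'I_m -> 'I_N} :=
  [ffun i => insubd (g i) (g i - a i)%N].
have h'E g i : h' g i = (g i - a i)%N :> nat.
  by rewrite ffunE val_insubd (leq_ltn_trans (leq_subr _ _)).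
have hE (b : {ffun 'I_m -> 'I_N}) i : (a i + b i < N)%N -> h b i = (a i + b i)%N :> nat.
  by move=> ab; rewrite ffunE val_insubd ab.
rewrite (reindex_onto h h') /=; last first.
  move=> g /forallP ag; apply/ffunP => i; apply/val_inj => /=.
  have agi : (a i <= g i)%N by have := ag i; rewrite !ffunE.
  by rewrite hE h'E subnKC// ltn_ord.
apply: eq_big => [b|b /andP[/forallP ab /eqP hb]].
  apply/andP/forallP => [[/forallP ab /eqP/ffunP hb] i|ab].
    have := ab i; have := congr1 val (hb i); rewrite /= h'E !ffunE /=.
    rewrite val_insubd; case: ifP => // /negbT; rewrite -leqNgt.
    rewrite -[\val (b i)]/(nat_of_ord (b i)) => le1 e.
    have {}e : (nat_of_ord (b i) - a i = b i)%N := e.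
    by have := ltn_ord (b i); lia.
  split.
    by apply/forallP => i; rewrite !ffunE /= val_insubd ab leq_addr.
  by apply/eqP/ffunP => i; apply/val_inj; rewrite /= h'E hE// addKn.
congr (_ * v _); apply/ffunP => i.
have -> : val_box b i = h' (h b) i by rewrite hb ffunE.
by rewrite h'E !ffunE.
Qed.

Lemma box_sum_widen (u : mindex -> C) N K : (N <= K)%N ->
  box_sum N u = \sum_(a : {ffun 'I_m -> 'I_K} | [forall i, (a i < N)%N])
    u (val_box a).
Proof.
move=> NK; rewrite /box_sum (big_box NK xpredT u).
by apply: eq_bigl => a; rewrite andbT.
Qed.

Lemma box_sum_ge0 (u : mindex -> C) N : (forall a, 0 <= u a) -> 0 <= box_sum N u.
Proof. by move=> u0; apply: sumr_ge0. Qed.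

Lemma box_sum_homo (u : mindex -> C) N K : (forall a, 0 <= u a) -> (N <= K)%N ->
  box_sum N u <= box_sum K u.
Proof.
move=> u0 NK; rewrite (box_sum_widen _ NK) big_mkcond; apply: ler_sum => a _.
by case: ifP.
Qed.

Lemma abs_sumM (u v : mindex -> C) (s t : C) :
  (forall x : nat -> C, (forall n, 0 <= x n) ->
    (forall n k, (n <= k)%N -> x n <= x k) ->
    (exists M, forall n, x n <= M) ->
    forall e, 0 < e -> exists N, forall n, (N <= n)%N -> x n - x N <= e) ->
  abs_sum u s -> abs_sum v t -> abs_sum (conv u v) (s * t).
Proof.
move=> gap [[M uM] us] [[M' vM'] vt].
pose au a := `|u a|; pose av a := `|v a|.
pose W n := box_sum n au * box_sum n av.
have au0 a : 0 <= au a by exact: normr_ge0.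
have av0 a : 0 <= av a by exact: normr_ge0.
have WM n : W n <= M * M' by apply: ler_pM; rewrite ?box_sum_ge0.
have WE n : W n = \sum_(a : {ffun 'I_m -> 'I_n}) \sum_(b : {ffun 'I_m -> 'I_n})
    au (val_box a) * av (val_box b) by rewrite /W /box_sum big_distrlr.
split.
  exists (M * M') => N; apply: le_trans (WM N).
  apply: (@le_trans _ _ (box_sum N (conv au av))).
    apply: ler_sum => a _; rewrite /conv; apply: le_trans (ler_norm_sum _ _ _) _.
    by apply: ler_sum => b _; rewrite normrM.
  rewrite box_sum_conv WE; apply: ler_sum => a _.
  rewrite big_mkcond; apply: ler_sum => b _; case: ifP => // _.
  by rewrite mulr_ge0.
have uv : box_sum n u * box_sum n v @[n --> \oo] --> s * t by exact: cvgM.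
rewrite (_ : (fun N => _) =
  (fun n => box_sum n u * box_sum n v - (box_sum n u * box_sum n v - box_sum n (conv u v)))).
  rewrite -[s * t]subr0; apply: cvgB => //.
  apply/cvgr0Pnorm_le => e e0.
  have Wh n k : (n <= k)%N -> W n <= W k.
    by move=> nk; rewrite /W ler_pM ?box_sum_ge0 ?box_sum_homo.
  have W0 n : 0 <= W n by rewrite /W mulr_ge0 ?box_sum_ge0.
  have [N NW] := gap W W0 Wh (ex_intro _ _ WM) e e0.
  exists (N + N)%N => // n /= Nn.
  have leNn : (N <= n)%N by lia.
  apply: le_trans (NW n leNn).
  have -> : W N = \sum_(a : {ffun 'I_m -> 'I_n}) \sum_(b : {ffun 'I_m -> 'I_n})
      (if [forall i, (a i < N)%N] && [forall i, (b i < N)%N]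
       then au (val_box a) * av (val_box b) else 0).
    rewrite /W !(box_sum_widen _ leNn) big_distrlr big_mkcond; apply: eq_bigr => a _.
    by case: ifP => _ /=; [rewrite big_mkcond | rewrite big1].
  rewrite box_sum_conv /box_sum big_distrlr -sumrB WE -sumrB.
  apply: le_trans (ler_norm_sum _ _ _) _; apply: ler_sum => a _.
  rewrite [X in `|_ - X|]big_mkcond /= -!sumrB.
  apply: le_trans (ler_norm_sum _ _ _) _; apply: ler_sum => b _.
  case: ifPn => [_|abn].
    by rewrite subrr normr0 subr_ge0; case: ifP => // _; rewrite mulr_ge0.
  rewrite subr0 /= normrM ifN ?subr0//; apply: contra abn.
  move=> /andP[/forallP aN /forallP bN]; apply/forallP => i.
  by apply: leq_trans Nn; rewrite -addSn leq_add// ltnW.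
by apply/funext => n; rewrite opprB addrC subrK.
Qed.

End PowerSeries.

Section Analytic.
Variables (C : numClosedFieldType) (m : nat).
Local Notation mindex := {ffun 'I_m -> nat}.
Implicit Types (f g : 'rV[C]_m -> C) (a : 'rV[C]_m).

Lemma conv_monomial (c d : mindex -> C) (z : 'rV[C]_m) (alpha : mindex) :
  conv (fun b => c b * monomial z b) (fun b => d b * monomial z b) alpha =
  conv c d alpha * monomial z alpha.
Proof.
rewrite /conv big_distrl; apply: eq_bigr => b /forallP ba /=.
rewrite mulrACA; congr (_ * _); rewrite -big_split; apply: eq_bigr => i _ /=.
by rewrite !ffunE -exprD subnKC.
Qed.

Lemma analytic_cst (x : C) a : analytic_at (cst x) a.
Proof.
exists (fun alpha => if alpha == [ffun=> 0%N] then x else 0).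
near=> z; rewrite (_ : (fun _ => _ * _) =
  (fun alpha => if alpha == [ffun=> 0%N] then x else 0)); first exact: abs_sum1.
apply/funext => alpha; case: eqP => [->|]; last by rewrite mul0r.
by rewrite /monomial big1 ?mulr1// => i _; rewrite ffunE expr0.
Unshelve. all: by end_near. Qed.

Lemma analyticD f g a : analytic_at f a -> analytic_at g a -> analytic_at (f + g) a.
Proof.
move=> [c fc] [d gd]; exists (fun alpha => c alpha + d alpha).
near=> z; rewrite (_ : (fun _ => _ * _) =
  (fun alpha => c alpha * monomial (z - a) alpha + d alpha * monomial (z - a) alpha)).
  by rewrite -[(f + g) z]/(f z + g z); apply: abs_sumD; near: z.
by apply/funext => alpha; rewrite mulrDl.
Unshelve. all: by end_near. Qed.

Lemma analyticN f a : analytic_at f a -> analytic_at (- f) a.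
Proof.
move=> [c fc]; exists (fun alpha => - c alpha).
near=> z; rewrite (_ : (fun _ => _ * _) =
  (fun alpha => - (c alpha * monomial (z - a) alpha))).
  by rewrite -[(- f) z]/(- f z); apply: abs_sumN; near: z.
by apply/funext => alpha; rewrite mulNr.
Unshelve. all: by end_near. Qed.

Lemma analyticM_gap f g a :
  (forall x : nat -> C, (forall n, 0 <= x n) ->
    (forall n k, (n <= k)%N -> x n <= x k) ->
    (exists M, forall n, x n <= M) ->
    forall e, 0 < e -> exists N, forall n, (N <= n)%N -> x n - x N <= e) ->
  analytic_at f a -> analytic_at g a -> analytic_at (f * g) a.
Proof.
move=> gap [c fc] [d gd]; exists (conv c d).
near=> z; rewrite (_ : (fun _ => _ * _) =
  conv (fun alpha => c alpha * monomial (z - a) alpha)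
       (fun alpha => d alpha * monomial (z - a) alpha)).
  rewrite -[(f * g) z]/(f z * g z).
  by apply: (abs_sumM gap); near: z.
by apply/funext => alpha; rewrite conv_monomial.
Unshelve. all: by end_near. Qed.

Lemma analytic_coord i a : analytic_at (fun z => z 0 i) a.
Proof.
pose e : mindex := [ffun j => (j == i) : nat].
have -> : (fun z : 'rV[C]_m => z 0 i) =
    (fun z : 'rV[C]_m => (z - a) 0 i : C) + cst (a 0 i) :> ('rV[C]_m -> C).
  by apply/funext => z; rewrite -[RHS]/((z - a) 0 i + a 0 i) !mxE subrK.
apply: analyticD; last exact: analytic_cst.
exists (fun alpha => if alpha == e then 1 else 0).
near=> z; rewrite (_ : (fun _ => _ * _) =
  (fun alpha => if alpha == e then (z - a) 0 i else 0)); first exact: abs_sum1.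
apply/funext => alpha; case: eqP => [->|]; last by rewrite mul0r.
rewrite mul1r /monomial (bigD1 i)//= ffunE eqxx expr1 big1 ?mulr1//.
by move=> j /negbTE ji; rewrite ffunE ji expr0.
Unshelve. all: by end_near. Qed.

End Analytic.

(* [R[i]] has no topology of its own; seen as a [numClosedFieldType] it gets  *)
(* the one of its modulus. It is locked because unification otherwise unfolds *)
(* the structures of [Cplx R] to those of [R[i]] and does not terminate in    *)
(* practice.                                                                  *)
HB.lock Definition Cplx (R : realType) : numClosedFieldType := R[i].

Lemma CplxE (R : realType) : Cplx R = (R[i] : numClosedFieldType).
Proof. by rewrite Cplx.unlock. Qed.

Lemma bounded_gap (R : realType) (x : nat -> Cplx R) : (forall n, 0 <= x n) ->
  (forall n k, (n <= k)%N -> x n <= x k) -> (exists M, forall n, x n <= M) ->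
  forall e, 0 < e -> exists N, forall n, (N <= n)%N -> x n - x N <= e.
Proof.
move: x; rewrite CplxE => x x0 xh [M xM] e e0.
pose y (n : nat) : R := complex.Re (x n : R[i]).
have yh : {homo y : n m / (n <= m)%N >-> n <= m}.
  by move=> n k /xh; rewrite lecE => /andP[].
have yM n : y n <= complex.Re (M : R[i]) by have := xM n; rewrite lecE => /andP[].
have ycv : cvgn y.
  by apply: nondecreasing_is_cvgn => //; exists (complex.Re (M : R[i])) => _ [n _ <-].
have /andP[/eqP eI eR] : (complex.Im (e : R[i]) == 0) && (0 < complex.Re (e : R[i])).
  by move: e0; rewrite ltcE.
have /cvgrPdist_lt/(_ _ eR)[N _ /(_ N (leqnn N)) /= hN] := ycv.
exists N => n Nn; rewrite lecE.
have xI k : complex.Im (x k : R[i]) = 0.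
  by have := x0 k; rewrite lecE => /andP[/eqP].
have Im_sub (a b : R[i]) : complex.Im (a - b) = complex.Im a - complex.Im b.
  by case: a b => ? ? [? ?].
have Re_sub (a b : R[i]) : complex.Re (a - b) = complex.Re a - complex.Re b.
  by case: a b => ? ? [? ?].
rewrite Im_sub Re_sub !xI eI subr0 eqxx /=.
have yn : y n <= limn y by exact: nondecreasing_cvgn_le.
have := le_lt_trans (ler_norm _) hN; rewrite -/(y n) -/(y N); lra.
Qed.

Section Holomorphic.
Variables (R : realType) (m : nat).
Local Notation C := (Cplx R).
Implicit Types (f g : 'rV[C]_m -> C) (a : 'rV[C]_m).

Lemma analyticM f g a : analytic_at f a -> analytic_at g a -> analytic_at (f * g) a.
Proof. exact: analyticM_gap (@bounded_gap R). Qed.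

Definition holomorphic_pred : {pred 'rV[C]_m -> C} :=
  fun f => `[< holomorphic_germ f >].

Lemma holomorphic_cst (x : C) : cst x \in holomorphic_pred.
Proof.
by apply/asboolP; near=> a; exact: analytic_cst.
Unshelve. all: by end_near. Qed.

Lemma holomorphic_coord i : (fun z : 'rV[C]_m => z 0 i) \in holomorphic_pred.
Proof.
by apply/asboolP; near=> a; exact: analytic_coord.
Unshelve. all: by end_near. Qed.

Lemma holomorphic_subring : subring_closed holomorphic_pred.
Proof.
split=> [|f g /asboolP fh /asboolP gh|f g /asboolP fh /asboolP gh].
- exact: holomorphic_cst.
- apply/asboolP; near=> a; apply: analyticD; first by near: a.
  by apply: analyticN; near: a.
- by apply/asboolP; near=> a; apply: analyticM; near: a.
Unshelve. all: by end_near. Qed.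

HB.instance Definition _ :=
  GRing.isSubringClosed.Build ('rV[C]_m -> C) holomorphic_pred holomorphic_subring.

(* A holomorphic function near 0, extended arbitrarily to the whole space.    *)
Record holo := Holo { holo_fun :> 'rV[C]_m -> C; _ : holo_fun \in holomorphic_pred }.

HB.instance Definition _ := [isSub for holo_fun].
HB.instance Definition _ := [Choice of holo by <:].
HB.instance Definition _ := [SubChoice_isSubComNzRing of holo by <:].

Definition null_germ : {pred holo} :=
  fun h : holo => `[< \forall z \near (0 : 'rV[C]_m), h z = 0 >].

Lemma null_germ_idealr : idealr_closed null_germ.
Proof.
split.
- by apply/asboolP; near=> z.
- apply/asboolP => /nbhs_singleton one0.
  by have /eqP := one0 : (1 : C) = 0; rewrite oner_eq0.
- move=> h f g /asboolP fh /asboolP gh; apply/asboolP; near=> z.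
  rewrite -[LHS]/(h z * f z + g z).
  have -> : f z = 0 by near: z.
  have -> : g z = 0 by near: z.
  by rewrite mulr0 addr0.
Unshelve. all: by end_near. Qed.

HB.instance Definition _ :=
  isIdealr.Build holo null_germ null_germ_idealr.

Definition germ := {ideal_quot null_germ}.

HB.instance Definition _ := GRing.ComNzRing.on germ.

Definition germ_of (f : holo) : germ := \pi_germ%qT f.

Definition germ_fun (u : germ) : 'rV[C]_m -> C := (repr u : holo).

Lemma germ_of_eqP (f g : holo) :
  germ_of f = germ_of g <-> \forall z \near (0 : 'rV[C]_m), f z = g z.
Proof.
rewrite /germ_of; split.
  move=> /eqP; rewrite -Quotient.idealrBE => /asboolP fg.
  by near=> z; apply/subr0_eq; near: z.
move=> fg; apply/eqP; rewrite -Quotient.idealrBE; apply/asboolP.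
near=> z; rewrite /= -[LHS]/(f z - g z); apply/eqP; rewrite subr_eq0; apply/eqP.
by near: z.
Unshelve. all: by end_near. Qed.

Lemma germ_funK (u : germ) : germ_of (repr u) = u.
Proof. exact: reprK. Qed.

Lemma germ_fun_of (f : holo) :
  \forall z \near (0 : 'rV[C]_m), germ_fun (germ_of f) z = f z.
Proof. by apply/germ_of_eqP; rewrite germ_funK. Qed.

Definition germ_cst (x : C) : germ := germ_of (Holo (holomorphic_cst x)).

Definition germ_coord (i : 'I_m) : germ := germ_of (Holo (holomorphic_coord i)).

Definition maximal_ideal : set germ := [set u | germ_fun u 0 = 0].

Lemma maximal_ideal_of (f : holo) : maximal_ideal (germ_of f) <-> f 0 = 0.
Proof.
have e : germ_fun (germ_of f) 0 = f 0 by exact: nbhs_singleton (germ_fun_of f).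
by rewrite /maximal_ideal /= e.
Qed.

(* Independent of the representatives when [Phi] is continuous and fixes 0.    *)
Definition induced_by (phi : germ -> germ) (Phi : 'rV[C]_m -> 'rV[C]_m) : Prop :=
  forall u, \forall z \near (0 : 'rV[C]_m), germ_fun (phi u) z = germ_fun u (Phi z).

Definition holomorphic_map_germ (Phi : 'rV[C]_m -> 'rV[C]_m) : Prop :=
  forall j, holomorphic_germ (fun z => Phi z 0 j).

Definition biholomorphic_germ (Phi : 'rV[C]_m -> 'rV[C]_m) : Prop :=
  [/\ Phi 0 = 0, holomorphic_map_germ Phi &
    exists Psi : 'rV[C]_m -> 'rV[C]_m,
      [/\ Psi 0 = 0, holomorphic_map_germ Psi,
          \forall z \near (0 : 'rV[C]_m), Psi (Phi z) = z &
          \forall z \near (0 : 'rV[C]_m), Phi (Psi z) = z]].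

End Holomorphic.

Section Ideals.
Variable A : comNzRingType.
Implicit Types I J : set A.

Definition ideal_gen (k : nat) (g : 'I_k -> A) : set A :=
  [set x | exists a : 'I_k -> A, x = \sum_(i < k) a i * g i].

Definition ideal_mul I J : set A :=
  [set x | exists (k : nat) (a b : 'I_k -> A),
     (forall i, I (a i) /\ J (b i)) /\ x = \sum_(i < k) a i * b i].

Definition ideal_exp I (k : nat) : set A := iter k (ideal_mul I) setT.

End Ideals.

Section Symplectic.
Variables (R : realType) (n : nat).
Local Notation C := (Cplx R).
Local Notation V := 'rV[C]_(n + n).

(* The coordinates of C^(2n) are (q_1,...,q_n,p_1,...,p_n).                    *)
Definition germ_q (i : 'I_n) : germ R (n + n) := germ_coord R (lshift n i).
Definition germ_p (i : 'I_n) : germ R (n + n) := germ_coord R (rshift n i).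

Definition symplectic_form (u v : V) : C :=
  \sum_(i < n) (u 0 (lshift n i) * v 0 (rshift n i) -
                u 0 (rshift n i) * v 0 (lshift n i)).

Definition symplectic_germ (Phi : V -> V) : Prop :=
  \forall z \near (0 : V), forall u v : V,
    symplectic_form ('d Phi z u) ('d Phi z v) = symplectic_form u v.

Definition symplectic_automorphism (phi : germ R (n + n) -> germ R (n + n)) : Prop :=
  bijective phi /\
  exists Phi : V -> V,
    [/\ biholomorphic_germ Phi, symplectic_germ Phi & induced_by phi Phi].

Definition sigma (i : 'rV[int]_n) : nat := (\sum_(k < n) absz (i ord0 k))%N.

Definition diophantine (lambda : 'rV[C]_n) : Prop :=
  exists (c : C) (tau : nat), 0 < c /\
    forall i : 'rV[int]_n, i != 0 ->
      c / (sigma i)%:R ^+ tau <= `|\sum_(k < n) lambda 0 k * (i 0 k)%:~R|.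

Definition quadratic_hamiltonian (lambda : 'rV[C]_n) : germ R (n + n) :=
  \sum_(i < n) germ_cst (n + n) (lambda 0 i) * germ_q i * germ_p i.

Definition ideal_qp : set (germ R (n + n)) :=
  ideal_gen (fun i : 'I_n => germ_q i * germ_p i).

End Symplectic.

(* Main.v *)
Require Import Defs.
From HB Require Import structures.
From mathcomp Require Import all_boot all_order all_algebra.
From mathcomp Require Import generic_quotient ring_quotient.
From mathcomp Require Import all_classical all_reals all_analysis.
From mathcomp Require Import zify ring lra.
From mathcomp Require complex.

(** The quadratic part [H] acts diagonally by the Poisson bracket: a monomial
    [q^a p^b] is multiplied by its frequency [(lambda, a - b)]. The diophantine
    condition says that a frequency vanishes only for [a = b] and that the inverse of
    a nonzero one is bounded by a power of the degree ([diophantine_freq]). A monomial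
    with [a = b] that is not in [I^2] is constant or one of the [q_i p_i]. From order 3
    on, the homological equation [{h, H} = f] can therefore be solved modulo [I^2]
    ([homological_invP]), and on a slightly smaller polydisc the norm of the solution
    exceeds that of [f] by a power of the inverse of the lost width
    ([nrm_homological_inv]).

    Newton's method: given [H + P], one looks for [h] such that the exponential of
    [{h, -}] maps it to [H + P'], with [P'] modulo [I^2] quadratically small in [P]
    modulo [I^2]. The difficulty is the part [G] of [P] in [I^2], which is not small and
    enters through the bracket [{h, G}]. It is overcome because a bracket loses only one
    power of [I] ([valge_poisson]) and [h] is built in two stages: [h0] removes the part
    of [P] outside [I], and [h1], in [I], removes the part of [P + {h0, P}] in [I] modulo
    [I^2]. As [{h0, G}] is in [I] it is cancelled by the choice of [h1], and [{h1, G}] is in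
    [I^2] ([newton_residual]). The norms are the sums of [|f_a| x^|a|] on polydiscs of
    radius [x]; [newton_norm] is the quadratic estimate for them and [newton_seq_norm]
    the resulting convergence.

    Each step also raises the order of [P] modulo [I^2]. All the exponentials, and their
    infinite product, are then defined on formal power series, each coefficient being
    a finite sum ([lie], [oplim]); the product is a ring automorphism [T] that preserves
    the bracket, with an inverse of the same kind. The estimates only serve to show that
    the images of the coordinates under both converge ([convergent_normal_form]).

    It remains to pass from series to germs. By [auto_ev] the automorphism [T] is the
    substitution of the map whose components are the sums of the series [T X_j]. Its
    Jacobian matrix [J] satisfies [J^T Omega J = Omega] because [T] preserves the brackets
    of the coordinates ([jacobian_symp]), hence also [J Omega J^T = Omega], which is the
    invariance of the symplectic form. Convergent series define holomorphic germs by
    recentering ([ev_recenter]), and a convergent series all of whose monomials are in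
    [I^2] defines a germ in [I^2], since its quotients by the products [q_i p_i] converge
    ([valge_ideal_exp]). *)

Set Implicit Arguments.
Unset Strict Implicit.
Unset Printing Implicit Defensive.

Import Order.TTheory GRing.Theory Num.Theory.
Import numFieldNormedType.Exports.

Local Open Scope classical_set_scope.
Local Open Scope ring_scope.

(** * Multi-indices and the ring of formal power series *)

Notation mindex m := {ffun 'I_m -> nat}.

Section MultiIndex.
Variable m : nat.
Implicit Types (a b c : mindex m) (N : nat).

Definition mdeg a : nat := (\sum_i a i)%N.

Definition munit (i : 'I_m) : mindex m := [ffun j => (j == i) : nat].

Definition box N : seq (mindex m) :=
  [seq [ffun i => val (f i)] | f : {ffun 'I_m -> 'I_N}].

Lemma mindexDE a b i : (a + b) i = (a i + b i)%N.
Proof. by rewrite ffunE. Qed.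

Lemma mdegD a b : mdeg (a + b) = (mdeg a + mdeg b)%N.
Proof. by rewrite /mdeg -big_split; apply: eq_bigr => i _; rewrite mindexDE. Qed.

Lemma mdeg0 : mdeg 0 = 0%N.
Proof. by rewrite /mdeg big1// => i _; rewrite ffunE. Qed.

Lemma mdeg_unit i : mdeg (munit i) = 1%N.
Proof.
rewrite /mdeg (bigD1 i)//= ffunE eqxx big1 ?addn0// => j /negbTE ji.
by rewrite ffunE ji.
Qed.

Lemma mdeg_eq0 a : (mdeg a == 0%N) = (a == 0).
Proof.
apply/idP/eqP => [|->]; last by rewrite mdeg0.
rewrite /mdeg sum_nat_eq0 => /forallP a0; apply/ffunP => i; rewrite ffunE.
by apply/eqP; exact: a0.
Qed.

Lemma leq_mdeg a i : (a i <= mdeg a)%N.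
Proof. by rewrite /mdeg (bigD1 i)//= leq_addr. Qed.

Lemma mindex_neq0 a : a != 0 -> exists i, a i != 0%N.
Proof.
move=> a0; apply/existsP; rewrite -negb_forall; apply: contra a0 => /forallP a0.
by apply/eqP/ffunP => i; rewrite ffunE; apply/eqP.
Qed.

Lemma mindex_subK a c : (forall i, (c i <= a i)%N) -> a = c + [ffun i => a i - c i]%N.
Proof. by move=> ca; apply/ffunP => i; rewrite mindexDE ffunE subnKC. Qed.

Lemma mindexDI c : injective (fun a => a + c).
Proof.
move=> a b /ffunP ab; apply/ffunP => i; have := ab i.
by rewrite !mindexDE => /addIn.
Qed.

Lemma mindexIDr a b c : (a + c == b + c) = (a == b).
Proof. exact: (inj_eq (@mindexDI c)). Qed.

Lemma uniq_box N : uniq (box N).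
Proof.
rewrite map_inj_uniq ?enum_uniq// => f g /ffunP fg.
by apply/ffunP => i; apply/val_inj; have := fg i; rewrite !ffunE.
Qed.

Lemma mem_box N a : (a \in box N) = [forall i, (a i < N)%N].
Proof.
apply/mapP/forallP => [[f _ ->] i|aN]; first by rewrite ffunE ltn_ord.
exists [ffun i => Ordinal (aN i)]; first by rewrite mem_enum.
by apply/ffunP => i; rewrite !ffunE.
Qed.

Lemma mdeg_box N a : (mdeg a < N)%N -> a \in box N.
Proof.
by move=> aN; rewrite mem_box; apply/forallP => i; apply: leq_ltn_trans (leq_mdeg _ _) aN.
Qed.

Lemma box_le N N' a : (N <= N')%N -> a \in box N -> a \in box N'.
Proof.
by rewrite !mem_box => le /forallP h; apply/forallP => i; apply: leq_trans (h i) le.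
Qed.

Lemma box_mdeg N a : a \in box N -> (mdeg a < (m * N).+1)%N.
Proof.
rewrite mem_box ltnS => /forallP aN.
by rewrite -[X in (X * _)%N](card_ord m) -sum_nat_const leq_sum// => i _; apply/ltnW.
Qed.

Lemma box_addl N a b : a + b \in box N -> a \in box N.
Proof.
rewrite !mem_box => /forallP h; apply/forallP => i.
by apply: leq_ltn_trans (h i); rewrite mindexDE leq_addr.
Qed.

Lemma box_addr N a b : a + b \in box N -> b \in box N.
Proof. by rewrite addrC; exact: box_addl. Qed.

Lemma box_add N N' a b : a \in box N -> b \in box N' -> a + b \in box (N + N').
Proof.
rewrite !mem_box => /forallP h /forallP h'; apply/forallP => i.
by rewrite mindexDE; have := h i; have := h' i; lia.
Qed.

Section Sums.
Variable V : nmodType.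

Lemma sum_box_widen N N' (F : mindex m -> V) : (N <= N')%N ->
  (forall a, a \notin box N -> F a = 0) ->
  \sum_(a <- box N') F a = \sum_(a <- box N) F a.
Proof.
move=> NN' F0; rewrite (bigID (mem (box N)))/= addrC big1_seq ?add0r; last first.
  by move=> a /andP[/F0].
rewrite -big_filter; apply: perm_big; apply: uniq_perm.
- by rewrite filter_uniq ?uniq_box.
- exact: uniq_box.
- move=> a; rewrite mem_filter andb_idr//; exact: box_le.
Qed.

Lemma sum_box_cond N N' (P : pred (mindex m)) (F : mindex m -> V) : (N <= N')%N ->
  \sum_(a <- box N' | (a \in box N) && P a) F a = \sum_(a <- box N | P a) F a.
Proof.
move=> NN'; rewrite big_mkcond/= (sum_box_widen NN'); last by move=> a /negbTE->.
rewrite [RHS]big_mkcond; apply: eq_big_seq => a ->//.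
Qed.

Lemma sum_box1 N c (F : mindex m -> V) : c \in box N ->
  \sum_(a <- box N) (if a == c then F a else 0) = F c.
Proof.
move=> cN; rewrite (bigD1_seq c)//= ?eqxx ?uniq_box// big1 ?addr0//.
by move=> a /negbTE->.
Qed.

End Sums.
End MultiIndex.

(** The alias carries the convolution product; on a bare function type the ring
    structure is the pointwise one. *)
Definition fps (m : nat) (K : Type) : Type := mindex m -> K.

Section FpsRing.
Variables (m : nat) (K : numFieldType).
Local Notation S := (fps m K).
Implicit Types (f g h : S) (a b c : mindex m).

HB.instance Definition _ := GRing.Lmodule.copy S (mindex m -> K^o).

Lemma fpsP f g : (forall a, f a = g a) -> f = g.
Proof. by move=> fg; apply/funext. Qed.

Lemma fpsDE f g a : (f + g) a = f a + g a. Proof. by []. Qed.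
Lemma fpsNE f a : (- f) a = - f a. Proof. by []. Qed.
Lemma fpsBE f g a : (f - g) a = f a - g a. Proof. by []. Qed.
Lemma fpsZE k f a : (k *: f) a = k * f a. Proof. by []. Qed.
Lemma fps0E a : (0 : S) a = 0. Proof. by []. Qed.

Lemma fps_sumE I (r : seq I) (P : pred I) (F : I -> S) a :
  (\sum_(i <- r | P i) F i) a = \sum_(i <- r | P i) F i a.
Proof. exact: (big_morph (fun f : S => f a)). Qed.

(** The sum over pairs in a box, with a test, is independent of the box as long as
    it contains [c] (see [fps_mulE]); several products can then be expanded over one
    common box, which reduces associativity to exchanging sums. *)
Definition fps_mul f g : S := fun c =>
  \sum_(a <- box m (mdeg c).+1) \sum_(b <- box m (mdeg c).+1)
    (if a + b == c then f a * g b else 0).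

Lemma fps_mulE N f g c : c \in box m N ->
  fps_mul f g c = \sum_(a <- box m N) \sum_(b <- box m N)
    (if a + b == c then f a * g b else 0).
Proof.
have aux N1 N2 : (N1 <= N2)%N -> c \in box m N1 ->
   \sum_(a <- box m N2) \sum_(b <- box m N2)
      (if a + b == c then f a * g b else 0) =
   \sum_(a <- box m N1) \sum_(b <- box m N1)
      (if a + b == c then f a * g b else 0).
  move=> le cN; rewrite (sum_box_widen le); last first.
    move=> a aN; rewrite big1// => b _; case: eqP => // abc.
    by rewrite -abc in cN; rewrite (box_addl cN) in aN.
  apply: eq_bigr => a _; rewrite (sum_box_widen le)// => b bN.
  by case: eqP => // abc; rewrite -abc in cN; rewrite (box_addr cN) in bN.
move=> cN; have cd : c \in box m (mdeg c).+1 by exact: mdeg_box.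
rewrite /fps_mul; have [le|le] := leqP N (mdeg c).+1; first exact: aux.
by rewrite -(aux _ N)// ltnW.
Qed.

Definition fps_one : S := fun a => if a == 0 then 1 else 0.

Lemma fps_mulC : commutative fps_mul.
Proof.
move=> f g; apply/fpsP => c; rewrite /fps_mul exchange_big.
by apply: eq_bigr => a _; apply: eq_bigr => b _; rewrite addrC mulrC.
Qed.

Lemma fps_mul1 : left_id fps_one fps_mul.
Proof.
move=> f; apply/fpsP => c; rewrite /fps_mul.
rewrite (bigD1_seq 0)/= ?uniq_box//; last by rewrite mdeg_box ?mdeg0.
rewrite [X in _ + X]big1 ?addr0; last first.
  move=> a /negbTE a0; rewrite big1// => b _.
  by rewrite /fps_one a0 mul0r if_same.
rewrite -[RHS](@sum_box1 _ _ (mdeg c).+1 c f) ?mdeg_box//.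
by apply: eq_bigr => b _; rewrite add0r /fps_one eqxx mul1r.
Qed.

Lemma fps_mulDl : left_distributive fps_mul +%R.
Proof.
move=> f g h; apply/fpsP => c; rewrite fpsDE /fps_mul -big_split.
apply: eq_bigr => a _; rewrite -big_split; apply: eq_bigr => b _ /=.
by case: ifP => _; rewrite ?mulrDl// addr0.
Qed.

Let triple f g h c N := \sum_(a <- box m N) \sum_(b <- box m N) \sum_(d <- box m N)
  (if a + b + d == c then f a * g b * h d else 0).

Lemma fps_mul_triple N f g h c : c \in box m N ->
  fps_mul (fps_mul f g) h c = triple f g h c N.
Proof.
move=> cN; rewrite (fps_mulE _ _ cN).
transitivity (\sum_(e <- box m N) \sum_(d <- box m N) \sum_(a <- box m N)
   \sum_(b <- box m N) (if e == a + b then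
       (if a + b + d == c then f a * g b * h d else 0) else 0)).
  apply: eq_big_seq => e eN; apply: eq_bigr => d _; case: (eqVneq (e + d) c) => edc.
    rewrite (fps_mulE _ _ eN) big_distrl; apply: eq_bigr => a _ /=.
    rewrite big_distrl; apply: eq_bigr => b _ /=; rewrite eq_sym; case: eqP => [<-|_].
      by rewrite edc eqxx.
    by rewrite mul0r.
  rewrite big1// => a _; rewrite big1// => b _; case: eqP => // eab.
  by rewrite -eab (negbTE edc).
rewrite exchange_big /=.
under eq_bigr => d _ do rewrite exchange_big /=.
rewrite exchange_big /=; apply: eq_bigr => a _.
under eq_bigr => d _ do rewrite exchange_big /=.
rewrite exchange_big /=; apply: eq_bigr => b _; apply: eq_bigr => d _.
case: (eqVneq (a + b + d) c) => abd; last by rewrite big1// => e _; rewrite if_same.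
rewrite (sum_box1 (fun=> f a * g b * h d))// .
by rewrite -abd in cN; exact: box_addl cN.
Qed.

Lemma fps_mulA : associative fps_mul.
Proof.
move=> f g h; apply/fpsP => c.
have cN : c \in box m (mdeg c).+1 by exact: mdeg_box.
rewrite fps_mulC !(fps_mul_triple _ _ _ cN) /triple.
under eq_bigr => a _ do rewrite exchange_big/=.
rewrite exchange_big/=; apply: eq_bigr => a _; apply: eq_bigr => b _.
apply: eq_bigr => d _.
by rewrite [b + d + a]addrC addrA [g b * h d * _]mulrC mulrA.
Qed.

Lemma fps_one_neq0 : fps_one != 0 :> S.
Proof.
apply/eqP => /(congr1 (fun f : S => f 0)).
by rewrite /fps_one eqxx => /eqP; rewrite oner_eq0.
Qed.

HB.instance Definition _ := GRing.Zmodule_isComNzRing.Build S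
  fps_mulA fps_mulC fps_mul1 fps_mulDl fps_one_neq0.

Lemma fps_scaleAl (k : K) f g : k *: (f * g) = (k *: f) * g.
Proof.
apply/fpsP => c; rewrite fpsZE.
rewrite -[(f * g) c]/(fps_mul f g c) -[RHS]/(fps_mul (k *: f) g c) /fps_mul mulr_sumr.
apply: eq_bigr => a _; rewrite mulr_sumr; apply: eq_bigr => b _ /=.
by case: ifP => _; rewrite ?mulr0// mulrA.
Qed.

HB.instance Definition _ := GRing.Lmodule_isLalgebra.Build K S fps_scaleAl.

Lemma fps_scaleAr (k : K) f g : k *: (f * g) = f * (k *: g).
Proof. by rewrite mulrC fps_scaleAl mulrC. Qed.

HB.instance Definition _ := GRing.Lalgebra_isAlgebra.Build K S fps_scaleAr.

Lemma fpsME N f g c : c \in box m N ->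
  (f * g) c = \sum_(a <- box m N) \sum_(b <- box m N)
    (if a + b == c then f a * g b else 0).
Proof. exact: fps_mulE. Qed.

Lemma fps1E a : (1 : S) a = if a == 0 then 1 else 0. Proof. by []. Qed.

End FpsRing.

(** * Derivations, filtrations and the Poisson bracket *)

Section Derivations.
Variables (m : nat) (K : numFieldType).
Local Notation S := (fps m K).
Implicit Types (f g h : S) (a b c : mindex m) (i j : 'I_m).

Definition fps_mon a : S := fun b => if b == a then 1 else 0.

Definition fps_X i : S := fps_mon (munit i).

Lemma fps_monME a f b : (fps_mon a * f) (a + b) = f b.
Proof.
have abN := mdeg_box (ltnSn (mdeg (a + b))).
rewrite (fpsME _ _ abN) (bigD1_seq a)/= ?uniq_box//; last exact: box_addl abN.
rewrite [X in _ + X]big1 ?addr0; last first.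
  by move=> a' /negbTE a'a; rewrite big1// => b' _; rewrite /fps_mon a'a mul0r if_same.
rewrite -[RHS](@sum_box1 _ _ (mdeg (a + b)).+1 b f); last exact: box_addr abN.
apply: eq_bigr => b' _; rewrite ![a + _]addrC mindexIDr.
by rewrite /fps_mon eqxx mul1r.
Qed.

Lemma fps_monM_eq0 a f c i : (c i < a i)%N -> (fps_mon a * f) c = 0.
Proof.
move=> ca; rewrite (fpsME _ _ (mdeg_box (ltnSn _))) big1// => a' _.
rewrite big1// => b' _; case: eqP => // abc; rewrite /fps_mon.
case: eqP => [ea|]; last by rewrite mul0r.
by move: ca; rewrite -abc ea mindexDE ltnNge leq_addr.
Qed.

Lemma fps_monI a : injective (fun f => fps_mon a * f).
Proof.
by move=> f g fg; apply/fpsP => b; rewrite -(fps_monME a f) [_ * f]fg fps_monME.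
Qed.

Lemma fps_monM a b : fps_mon a * fps_mon b = fps_mon (a + b).
Proof.
apply/fpsP => c; have [/forallP ac|/forallPn[i]] := boolP [forall i, (a i <= c i)%N].
  rewrite (mindex_subK ac).
  by rewrite fps_monME /fps_mon ![a + _]addrC mindexIDr.
rewrite -ltnNge => ca; rewrite (fps_monM_eq0 _ ca) /fps_mon.
by case: eqP => // cab; move: ca; rewrite cab mindexDE ltnNge leq_addr.
Qed.

Lemma fps_mon0 : fps_mon 0 = 1. Proof. by []. Qed.

Definition partial i f : S := fun a => (a i).+1%:R * f (a + munit i).

Lemma partialD i : {morph partial i : f g / f + g}.
Proof. by move=> f g; apply/fpsP => a; rewrite /partial !fpsDE mulrDr. Qed.

Lemma partialZ i (k : K) f : partial i (k *: f) = k *: partial i f.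
Proof. by apply/fpsP => a; rewrite /partial !fpsZE mulrCA. Qed.

Lemma partialN i : {morph partial i : f / - f}.
Proof. by move=> f; rewrite -scaleN1r partialZ scaleN1r. Qed.

Lemma partialB i : {morph partial i : f g / f - g}.
Proof. by move=> f g; rewrite partialD partialN. Qed.

Lemma partial0 i : partial i 0 = 0.
Proof. by apply/fpsP => a; rewrite /partial !fps0E mulr0. Qed.

Lemma partial_sum i I (r : seq I) (P : pred I) (F : I -> S) :
  partial i (\sum_(k <- r | P k) F k) = \sum_(k <- r | P k) partial i (F k).
Proof. exact: (big_morph _ (partialD i) (partial0 i)). Qed.

Definition euler i f : S := fun a => (a i)%:R * f a.

Lemma euler_partial i f : fps_X i * partial i f = euler i f.
Proof.
apply/fpsP => a; case: (posnP (a i)) => [a0|a0].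
  rewrite /euler a0 mul0r (@fps_monM_eq0 _ _ _ i)// a0 ffunE eqxx//.
have [d ->] : exists d, a = munit i + d.
  by eexists; apply: mindex_subK => j; rewrite ffunE; case: eqP => [->|].
rewrite fps_monME /partial /euler addrC; congr (_%:R * _).
by rewrite mindexDE ffunE eqxx.
Qed.

Lemma eulerM i f g : euler i (f * g) = euler i f * g + f * euler i g.
Proof.
apply/fpsP => c; rewrite fpsDE /euler !(fpsME _ _ (mdeg_box (ltnSn (mdeg c)))).
rewrite mulr_sumr -big_split; apply: eq_bigr => a _ /=.
rewrite mulr_sumr -big_split; apply: eq_bigr => b _ /=.
case: eqP => [<-|_]; last by rewrite mulr0 addr0.
by rewrite mindexDE natrD; ring.
Qed.

(** Multiplication by [X_i] is injective and turns the partial derivative into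
    [X_i * d/dX_i], which is diagonal on monomials and for which Leibniz' rule is the
    additivity of exponents. *)
Lemma partialM i f g : partial i (f * g) = partial i f * g + f * partial i g.
Proof.
apply: (@fps_monI (munit i)); rewrite -/(fps_X i) mulrDr mulrA mulrCA.
by rewrite !euler_partial eulerM.
Qed.

Lemma partialC i j f : partial i (partial j f) = partial j (partial i f).
Proof.
apply/fpsP => a; rewrite /partial addrAC !mulrA; congr (_ * _).
have [->//|ij] := eqVneq i j.
rewrite !mindexDE !ffunE [j == i]eq_sym (negbTE ij) !addn0.
by rewrite mulrC.
Qed.

Lemma partial_X i j : partial i (fps_X j) = (i == j)%:R.
Proof.
apply/fpsP => a; rewrite /partial /fps_X /fps_mon.
have [<-|ij] := eqVneq i j.
  rewrite mulr1n fps1E -[X in _ == X]add0r mindexIDr; case: eqP => [->|_].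
    by rewrite ffunE mul1r.
  by rewrite mulr0.
rewrite mulr0n fps0E; case: eqP => [/ffunP/(_ i)|]; last by rewrite mulr0.
by rewrite mindexDE !ffunE eqxx (negbTE ij) addn1.
Qed.

End Derivations.

Section Filtration.
Variables (m : nat) (K : numFieldType) (w : mindex m -> nat).
Local Notation S := (fps m K).
Implicit Types (f g h : S) (a b c : mindex m) (i : 'I_m) (j k : nat).

(** For the total degree as [w] this is the order of [f] at the origin; for [qpval]
    below, the power of the ideal of the [q_i p_i] that contains [f]. *)
Definition wge k f := forall a, (w a < k)%N -> f a = 0.

Lemma wge0 f : wge 0 f. Proof. by []. Qed.

Lemma wge_le j k f : (k <= j)%N -> wge j f -> wge k f.
Proof. by move=> kj fj a ak; apply: fj; apply: leq_trans ak kj. Qed.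

Lemma wgeD k f g : wge k f -> wge k g -> wge k (f + g).
Proof. by move=> fk gk a ak; rewrite fpsDE fk// gk// addr0. Qed.

Lemma wgeZ k (l : K) f : wge k f -> wge k (l *: f).
Proof. by move=> fk a ak; rewrite fpsZE fk// mulr0. Qed.

Lemma wgeN k f : wge k f -> wge k (- f).
Proof. by move=> fk a ak; rewrite fpsNE fk// oppr0. Qed.

Lemma wgeB k f g : wge k f -> wge k g -> wge k (f - g).
Proof. by move=> fk gk; apply: wgeD => //; exact: wgeN. Qed.

Lemma wge_zero k : wge k 0. Proof. by []. Qed.

Lemma wge_sum I (r : seq I) (P : pred I) (F : I -> S) k :
  (forall l, P l -> wge k (F l)) -> wge k (\sum_(l <- r | P l) F l).
Proof. by move=> Fk; elim/big_ind: _ => //; exact: wgeD. Qed.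

Hypothesis wD : forall a b, (w a + w b <= w (a + b)%R)%N.

Lemma wgeM j k f g : wge j f -> wge k g -> wge (j + k) (f * g).
Proof.
move=> fj gk c ck; rewrite (fpsME _ _ (mdeg_box (ltnSn (mdeg c)))).
rewrite big1// => a _; rewrite big1// => b _; case: eqP => // abc.
have [aj|ja] := ltnP (w a) j; first by rewrite fj// mul0r.
have [bk|kb] := ltnP (w b) k; first by rewrite gk// mulr0.
by have := wD a b; rewrite abc; lia.
Qed.

End Filtration.

Section Order.
Variables (m : nat) (K : numFieldType).
Local Notation S := (fps m K).
Implicit Types (f g h : S) (a b c : mindex m) (i : 'I_m) (j k : nat).

Definition ordge : nat -> S -> Prop := wge (@mdeg m).

Lemma ordgeM j k f g : ordge j f -> ordge k g -> ordge (j + k) (f * g).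
Proof. by apply: wgeM => a b; rewrite mdegD. Qed.

Lemma ordge_partial i k f : ordge k f -> ordge k.-1 (partial i f).
Proof.
move=> fk a ak; rewrite /partial fk ?mulr0// mdegD mdeg_unit addn1.
by rewrite -ltn_predRL.
Qed.

Lemma ordge_X i : ordge 1 (fps_X K i).
Proof.
move=> a; rewrite ltnS leqn0 mdeg_eq0 => /eqP->; rewrite /fps_X /fps_mon.
by case: eqP => // /ffunP/(_ i); rewrite !ffunE eqxx.
Qed.

Lemma ordge_eq f g : (forall N, ordge N (f - g)) -> f = g.
Proof.
move=> fg; apply/fpsP => a; apply/eqP; rewrite -subr_eq0; apply/eqP.
exact: (fg (mdeg a).+1).
Qed.

End Order.

Section Poisson.
Variables (n : nat) (K : numFieldType).
Local Notation m := (n + n)%N.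
Local Notation S := (fps m K).
Implicit Types (f g h : S) (a b c : mindex m) (i j : 'I_n).

Definition dq i : S -> S := partial (lshift n i).
Definition dp i : S -> S := partial (rshift n i).

Definition poisson f g : S := \sum_i (dq i f * dp i g - dp i f * dq i g).

Lemma poissonC f g : poisson f g = - poisson g f.
Proof. by rewrite /poisson -sumrN; apply: eq_bigr => i _; ring. Qed.

Lemma poissonDl f g h : poisson (f + g) h = poisson f h + poisson g h.
Proof.
rewrite /poisson -big_split; apply: eq_bigr => i _ /=.
by rewrite /dq /dp !partialD; ring.
Qed.

Lemma poissonDr f g h : poisson f (g + h) = poisson f g + poisson f h.
Proof. by rewrite poissonC poissonDl opprD -!poissonC. Qed.

Lemma poissonZl (k : K) f g : poisson (k *: f) g = k *: poisson f g.
Proof.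
rewrite /poisson scaler_sumr; apply: eq_bigr => i _ /=.
by rewrite /dq /dp !partialZ -!scalerAl scalerBr.
Qed.

Lemma poissonZr (k : K) f g : poisson f (k *: g) = k *: poisson f g.
Proof. by rewrite poissonC poissonZl -scalerN -poissonC. Qed.

Lemma poissonNl f g : poisson (- f) g = - poisson f g.
Proof. by rewrite -[- f]scaleN1r poissonZl scaleN1r. Qed.

Lemma poissonM f g h : poisson f (g * h) = poisson f g * h + g * poisson f h.
Proof.
rewrite /poisson big_distrl big_distrr -big_split; apply: eq_bigr => i _ /=.
by rewrite /dq /dp !partialM; ring.
Qed.

Let double_inj f g : f + f = g + g -> f = g.
Proof.
rewrite -!mulr2n -[f *+ 2]scaler_nat -[g *+ 2]scaler_nat => /(congr1 (fun h => 2%:R^-1 *: h)).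
by rewrite !scalerA mulVf ?pnatr_eq0// !scale1r.
Qed.

Let dbl_sum (F G : 'I_n -> 'I_n -> S) :
  (forall i j, F i j + F j i = G i j + G j i) ->
  \sum_i \sum_j F i j = \sum_i \sum_j G i j.
Proof.
move=> FG; apply: double_inj.
rewrite {2}[\sum_i \sum_j F i j]exchange_big {2}[\sum_i \sum_j G i j]exchange_big /=.
rewrite -!big_split; apply: eq_bigr => i _; rewrite -!big_split; apply: eq_bigr => j _.
exact: FG.
Qed.

(** Only after symmetrizing in the two summation indices do the second derivatives
    cancel term by term. *)
Lemma poisson_jacobi f g h :
  poisson f (poisson g h) = poisson (poisson f g) h + poisson g (poisson f h).
Proof.
pose T (u v w : S) i j : S :=
  dq i u * (dp i (dq j v) * dp j w + dq j v * dp i (dp j w)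
            - dp i (dp j v) * dq j w - dp j v * dp i (dq j w))
  - dp i u * (dq i (dq j v) * dp j w + dq j v * dq i (dp j w)
            - dq i (dp j v) * dq j w - dp j v * dq i (dq j w)).
have TE u v w : poisson u (poisson v w) = \sum_i \sum_j T u v w i j.
  rewrite /poisson; apply: eq_bigr => i _.
  rewrite [dq i (\sum_j _)]partial_sum [dp i (\sum_j _)]partial_sum.
  rewrite !mulr_sumr -sumrB; apply: eq_bigr => j _.
  by rewrite /T /dp /dq !partialB !partialM; ring.
rewrite [poisson (poisson f g) h]poissonC !TE -sumrN -big_split /=.
under [RHS]eq_bigr => i _ do rewrite -sumrN -big_split /=.
apply: dbl_sum => i j; rewrite /T.
rewrite /dp /dq ![partial (rshift n j) (partial (rshift n i) _)]partialC.
rewrite ![partial (lshift n j) (partial (lshift n i) _)]partialC.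
rewrite ![partial (rshift n _) (partial (lshift n _) _)]partialC.
ring.
Qed.

Lemma ordge_poisson (j k : nat) f g : ordge j f -> ordge k g -> ordge (j + k - 2) (poisson f g).
Proof.
move=> fj gk; apply: wge_sum => i _.
have le : (j + k - 2 <= j.-1 + k.-1)%N by lia.
by apply: (wge_le le); apply: wgeB; apply: ordgeM; exact: ordge_partial.
Qed.

(** The largest power of the ideal generated by the [q_i p_i] to which a monomial
    belongs. *)
Definition qpval a : nat := (\sum_i minn (a (lshift n i)) (a (rshift n i)))%N.

Definition valge : nat -> S -> Prop := wge qpval.

Lemma qpvalD a b : (qpval a + qpval b <= qpval (a + b)%R)%N.
Proof.
rewrite /qpval -big_split leq_sum// => i _ /=; rewrite !mindexDE.
move: (a (lshift n i)) (a (rshift n i)) (b (lshift n i)) (b (rshift n i)) => x y z t.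
by lia.
Qed.

Definition qpunit i : mindex m := munit (lshift n i) + munit (rshift n i).

Lemma qpval_qpunit i a : qpval (a + qpunit i) = (qpval a).+1.
Proof.
rewrite /qpval (bigD1 i)//= [in RHS](bigD1 i)//= -addSn; congr (_ + _)%N.
  rewrite !mindexDE !ffunE !eqxx eq_lrshift eq_rlshift.
  by move: (a (lshift n i)) (a (rshift n i)) => x y; lia.
apply: eq_bigr => j ji; rewrite !mindexDE !ffunE eq_lrshift eq_rlshift.
by rewrite eq_lshift eq_rshift (negbTE ji) !addn0.
Qed.

Lemma valge_euler k l f : valge k f -> valge k (euler l f).
Proof. by move=> fk a ak; rewrite /euler fk// mulr0. Qed.

(** A bracket loses one power of the ideal and not two: after multiplication by
    [q_i p_i] each of its terms is a product of two Euler derivatives, which lose none. *)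
Lemma valge_poisson (j k : nat) f g : valge j f -> valge k g -> valge (j + k).-1 (poisson f g).
Proof.
move=> fj gk; apply: wge_sum => i _.
have aux (u v : S) (s t : 'I_m) : valge j u -> valge k v ->
    munit s + munit t = qpunit i -> valge (j + k).-1 (partial s u * partial t v).
  move=> uj vk st a ak.
  rewrite -(fps_monME (qpunit i)) -st -fps_monM.
  have -> : fps_mon K (munit s) * fps_mon K (munit t) * (partial s u * partial t v)
    = euler s u * euler t v by rewrite -!euler_partial /fps_X; ring.
  rewrite (wgeM qpvalD (valge_euler s uj) (valge_euler t vk))//.
  by rewrite st addrC qpval_qpunit; lia.
by apply: wgeB; apply: aux; rewrite // /qpunit addrC.
Qed.

End Poisson.

(** * Lie series *)

Lemma sum_triangle (V : nmodType) (F : nat -> nat -> V) (M : nat) :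
  \sum_(k < M) \sum_(i < k.+1) F i (k - i)%N =
  \sum_(i < M) \sum_(j < M | (i + j < M)%N) F i j.
Proof.
transitivity (\sum_(k < M) \sum_(i < M | (i <= k)%N) F i (k - i)%N).
  by apply: eq_bigr => k _; rewrite (big_ord_widen M (fun i => F i (k - i)%N))//.
rewrite (exchange_big_dep xpredT)//=; apply: eq_bigr => i _.
rewrite -(big_mkord (fun k => (i <= k)%N) (fun k => F i (k - i)%N)).
rewrite -(big_mkord (fun j => (i + j < M)%N) (F i)).
rewrite (@big_cat_nat _ _ _ i)//=; last exact/ltnW.
rewrite big_nat_cond big_pred0 ?add0r; last by move=> k; case: leqP; rewrite ?andbF.
rewrite (@big_cat_nat _ _ _ (M - i) 0 M)//= ?leq_subr//.
rewrite [X in _ = _ + X]big_nat_cond [X in _ = _ + X]big_pred0 ?addr0; last first.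
  by move=> k; apply/negbTE; lia.
rewrite -{1}[nat_of_ord i]add0n big_addn big_nat_cond [RHS]big_nat_cond.
by apply: eq_big => [k|k _]; [lia | rewrite addnK].
Qed.

Section LieSeries.
Variables (m : nat) (K : numFieldType).
Local Notation S := (fps m K).
Implicit Types (f g h : S) (a b c : mindex m) (i j k N : nat).

Lemma ordge_trunc N f g a : ordge N (f - g) -> (mdeg a < N)%N -> f a = g a.
Proof. by move=> fg aN; apply/eqP; rewrite -subr_eq0 -fpsBE fg. Qed.

Lemma ordge_trans N f g h : ordge N (f - g) -> ordge N (g - h) -> ordge N (f - h).
Proof. by move=> fg gh; rewrite -(subrKA g); apply: wgeD. Qed.

Lemma ordge_sym N f g : ordge N (f - g) -> ordge N (g - f).
Proof. by move=> fg; rewrite -opprB; apply: wgeN. Qed.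

Variable D : S -> S.
Hypothesis D_lin : linear D.

Let D_sum I (r : seq I) (P : pred I) (F : I -> S) :
  D (\sum_(l <- r | P l) F l) = \sum_(l <- r | P l) D (F l).
Proof.
have D0 : D 0 = 0 by have := D_lin (-1) 0 0; rewrite scaler0 addr0 scaleN1r addNr.
apply: (big_morph D) => // f g; by rewrite -[f]scale1r D_lin !scale1r.
Qed.

Let D_Z (l : K) f : D (l *: f) = l *: D f.
Proof.
have D0 : D 0 = 0 by have := D_lin (-1) 0 0; rewrite scaler0 addr0 scaleN1r addNr.
by have := D_lin l f 0; rewrite D0 !addr0.
Qed.

Definition dpow k f : S := (k`!%:R)^-1 *: iter k D f.

Lemma dpow0 f : dpow 0 f = f.
Proof. by rewrite /dpow fact0 invr1 scale1r. Qed.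

Lemma dpow_lin k : linear (dpow k).
Proof.
move=> l f g; rewrite /dpow scalerA mulrC -scalerA -scalerDr; congr (_ *: _).
by elim: k => //= k ->; rewrite D_lin.
Qed.

Lemma dpowS k f : D (dpow k f) = k.+1%:R *: dpow k.+1 f.
Proof.
by rewrite /dpow D_Z scalerA factS natrM invfM mulrA mulfV ?mul1r ?pnatr_eq0.
Qed.

Lemma dpow_add i j f : dpow i (dpow j f) = 'C(i + j, i)%:R *: dpow (i + j) f.
Proof.
elim: i => [|i IH] /=; first by rewrite dpow0 bin0 scale1r.
apply: (@scalerI _ _ (i.+1%:R)); first by rewrite pnatr_eq0.
rewrite -dpowS IH D_Z dpowS !scalerA addSn; congr (_ *: _).
by rewrite -!natrM -mul_bin_diag mulnC.
Qed.

Lemma dpow_bilinear (B : S -> S -> S) k f g :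
  (forall g, linear (B^~ g)) -> (forall f, linear (B f)) ->
  (forall f g, D (B f g) = B (D f) g + B f (D g)) ->
  dpow k (B f g) = \sum_(i < k.+1) B (dpow i f) (dpow (k - i) g).
Proof.
move=> Bl Br DB.
have BZl (l : K) u v : B (l *: u) v = l *: B u v.
  have B0 : B 0 v = 0 by have := Bl v (-1) 0 0; rewrite scaler0 addr0 scaleN1r addNr.
  by have := Bl v l u 0; rewrite B0 !addr0.
have BZr (l : K) u v : B u (l *: v) = l *: B u v.
  have B0 : B u 0 = 0 by have := Br u (-1) 0 0; rewrite scaler0 addr0 scaleN1r addNr.
  by have := Br u l v 0; rewrite B0 !addr0.
elim: k => [|k IH]; first by rewrite big_ord_recl big_ord0 addr0 !dpow0.
apply: (@scalerI _ _ (k.+1%:R)); first by rewrite pnatr_eq0.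
rewrite -dpowS IH D_sum.
under eq_bigr => i _ do rewrite DB !dpowS [B (_.+1%:R *: _) _]BZl [B _ (_.+1%:R *: _)]BZr.
rewrite big_split /= scaler_sumr.
transitivity (\sum_(i < k.+2) i%:R *: B (dpow i f) (dpow (k.+1 - i) g) +
              \sum_(i < k.+2) (k.+1 - i)%N%:R *: B (dpow i f) (dpow (k.+1 - i) g)).
  congr (_ + _).
    by rewrite [RHS]big_ord_recl scale0r add0r; apply: eq_bigr => i _; rewrite lift0 subSS.
  rewrite [RHS]big_ord_recr /= subnn scale0r addr0; apply: eq_bigr => i _ /=.
  by rewrite subSn// -ltnS.
rewrite -big_split; apply: eq_bigr => i _ /=.
by rewrite -scalerDl -natrD subnKC// -ltnS.
Qed.

Variable e : nat.
Hypothesis D_ord : forall N f, ordge N f -> ordge (N + e.+1) (D f).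

Lemma ordge_dpow k N f : ordge N f -> ordge (N + k * e.+1) (dpow k f).
Proof.
move=> fN; apply: wgeZ; elim: k => [|k IH]; first by rewrite mul0n addn0.
by rewrite mulSn [(e.+1 + _)%N]addnC addnA; exact: D_ord.
Qed.

Lemma ordge_dpow_k k f : ordge k (dpow k f).
Proof. by apply: (@wge_le _ _ _ (0 + k * e.+1)); [lia | exact: ordge_dpow]. Qed.

(** As [D] raises the order, [dpow k f] has no terms of degree less than [k]: each
    coefficient of the exponential of [D] is a finite sum, and no convergence is
    involved. *)
Definition lie f : S := fun a => \sum_(k < (mdeg a).+1) dpow k f a.

Definition lie_trunc N f : S := \sum_(k < N) dpow k f.

Lemma lieE N f : ordge N (lie f - lie_trunc N f).
Proof.
move=> a aN; rewrite fpsBE /lie /lie_trunc fps_sumE; apply/eqP; rewrite subr_eq0.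
rewrite (big_ord_widen N (fun k => dpow k f a))//.
rewrite big_mkcond; apply/eqP/eq_bigr => k _; case: ltnP => // ka.
by rewrite (@ordge_dpow_k k).
Qed.

Lemma lie_tail d L f a : (mdeg a < L + d)%N ->
  (lie f - lie_trunc d f) a = \sum_(k < L) dpow (k + d) f a.
Proof.
move=> aL; have := @lieE (L + d)%N f a aL.
rewrite !fpsBE => /eqP/[!subr_eq0]/eqP->.
rewrite /lie_trunc !fps_sumE addnC.
rewrite -!(big_mkord xpredT (fun k => dpow k f a)).
rewrite (@big_cat_nat _ _ _ d)//= ?leq_addr// addrAC subrr add0r.
by rewrite -{1}[d]add0n big_addn addKn big_mkord.
Qed.

Lemma ordge_lie_tail d N f : ordge N f -> ordge (N + d * e.+1) (lie f - lie_trunc d f).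
Proof.
move=> fN a aN; rewrite (@lie_tail _ (mdeg a).+1); last by rewrite ltnS leq_addr.
rewrite big1// => k _; apply: (ordge_dpow (k := (k + d)%N) fN).
by apply: leq_trans aN _; rewrite leq_add2l leq_mul2r leq_addl orbT.
Qed.

Lemma lie_lin : linear lie.
Proof.
move=> l f g; apply/fpsP => a; rewrite fpsDE fpsZE /lie mulr_sumr -big_split.
by apply: eq_bigr => k _; rewrite dpow_lin.
Qed.

Lemma lie_sub N f : ordge N f -> ordge (N + e.+1) (lie f - f).
Proof.
move=> fN a aN; rewrite fpsBE /lie big_ord_recl dpow0 addrC addKr.
rewrite big1// => k _; rewrite lift0; apply: (ordge_dpow (k := k.+1) fN).
by apply: leq_trans aN _; rewrite leq_add2l mulSn leq_addr.
Qed.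

Lemma ordge_lie N f : ordge N f -> ordge N (lie f).
Proof.
move=> fN; rewrite -[lie f](subrK f); apply: wgeD => //.
by apply: wge_le (lie_sub fN); rewrite leq_addr.
Qed.

(** The exponential of a derivation of a bilinear operation is an automorphism of it;
    for the product [d] is 0, for the Poisson bracket it is 2. Modulo a high order all
    three exponentials may be truncated, and the truncations differ by terms
    [B (dpow i f) (dpow j g)] with [i + j] large. *)
Lemma lie_bilinear (B : S -> S -> S) (d : nat) f g :
  (forall g, linear (B^~ g)) -> (forall f, linear (B f)) ->
  (forall j k f g, ordge j f -> ordge k g -> ordge (j + k - d) (B f g)) ->
  (forall f g, D (B f g) = B (D f) g + B f (D g)) ->
  lie (B f g) = B (lie f) (lie g).
Proof.
move=> Bl Br Bo DB.
have BBl u v w : B (u - v) w = B u w - B v w.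
  by have := Bl w (-1) v u; rewrite !scaleN1r /= [- v + u]addrC [RHS]addrC.
have BBr u v w : B w (u - v) = B w u - B w v.
  by have := Br w (-1) v u; rewrite !scaleN1r [- v + u]addrC [RHS]addrC.
have BSl I (r : seq I) (P : pred I) (F : I -> S) v : B (\sum_(l <- r | P l) F l) v =
   \sum_(l <- r | P l) B (F l) v.
  apply: (big_morph (B^~ v)) => [x y|].
    by rewrite -[x]scale1r Bl !scale1r.
  by have := BBl 0 0 v; rewrite !subrr.
have BSr I (r : seq I) (P : pred I) (F : I -> S) v : B v (\sum_(l <- r | P l) F l) =
   \sum_(l <- r | P l) B v (F l).
  apply: (big_morph (B v)) => [x y|].
    by rewrite -[x]scale1r Br !scale1r.
  by have := BBr 0 0 v; rewrite !subrr.
apply: ordge_eq => N; pose M := (N + d)%N.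
have lM u : ordge M (lie u - lie_trunc M u) by exact: lieE.
apply: (@ordge_trans N _ (lie_trunc M (B f g))).
  by apply: wge_le (lM _); rewrite leq_addr.
apply: (@ordge_trans N _ (B (lie_trunc M f) (lie_trunc M g))); last first.
  apply: ordge_sym; apply: (@ordge_trans N _ (B (lie_trunc M f) (lie g))).
    rewrite -BBl -[N](addnK d) -[in X in ordge X _](addn0 (N + d)%N).
    by apply: Bo => //; exact: wge0.
  rewrite -BBr -[N](addnK d) -[in X in ordge X _](add0n (N + d)%N).
  by apply: Bo => //; exact: wge0.
rewrite /lie_trunc.
under [X in ordge N (X - _)]eq_bigr => k _ do rewrite dpow_bilinear//.
rewrite (sum_triangle (fun i j => B (dpow i f) (dpow j g))).
rewrite BSl -sumrB.
apply: wge_sum => i _; rewrite BSr.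
rewrite [X in _ - X](bigID (fun j : 'I_M => (i + j < M)%N)) /= opprD addNKr.
apply: wgeN; apply: wge_sum => j; rewrite -leqNgt => ij.
apply: (@wge_le _ _ _ (i + j - d)%N); first by move: ij; rewrite /M; lia.
by apply: Bo; exact: ordge_dpow_k.
Qed.

End LieSeries.

(** On truncations the coefficient of [dpow k f] in the composite is the expansion of
    [(1 - 1) ^+ k]. *)
Lemma lie_inv m (K : numFieldType) (D D' : fps m K -> fps m K) e f :
  linear D -> (forall g, D' g = - D g) ->
  (forall N f, ordge N f -> ordge (N + e.+1) (D f)) -> lie D' (lie D f) = f.
Proof.
move=> Dl D'E Do.
have D'l : linear D' by move=> l u v; rewrite !D'E Dl opprD scalerN.
have D'o N u : ordge N u -> ordge (N + e.+1) (D' u).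
  by move=> uN; rewrite D'E; apply/wgeN/Do.
have D'pow k u : dpow D' k u = (-1) ^+ k *: dpow D k u.
  rewrite /dpow scalerA mulrC -scalerA; congr (_ *: _).
  elim: k => [|k IH]; first by rewrite scale1r.
  rewrite [LHS]/= IH D'E exprS mulN1r scaleNr; congr (- _).
  have D0 : D 0 = 0 by have := Dl (-1) 0 0; rewrite scaler0 addr0 scaleN1r addNr.
  by have := Dl ((-1) ^+ k) (iter k D u) 0; rewrite D0 !addr0.
have trunc_lin N : linear (lie_trunc D N).
  move=> l u v; rewrite /lie_trunc scaler_sumr -big_split.
  by apply: eq_bigr => k _; rewrite dpow_lin.
have dB k u v : dpow D' k (u - v) = dpow D' k u - dpow D' k v.
  by have := dpow_lin D'l k (-1) v u; rewrite !scaleN1r [- v + u]addrC [RHS]addrC.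
apply: ordge_eq => N.
have lN (D1 : fps m K -> fps m K) u : linear D1 ->
    (forall N f, ordge N f -> ordge (N + e.+1) (D1 f)) ->
  ordge N (lie D1 u - lie_trunc D1 N u) by move=> ? D1o; exact: lieE D1o _ _.
apply: (@ordge_trans _ _ _ _ (lie_trunc D' N (lie D f))); first exact: lN.
apply: (@ordge_trans _ _ _ _ (lie_trunc D' N (lie_trunc D N f))).
  rewrite /lie_trunc -sumrB; apply: wge_sum => k _.
  rewrite -dB.
  have := @ordge_dpow _ _ _ _ D'o k _ _ (lN D f Dl Do).
  by apply: wge_le; rewrite leq_addr.
case: N lN => [|N] lN; first exact: wge0.
have -> : lie_trunc D' N.+1 (lie_trunc D N.+1 f) =
  \sum_(i < N.+1) \sum_(j < N.+1) ((-1) ^+ i * 'C(i + j, i)%:R) *: dpow D (i + j) f.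
  rewrite /lie_trunc; apply: eq_bigr => i _.
  have dsum : dpow D' i (\sum_(j < N.+1) dpow D j f) = \sum_(j < N.+1) dpow D' i (dpow D j f).
    apply: (big_morph (dpow D' i)) => [u v|].
      by rewrite -[u]scale1r dpow_lin// !scale1r.
    have := dpow_lin D'l i (-1) 0 0; rewrite scaler0 addr0 scaleN1r addNr//.
  by rewrite dsum; apply: eq_bigr => j _; rewrite D'pow dpow_add// scalerA.
under eq_bigr => i _ do rewrite (bigID (fun j : 'I_N.+1 => (i + j < N.+1)%N)) /=.
rewrite big_split /= -addrA [_ - f]addrC addrA; apply: wgeD; last first.
  apply: wge_sum => i _; apply: wge_sum => j; rewrite -leqNgt => ij; apply: wgeZ.
  exact: wge_le ij (ordge_dpow_k Do _).
rewrite -(sum_triangle (fun i j => ((-1) ^+ i * 'C(i + j, i)%:R) *: dpow D (i + j) f)).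
rewrite big_ord_recl [X in _ + X - f]big1 ?addr0; last first.
  move=> k _; transitivity ((\sum_(i < k.+2) (-1) ^+ i * 'C(k.+1, i)%:R : K) *:
      dpow D k.+1 f).
    by rewrite lift0 scaler_suml; apply: eq_bigr => i _; rewrite /= subnKC// -ltnS.
  have -> : (\sum_(i < k.+2) (-1) ^+ i * 'C(k.+1, i)%:R : K) = (1 - 1) ^+ k.+1.
    by rewrite exprBn; apply: eq_bigr => i _; rewrite !expr1n !mulr1 mulr_natr.
  by rewrite subrr expr0n scale0r.
by rewrite big_ord_recl big_ord0 /= bin0 mulr1 scale1r dpow0 addr0 subrr; exact: wge_zero.
Qed.

(** * Poisson automorphisms and their infinite products *)

Section PoissonAutomorphisms.
Variables (n : nat) (K : numFieldType).
Local Notation S := (fps (n + n) K).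
Implicit Types (f g h : S) (N k : nat) (T U : S -> S).

(** The ring homomorphisms that preserve the bracket and are continuous for the
    adic topology; the continuity [pa_ord] is what lets an identity pass to limits. *)
Record poisson_auto T : Prop := PoissonAuto {
  pa_lin : linear T;
  pa_ord : forall N f, ordge N f -> ordge N (T f);
  pa_1 : T 1 = 1;
  pa_mul : forall f g, T (f * g) = T f * T g;
  pa_poisson : forall f g, T (poisson f g) = poisson (T f) (T g) }.

Lemma linB T f g : linear T -> T (f - g) = T f - T g.
Proof. by move=> Tl; rewrite addrC -scaleN1r Tl scaleN1r addrC. Qed.

Lemma linD T f g : linear T -> T (f + g) = T f + T g.
Proof. by move=> Tl; rewrite -[f]scale1r Tl !scale1r. Qed.

Lemma lin0 T : linear T -> T 0 = 0.
Proof. by move=> Tl; rewrite -[0 in LHS](subrr 0) linB// subrr. Qed.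

Lemma linZ T (l : K) f : linear T -> T (l *: f) = l *: T f.
Proof. by move=> Tl; have := Tl l f 0; rewrite (lin0 Tl) !addr0. Qed.

Lemma lin_sum T I (r : seq I) (P : pred I) (F : I -> S) : linear T ->
  T (\sum_(l <- r | P l) F l) = \sum_(l <- r | P l) T (F l).
Proof. by move=> Tl; apply: (big_morph T) => [x y|]; [exact: linD | exact: lin0]. Qed.

Lemma poisson_auto_id : poisson_auto id. Proof. by []. Qed.

Lemma poisson_auto_comp T U : poisson_auto T -> poisson_auto U ->
  poisson_auto (T \o U).
Proof.
move=> [Tl To T1 Tm Tp] [Ul Uo U1 Um Up]; split => /=.
- by move=> l f g /=; rewrite Ul Tl.
- by move=> N f /Uo/To.
- by rewrite U1.
- by move=> f g; rewrite Um Tm.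
- by move=> f g; rewrite Up Tp.
Qed.

Lemma poisson_linear f : linear (poisson f).
Proof. by move=> l g h; rewrite poissonDr poissonZr. Qed.

Lemma poisson_linearl g : linear ((@poisson n K)^~ g).
Proof. by move=> l f h /=; rewrite poissonDl poissonZl. Qed.

Lemma poisson1r f : poisson f 1 = 0.
Proof.
have := poissonM f 1 1; rewrite !mulr1 mul1r => /eqP.
by rewrite -subr_eq0 opprD addNKr oppr_eq0 => /eqP.
Qed.

Lemma ad_raises e h N f : ordge e.+3 h -> ordge N f -> ordge (N + e.+1) (poisson h f).
Proof.
move=> he fN; apply: wge_le (ordge_poisson he fN); lia.
Qed.

Lemma lie_poisson_auto e h : ordge e.+3 h -> poisson_auto (lie (poisson h)).
Proof.
move=> he; have hl := poisson_linear h.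
have ho N f := @ad_raises e h N f he.
split.
- exact: lie_lin.
- exact: ordge_lie ho.
- apply/fpsP => a; rewrite /lie big_ord_recl dpow0 big1 ?addr0// => k _.
  rewrite lift0; suff -> : dpow (poisson h) k.+1 1 = 0 by [].
  rewrite /dpow iterSr poisson1r; suff -> : iter k (poisson h) 0 = 0 by rewrite scaler0.
  by elim: (nat_of_ord k) => //= j ->; rewrite lin0.
- move=> f g; apply: (@lie_bilinear _ _ _ hl e ho *%R 0%N).
  + by move=> u l v w /=; rewrite mulrDl scalerAl.
  + by move=> u l v w /=; rewrite mulrDr scalerAr.
  + by move=> j k u v uj vk; rewrite subn0; exact: ordgeM.
  + exact: poissonM.
- move=> f g; apply: (@lie_bilinear _ _ _ hl e ho (@poisson n K) 2%N).
  + exact: poisson_linearl.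
  + exact: poisson_linear.
  + exact: ordge_poisson.
  + exact: poisson_jacobi.
Qed.

Section OperatorLimit.
Variable T : nat -> S -> S.
Hypothesis T_stable : forall k f, ordge k.+1 (T k.+1 f - T k f).

(** By [T_stable] the coefficient of a monomial in [T k f] no longer changes once [k]
    has reached its degree. *)
Definition oplim f : S := fun a => T (mdeg a) f a.

Lemma oplimE k f : ordge k.+1 (oplim f - T k f).
Proof.
have step a d : T (mdeg a + d) f a = T (mdeg a) f a.
  elim: d => [|d <-]; first by rewrite addn0.
  rewrite addnS; apply: (@ordge_trunc _ _ (mdeg a + d).+1); first exact: T_stable.
  by rewrite ltnS leq_addr.
move=> a; rewrite ltnS => ak; rewrite fpsBE /oplim -(step a (k - mdeg a)%N).
by rewrite subnKC// subrr.
Qed.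

Let oplimE' k f : ordge k (oplim f - T k f).
Proof. by apply: (@wge_le _ _ _ k.+1) => //; exact: oplimE. Qed.

Hypothesis T_auto : forall k, poisson_auto (T k).

(** A bilinear operation that lowers orders by at most [d] is continuous, so that its
    compatibility with the [T k] passes to the limit. *)
Lemma oplim_auto : poisson_auto oplim.
Proof.
have bil (B : S -> S -> S) d f g : (forall g, linear (B^~ g)) ->
   (forall f, linear (B f)) ->
   (forall j k f g, ordge j f -> ordge k g -> ordge (j + k - d) (B f g)) ->
   (forall k f g, T k (B f g) = B (T k f) (T k g)) ->
   oplim (B f g) = B (oplim f) (oplim g).
  move=> Bl Br Bo TB; apply: ordge_eq => N.
  apply: (@ordge_trans _ _ _ _ (B (T (N + d) f) (T (N + d) g))).
    rewrite -TB; apply: (@wge_le _ _ _ (N + d)%N); first by rewrite leq_addr.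
    exact: oplimE'.
  apply: ordge_sym; apply: (@ordge_trans _ _ _ _ (B (T (N + d) f) (oplim g))).
    rewrite -(linB (T := B^~ _)) //.
    apply: (@wge_le _ _ _ (N + d + 0 - d)%N); first lia.
    by apply: Bo => //; exact: oplimE'.
  rewrite -(linB (T := B _)) //.
  apply: (@wge_le _ _ _ (0 + (N + d) - d)%N); first lia.
  by apply: Bo => //; exact: oplimE'.
split.
- move=> l f g; apply/fpsP => a.
  by rewrite /oplim (pa_lin (T_auto _)).
- move=> N f fN a aN; rewrite /oplim; exact: (pa_ord (T_auto _) fN).
- by apply/fpsP => a; rewrite /oplim (pa_1 (T_auto _)).
- move=> f g; apply: (bil _ 0%N).
  + by move=> u l v w /=; rewrite mulrDl scalerAl.
  + by move=> u l v w /=; rewrite mulrDr scalerAr.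
  + by move=> j k u v uj vk; rewrite subn0; exact: ordgeM.
  + by move=> k u v; rewrite (pa_mul (T_auto k)).
- move=> f g; apply: (bil _ 2%N).
  + exact: poisson_linearl.
  + exact: poisson_linear.
  + exact: ordge_poisson.
  + by move=> k u v; rewrite (pa_poisson (T_auto k)).
Qed.

End OperatorLimit.

Lemma oplimK (T U : nat -> S -> S) : (forall k f, ordge k.+1 (T k.+1 f - T k f)) ->
  (forall k f, ordge k.+1 (U k.+1 f - U k f)) -> (forall k, poisson_auto (T k)) ->
  (forall k f, T k (U k f) = f) -> forall f, oplim T (oplim U f) = f.
Proof.
move=> Ts Us Ta TU f; apply: ordge_eq => N.
apply: (@ordge_trans _ _ _ _ (T N (oplim U f))).
  by apply: (@wge_le _ _ _ N.+1) => //; exact: oplimE.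
rewrite -{2}[f](TU N) -(linB _ _ (pa_lin (Ta N))).
apply: (pa_ord (Ta N)); apply: (@wge_le _ _ _ N.+1) => //; exact: oplimE.
Qed.

Section InfiniteProduct.
Variable h : nat -> S.
Hypothesis h_ord : forall k, ordge k.+3 (h k).

(** The newest factor of [fwd] acts last, while in its inverse [bwd] it acts first. *)
Fixpoint fwd k f : S := if k is j.+1 then lie (poisson (h j)) (fwd j f) else f.

Fixpoint bwd k f : S := if k is j.+1 then bwd j (lie (poisson (- h j)) f) else f.

Let hN_ord k : ordge k.+3 (- h k).
Proof. by apply: wgeN; exact: h_ord. Qed.

Lemma fwd_auto k : poisson_auto (fwd k).
Proof.
elim: k => [|k IH]; first exact: poisson_auto_id.
exact: (poisson_auto_comp (lie_poisson_auto (@h_ord k)) IH).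
Qed.

Lemma bwd_auto k : poisson_auto (bwd k).
Proof.
elim: k => [|k IH]; first exact: poisson_auto_id.
exact: (poisson_auto_comp IH (lie_poisson_auto (@hN_ord k))).
Qed.

Lemma fwd_stable k f : ordge k.+1 (fwd k.+1 f - fwd k f).
Proof.
have := lie_sub (D := poisson (h k)) (e := k) (fun N g => @ad_raises k _ N g (@h_ord k)).
by move=> /(_ 0%N (fwd k f)); apply.
Qed.

Lemma bwd_stable k f : ordge k.+1 (bwd k.+1 f - bwd k f).
Proof.
rewrite /= -(linB _ _ (pa_lin (bwd_auto k))); apply: (pa_ord (bwd_auto k)).
have := lie_sub (D := poisson (- h k)) (e := k) (fun N g => @ad_raises k _ N g (@hN_ord k)).
by move=> /(_ 0%N f); apply.
Qed.

Lemma lie_poissonNK k f : lie (poisson (- h k)) (lie (poisson (h k)) f) = f.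
Proof.
apply: (@lie_inv _ _ _ _ k); first exact: poisson_linear.
  by move=> g; rewrite poissonNl.
by move=> N g; apply: ad_raises.
Qed.

Lemma lie_poissonKN k f : lie (poisson (h k)) (lie (poisson (- h k)) f) = f.
Proof.
apply: (@lie_inv _ _ _ _ k); first exact: poisson_linear.
  by move=> g; rewrite poissonNl opprK.
by move=> N g; apply: ad_raises.
Qed.

Lemma fwdK k f : bwd k (fwd k f) = f.
Proof. by elim: k f => //= k IH f; rewrite lie_poissonNK IH. Qed.

Lemma bwdK k f : fwd k (bwd k f) = f.
Proof. by elim: k f => //= k IH f; rewrite IH lie_poissonKN. Qed.

Definition fwd_lim := oplim fwd.
Definition bwd_lim := oplim bwd.

Lemma fwd_lim_auto : poisson_auto fwd_lim.
Proof. exact: oplim_auto fwd_stable fwd_auto. Qed.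

Lemma bwd_lim_auto : poisson_auto bwd_lim.
Proof. exact: oplim_auto bwd_stable bwd_auto. Qed.

Lemma fwd_limK f : bwd_lim (fwd_lim f) = f.
Proof. exact: oplimK bwd_stable fwd_stable bwd_auto fwdK f. Qed.

Lemma bwd_limK f : fwd_lim (bwd_lim f) = f.
Proof. exact: oplimK fwd_stable bwd_stable fwd_auto bwdK f. Qed.

End InfiniteProduct.
End PoissonAutomorphisms.

(** * Weighted norms on polydiscs *)

(** The norm of [K] takes its values in [K] itself. Estimates are made with values in a
    totally ordered field, where linear arithmetic applies. *)
Record absval (K : numFieldType) (R : realFieldType) := AbsVal {
  av :> K -> R;
  av_ge0 : forall x, 0 <= av x;
  avD : forall x y, av (x + y) <= av x + av y;
  avM : forall x y, av (x * y) = av x * av y;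
  avN : forall x, av (- x) = av x;
  av_nat : forall k : nat, av k%:R = k%:R;
  av_eq0 : forall x, (av x == 0) = (x == 0) }.

Section AbsVal.
Variables (K : numFieldType) (R : realFieldType) (av : absval K R).

Lemma av0 : av 0 = 0. Proof. exact: (av_nat av 0). Qed.
Lemma av1 : av 1 = 1. Proof. exact: (av_nat av 1). Qed.

Lemma av_sum I (r : seq I) (P : pred I) (F : I -> K) :
  av (\sum_(i <- r | P i) F i) <= \sum_(i <- r | P i) av (F i).
Proof.
elim/big_rec2: _ => [|i y x _ le]; first by rewrite av0.
by apply: le_trans (avD _ _ _) _; rewrite lerD2l.
Qed.

Lemma avV x : av x^-1 = (av x)^-1.
Proof.
have [->|x0] := eqVneq x 0; first by rewrite invr0 av0 invr0.
have ax0 : av x != 0 by rewrite av_eq0.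
by apply: (mulfI ax0); rewrite -avM !divff// av1.
Qed.

Lemma avX x k : av (x ^+ k) = av x ^+ k.
Proof. by elim: k => [|k IH]; rewrite ?expr0 ?av1// !exprS avM IH. Qed.

End AbsVal.

Section RealInequalities.
Variable R : realFieldType.
Implicit Types (x y : R).

Lemma expr_derivative_le d x y : 0 <= y -> y <= x ->
  d.+1%:R * y ^+ d * (x - y) <= x ^+ d.+1.
Proof.
move=> y0 yx; suff : d.+1%:R * y ^+ d * (x - y) <= x ^+ d.+1 - y ^+ d.+1.
  by move=> /le_trans; apply; rewrite gerBl exprn_ge0.
elim: d => [|d IH]; first by rewrite expr0 !mul1r !expr1.
have yA : y * (d.+1%:R * y ^+ d * (x - y)) <= x * (x ^+ d.+1 - y ^+ d.+1).
  apply: le_trans (ler_wpM2l y0 IH) _; apply: ler_wpM2r => //.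
  by rewrite subr_ge0 lerXn2r// nnegrE//; lra.
have -> : x ^+ d.+2 - y ^+ d.+2 =
    x * (x ^+ d.+1 - y ^+ d.+1) + y ^+ d.+1 * (x - y).
  by rewrite [x ^+ d.+2]exprS [y ^+ d.+2]exprS; ring.
have -> : d.+2%:R * y ^+ d.+1 * (x - y) =
    y * (d.+1%:R * y ^+ d * (x - y)) + y ^+ d.+1 * (x - y).
  by rewrite -natr1 [y ^+ d.+1]exprS; ring.
by rewrite lerD2r.
Qed.

(** Both [k ^ k <= 'C(2 k, k) * k`!], comparing factors, and ['C(2 k, k) <= 4 ^ k]. *)
Lemma expn_le_fact k : (k%:R ^+ k : R) <= 4%:R ^+ k * k`!%:R.
Proof.
rewrite -!natrX -natrM ler_nat.
have h : (k ^ k <= 'C(k + k, k) * k`!)%N.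
  have -> : (k ^ k = \prod_(i < k) k)%N by rewrite prod_nat_const card_ord.
  rewrite bin_ffact ffact_prod leq_prod// => i _.
  by have := ltn_ord i; lia.
apply: leq_trans h _; rewrite leq_mul2r -[4%N]/(2 * 2)%N expnMn -expnD.
apply/orP; right; rewrite -[2%N]/(1 + 1)%N expnDn.
have kk : (k < (k + k).+1)%N by rewrite ltnS leq_addr.
by rewrite (bigD1 (Ordinal kk))//= !exp1n !muln1 leq_addr.
Qed.

End RealInequalities.

Section Norm.
Variables (m : nat) (K : numFieldType) (R : realFieldType) (av : absval K R).
Local Notation S := (fps m K).
Implicit Types (f g h : S) (a b c : mindex m) (i : 'I_m) (k d N : nat) (x y M : R).

Lemma sum_sub_le (s t : seq (mindex m)) (F : mindex m -> R) :
  uniq s -> uniq t -> {subset s <= t} -> (forall a, 0 <= F a) ->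
  \sum_(a <- s) F a <= \sum_(a <- t) F a.
Proof.
move=> us ut st F0; rewrite [leRHS](bigID (mem s)) /=.
rewrite -[X in _ <= X + _]big_filter.
have ps : perm_eq [seq a <- t | mem s a] s.
  apply: uniq_perm; rewrite ?filter_uniq// => a; rewrite mem_filter andb_idr//.
  by move=> /st.
by rewrite [X in _ <= X + _](perm_big _ ps) lerDl sumr_ge0.
Qed.

Definition nterm x f a : R := av (f a) * x ^+ mdeg a.

(** Boundedness of all the finite partial sums; no value has to be attached to an
    infinite sum. *)
Definition normle x f M := forall N, \sum_(a <- box m N) nterm x f a <= M.

Lemma nterm_ge0 x f a : 0 <= x -> 0 <= nterm x f a.
Proof. by move=> x0; rewrite mulr_ge0 ?av_ge0 ?exprn_ge0. Qed.

Lemma normle_ge0 x f M : normle x f M -> 0 <= M.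
Proof.
move=> /(_ 0%N); have [[i]|m0] := pselect (exists i : 'I_m, True).
  rewrite big1_seq// => a /=; rewrite mem_box => /forallP/(_ i)//.
by apply: le_trans; apply: sumr_ge0 => a _; rewrite /nterm (_ : a = 0) ?mdeg0 ?expr0 ?mulr1 ?av_ge0//;
  apply/ffunP => i; case: m0; exists i.
Qed.

Lemma normle_le x f M M' : M <= M' -> normle x f M -> normle x f M'.
Proof. by move=> MM fM N; apply: le_trans (fM N) MM. Qed.

Lemma normle_coef x f g M : 0 <= x -> (forall a, av (g a) <= av (f a)) ->
  normle x f M -> normle x g M.
Proof.
move=> x0 gf fM N; apply: le_trans (fM N); apply: ler_sum => a _.
by rewrite ler_wpM2r ?exprn_ge0.
Qed.

Lemma normle_mono x y f M : 0 <= y -> y <= x -> normle x f M -> normle y f M.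
Proof.
move=> y0 yx fM N; apply: le_trans (fM N); apply: ler_sum => a _.
by rewrite ler_wpM2l ?av_ge0// lerXn2r// nnegrE; lra.
Qed.

Lemma normleD x f g A B : 0 <= x -> normle x f A -> normle x g B ->
  normle x (f + g) (A + B).
Proof.
move=> x0 fA gB N; apply: le_trans (lerD (fA N) (gB N)); rewrite -big_split.
apply: ler_sum => a _ /=; rewrite /nterm -mulrDl ler_wpM2r ?exprn_ge0//.
exact: avD.
Qed.

Lemma normleZ x (l : K) f M : normle x f M -> normle x (l *: f) (av l * M).
Proof.
move=> fM N; have := ler_wpM2l (av_ge0 av l) (fM N); rewrite mulr_sumr.
by apply: le_trans; apply: ler_sum => a _; rewrite /nterm fpsZE avM mulrA.
Qed.

Lemma normleN x f M : normle x f M -> normle x (- f) M.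
Proof.
by move=> fM N; apply: le_trans (fM N); apply: ler_sum => a _; rewrite /nterm fpsNE avN.
Qed.

Lemma normleB x f g A B : 0 <= x -> normle x f A -> normle x g B ->
  normle x (f - g) (A + B).
Proof. by move=> x0 fA gB; apply: normleD => //; exact: normleN. Qed.

Lemma normle_zero x : normle x 0 0.
Proof. by move=> N; rewrite big1// => a _; rewrite /nterm fps0E av0 mul0r. Qed.

Lemma normle_sum x I (r : seq I) (F : I -> S) (M : I -> R) : 0 <= x ->
  (forall l, normle x (F l) (M l)) -> normle x (\sum_(l <- r) F l) (\sum_(l <- r) M l).
Proof.
move=> x0 FM; elim/big_rec2: _ => [|l A f _ fA]; first exact: normle_zero.
exact: normleD.
Qed.

Lemma normleM x f g A B : 0 <= x -> normle x f A -> normle x g B ->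
  normle x (f * g) (A * B).
Proof.
move=> x0 fA gB N.
have fN0 : 0 <= \sum_(a <- box m N) nterm x f a.
  by apply: sumr_ge0 => a _; exact: nterm_ge0.
have gN0 : 0 <= \sum_(a <- box m N) nterm x g a.
  by apply: sumr_ge0 => a _; exact: nterm_ge0.
apply: le_trans (ler_pM fN0 gN0 (fA N) (gB N)).
apply: (@le_trans _ _ (\sum_(c <- box m N) \sum_(a <- box m N) \sum_(b <- box m N)
   (if c == a + b then nterm x f a * nterm x g b else 0))).
  rewrite big_seq [leRHS]big_seq; apply: ler_sum => c cN.
  rewrite /nterm (fpsME _ _ cN).
  apply: le_trans (ler_wpM2r (exprn_ge0 _ x0) (av_sum av _ _ _)) _.
  rewrite mulr_suml; apply: ler_sum => a _.
  apply: le_trans (ler_wpM2r (exprn_ge0 _ x0) (av_sum av _ _ _)) _.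
  rewrite mulr_suml; apply: ler_sum => b _; rewrite eq_sym.
  case: eqP => [->|_]; last by rewrite av0 mul0r.
  by rewrite avM mdegD exprD mulrACA.
rewrite exchange_big /= mulr_suml; apply: ler_sum => a _.
rewrite exchange_big /= mulr_sumr; apply: ler_sum => b _.
have [abN|abN] := boolP (a + b \in box m N).
  by rewrite (sum_box1 (fun=> nterm x f a * nterm x g b)).
rewrite big1_seq; first by rewrite mulr_ge0 ?nterm_ge0.
by move=> c /= cN; case: eqP => // cab; rewrite cab (negbTE abN) in cN.
Qed.

Lemma sum_box_shift N (F : mindex m -> R) c : (forall a, 0 <= F a) ->
  \sum_(a <- box m N) F (a + c) <= \sum_(a <- box m (N + (mdeg c).+1)) F a.
Proof.
move=> F0; rewrite -(big_map (fun a => a + c) xpredT F).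
apply: sum_sub_le => //.
- by rewrite map_inj_uniq ?uniq_box//; exact: mindexDI.
- exact: uniq_box.
- move=> _ /mapP[a aN ->]; apply: box_add => //; exact: mdeg_box.
Qed.

(** Cauchy's estimate, which for one monomial of degree [d.+1] is
    [d.+1%:R * y ^+ d * (x - y) <= x ^+ d.+1]. *)
Lemma normle_partial i x y f M : 0 <= y -> y < x -> normle x f M ->
  normle y (partial i f) (M / (x - y)).
Proof.
move=> y0 yx fM N; have xy : 0 < x - y by lra.
have x0 : 0 <= x by lra.
rewrite ler_pdivlMr// mulr_suml; apply: le_trans (fM (N + (mdeg (munit i)).+1)%N).
apply: le_trans (@sum_box_shift N (nterm x f) (munit i) (fun a => nterm_ge0 _ _ x0)).
apply: ler_sum => a _; rewrite /nterm /partial avM av_nat.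
rewrite mdegD mdeg_unit addn1 [_.+1%:R * _]mulrC -!mulrA ler_wpM2l ?av_ge0//.
apply: le_trans (expr_derivative_le (mdeg a) y0 (ltW yx)); rewrite mulrA.
rewrite ler_wpM2r ?(ltW xy)// ler_wpM2r ?exprn_ge0// ler_nat ltnS.
exact: leq_mdeg.
Qed.

(** Division by small divisors is majorized by iterates of this operator. *)
Definition deg_mul f : S := fun a => (mdeg a)%:R * f a.

Lemma normle_deg_mul x y f M : 0 <= y -> y < x -> normle x f M ->
  normle y (deg_mul f) (M * (x / (x - y))).
Proof.
move=> y0 yx fM N; have xy : 0 < x - y by lra.
have x0 : 0 <= x by lra.
rewrite mulrA ler_pdivlMr// mulr_suml mulrC.
apply: le_trans (ler_wpM2l x0 (fM N)); rewrite mulr_sumr; apply: ler_sum => a _.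
rewrite /nterm /deg_mul avM av_nat [X in _ <= X]mulrCA [_%:R * _]mulrC -!mulrA.
rewrite ler_wpM2l ?av_ge0//; case: (mdeg a) => [|d].
  by rewrite mul0r mulr_ge0 ?exprn_ge0.
have dE : d.+1%:R * (y ^+ d.+1 * (x - y)) = y * (d.+1%:R * y ^+ d * (x - y)).
  by rewrite exprS; ring.
rewrite dE; apply: ler_pM => //; last by apply: expr_derivative_le => //; exact: ltW.
  by rewrite !mulr_ge0 ?exprn_ge0// ltW.
exact: ltW.
Qed.

Lemma normle_deg_pow T x e f M : 0 < e -> e * T%:R <= x -> normle x f M ->
  normle (x - e * T%:R) (iter T deg_mul f) (M * (x / e) ^+ T).
Proof.
move=> e0; elim: T => [|T IH]; first by rewrite !mulr0 subr0 expr0 mulr1.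
rewrite -natr1 mulrDr mulr1 => Tx fM.
have {}IH := IH ltac:(lra) fM.
have T0 : 0 <= e * T%:R by rewrite mulr_ge0// ltW.
have := @normle_deg_mul (x - e * T%:R) (x - (e * T%:R + e)) _ _ _ _ IH.
have -> : x - e * T%:R - (x - (e * T%:R + e)) = e by ring.
move=> /(_ ltac:(lra) ltac:(lra)); apply: normle_le.
rewrite exprSr [leRHS]mulrA ler_wpM2l ?(normle_ge0 IH)//.
by rewrite ler_pM2r ?invr_gt0//; lra.
Qed.

(** A finite box only sees coefficients on which the limit coincides with one [T k]. *)
Lemma normle_oplim x (T : nat -> S -> S) f M : 
  (forall k f, ordge k.+1 (T k.+1 f - T k f)) ->
  (forall k, normle x (T k f) M) -> normle x (fun a => T (mdeg a) f a) M.
Proof.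
move=> Ts TM N; apply: le_trans (TM (m * N).+1 N).
have step d a : T (mdeg a + d)%N f a = T (mdeg a) f a.
  elim: d => [|d <-]; first by rewrite addn0.
  rewrite addnS; apply: (@ordge_trunc _ _ (mdeg a + d).+1); first exact: Ts.
  by rewrite ltnS leq_addr.
rewrite big_seq [leRHS]big_seq; apply: ler_sum => a /box_mdeg aN.
by rewrite /nterm -(step ((m * N).+1 - mdeg a)%N) subnKC// ltnW.
Qed.

(** Each monomial of the series has degree at least [d] and gains at least
    [(x / r) ^+ d]. *)
Lemma normle_order x d f M r : 0 < r -> 0 <= x -> x <= r -> ordge d f ->
  normle r f M -> normle x f (M * (x / r) ^+ d).
Proof.
move=> r0 x0 xr fd fM N; rewrite [M * _]mulrC.
have q0 : 0 <= x / r by rewrite divr_ge0// ltW.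
apply: le_trans (ler_wpM2l (exprn_ge0 d q0) (fM N)); rewrite mulr_sumr.
apply: ler_sum => a _; have [ad|da] := ltnP (mdeg a) d.
  by rewrite /nterm fd// av0 !mul0r mulr0.
rewrite /nterm mulrCA ler_wpM2l ?av_ge0//.
have [k ->] : exists k, mdeg a = (k + d)%N by exists (mdeg a - d)%N; rewrite subnK.
have -> : (x / r) ^+ d * r ^+ (k + d) = r ^+ k * x ^+ d.
  rewrite exprD expr_div_n; field.
  by rewrite expf_neq0// gt_eqF.
by rewrite exprD ler_wpM2r ?exprn_ge0// lerXn2r// nnegrE; lra.
Qed.

End Norm.

(** * Norm estimates for brackets and Lie series *)

Section PoissonNorm.
Variables (n : nat) (K : numFieldType) (R : realFieldType) (av : absval K R).
Local Notation S := (fps (n + n) K).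
Implicit Types (f g h : S) (k N : nat) (x y M : R).
Local Notation c2 := ((n + n)%:R : R).

Lemma normle_poisson_partial y h g A B : 0 <= y ->
  (forall j, normle av y (partial j h) A) -> (forall j, normle av y (partial j g) B) ->
  normle av y (poisson h g) (c2 * A * B).
Proof.
move=> y0 hA gB; have -> : c2 * A * B = \sum_(i < n) (A * B + A * B).
  by rewrite sumr_const card_ord -[_ *+ n]mulr_natl natrD; ring.
by apply: normle_sum => // i; apply: normleB => //; apply: normleM => //; [exact: hA|exact: gB|exact: hA|exact: gB].
Qed.

Lemma normle_poisson x y f g A B : 0 <= y -> y < x ->
  normle av x f A -> normle av x g B ->
  normle av y (poisson f g) (c2 * (A / (x - y)) * (B / (x - y))).
Proof.
by move=> y0 yx fA gB; apply: normle_poisson_partial => // j; apply: normle_partial.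
Qed.

Section LieNorm.
Variables (h : S) (x0 eta : R).
Hypothesis h_ord : ordge 3 h.
Hypothesis eta0 : 0 <= eta.
Hypothesis h_eta : forall j, normle av x0 (partial j h) eta.

Lemma normle_iter_ad x e j f M : 0 < e -> e * j%:R <= x -> x <= x0 ->
  normle av x f M ->
  normle av (x - e * j%:R) (iter j (poisson h) f) ((c2 * eta / e) ^+ j * M).
Proof.
move=> e0; elim: j => [|j IH]; first by rewrite !mulr0 subr0 expr0 mul1r.
rewrite -natr1 mulrDr mulr1 => jx xx0 fM.
have {}IH := IH ltac:(lra) xx0 fM.
have j0 : 0 <= e * j%:R by rewrite mulr_ge0// ltW.
have -> : (c2 * eta / e) ^+ j.+1 * M = c2 * eta * ((c2 * eta / e) ^+ j * M / e).
  by rewrite exprS; ring.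
apply: normle_poisson_partial => [|i|i]; first lra.
  by apply: (@normle_mono _ _ _ _ x0); [lra|lra|exact: h_eta].
have := @normle_partial _ _ _ av i (x - e * j%:R) (x - (e * j%:R + e)) _ _ _ _ IH.
have -> : x - e * j%:R - (x - (e * j%:R + e)) = e by ring.
apply; lra.
Qed.

(** The [k] brackets share the width [x - y], each on a layer of width [(x - y) / k];
    the resulting factor [k ^ k] is absorbed by [k`!] up to [4 ^ k]. *)
Lemma normle_dpow x y k f M : 0 <= y -> y < x -> x <= x0 -> normle av x f M ->
  normle av y (dpow (poisson h) k f) ((4%:R * c2 * eta / (x - y)) ^+ k * M).
Proof.
move=> y0 yx xx0 fM; case: k => [|k].
  rewrite dpow0 expr0 mul1r; apply: normle_mono fM; lra.
set e := (x - y) / k.+1%:R.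
have k0 : 0 < k.+1%:R :> R by rewrite ltr0n.
have e0 : 0 < e by rewrite divr_gt0//; lra.
have ek : e * k.+1%:R = x - y by rewrite divfK// gt_eqF.
have := @normle_iter_ad x e k.+1 f M e0 ltac:(rewrite ek; lra) xx0 fM.
rewrite ek; have -> : x - (x - y) = y by ring.
have M0 := normle_ge0 fM.
have xy : 0 < x - y by lra.
move=> /(normleZ ((k.+1)`!%:R^-1)); apply: normle_le.
rewrite avV av_nat [leLHS]mulrA; apply: ler_wpM2r => //; rewrite ler_pdivrMl ?ltr0n ?fact_gt0//.
have -> : c2 * eta / e = k.+1%:R * (c2 * eta / (x - y)).
  by rewrite /e invf_div; ring.
have -> : 4%:R * c2 * eta / (x - y) = 4%:R * (c2 * eta / (x - y)) by ring.
have : 0 <= c2 * eta / (x - y) by rewrite divr_ge0 ?mulr_ge0// ltW.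
move: (c2 * eta / (x - y)) => q q0.
rewrite !exprMn [leRHS]mulrA; apply: ler_wpM2r; first exact: exprn_ge0.
by rewrite mulrC; exact: expn_le_fact.
Qed.

(** The tail of a geometric series of ratio [theta <= 1/2] is at most twice its first
    term. *)
Lemma normle_lie x y theta d f M : 0 <= y -> y < x -> x <= x0 ->
  4%:R * c2 * eta / (x - y) <= theta -> theta <= 1 / 2%:R ->
  normle av x f M ->
  normle av y (lie (poisson h) f - lie_trunc (poisson h) d f) (2%:R * theta ^+ d * M).
Proof.
move=> y0 yx xx0 thetaP theta2 fM N; set L := ((n + n) * N).+1%N.
have M0 := normle_ge0 fM; have xy : 0 < x - y by lra.
have q0 : 0 <= 4%:R * c2 * eta / (x - y) by rewrite divr_ge0 ?mulr_ge0// ltW.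
have theta0 : 0 <= theta by exact: le_trans thetaP.
pose T (k : nat) := \sum_(a <- box (n + n) N) nterm av y (dpow (poisson h) k f) a.
have TM k : T k <= theta ^+ k * M.
  apply: le_trans (@normle_dpow _ _ k _ _ y0 yx xx0 fM N) _.
  by rewrite ler_wpM2r// lerXn2r// nnegrE.
apply: (@le_trans _ _ (\sum_(k < L) T (k + d)%N)).
  rewrite /T exchange_big big_seq [leRHS]big_seq; apply: ler_sum => a /box_mdeg aN /=; rewrite /nterm.
  rewrite (@lie_tail _ _ _ 0 (fun N g => @ad_raises _ _ 0 _ N g h_ord) d L); last first.
    by apply: leq_trans aN _; rewrite leq_addr.
  rewrite -mulr_suml ler_wpM2r ?exprn_ge0//; exact: av_sum.
apply: (@le_trans _ _ (\sum_(k < L) theta ^+ (k + d) * M)).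
  by apply: ler_sum => k _; exact: TM.
rewrite -mulr_suml ler_wpM2r//.
under eq_bigr => k _ do rewrite exprD.
rewrite -mulr_suml ler_wpM2r ?exprn_ge0//.
suff : \sum_(k < L) theta ^+ k <= 2%:R * (1 - theta ^+ L).
  by have := exprn_ge0 L theta0; lra.
elim: (L) => [|l IH]; first by rewrite big_ord0 expr0 subrr mulr0.
rewrite big_ord_recr /=; apply: le_trans (lerD IH (lexx _)) _.
have : 0 <= theta ^+ l by rewrite exprn_ge0.
by rewrite exprS; nra.
Qed.

End LieNorm.
End PoissonNorm.

(** * The homological equation and the formal Newton step *)

Section Homological.
Variables (n : nat) (K : numFieldType).
Local Notation S := (fps (n + n) K).
Implicit Types (f g h : S) (k N : nat) (a : mindex (n + n)).
Variable lambda : 'I_n -> K.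

Definition quad : S :=
  \sum_i lambda i *: (fps_X K (lshift n i) * fps_X K (rshift n i)).

Definition freq a : K :=
  \sum_i lambda i * ((a (lshift n i))%:R - (a (rshift n i))%:R).

Lemma dq_quad i : dq i quad = lambda i *: fps_X K (rshift n i).
Proof.
rewrite /dq /quad partial_sum (bigD1 i)//= big1 ?addr0; last first.
  move=> j ji; rewrite partialZ partialM !partial_X eq_lshift eq_lrshift.
  by rewrite eq_sym (negbTE ji) mulr0n mul0r mulr0 addr0 scaler0.
by rewrite partialZ partialM !partial_X eqxx eq_lrshift mul1r mulr0 addr0.
Qed.

Lemma dp_quad i : dp i quad = lambda i *: fps_X K (lshift n i).
Proof.
rewrite /dp /quad partial_sum (bigD1 i)//= big1 ?addr0; last first.
  move=> j ji; rewrite partialZ partialM !partial_X eq_rshift eq_rlshift.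
  by rewrite eq_sym (negbTE ji) mulr0n mul0r mulr0 addr0 scaler0.
by rewrite partialZ partialM !partial_X eqxx eq_rlshift mulr1 mul0r add0r.
Qed.

Lemma poisson_quad f a : poisson f quad a = freq a * f a.
Proof.
rewrite /poisson fps_sumE /freq mulr_suml; apply: eq_bigr => i _.
rewrite dq_quad dp_quad -!scalerAr fpsBE !fpsZE.
rewrite ![_ * fps_X _ _]mulrC /dq /dp !euler_partial /euler; ring.
Qed.

Lemma ordge_quad : ordge 2 quad.
Proof.
apply: wge_sum => i _; apply: wgeZ; rewrite -[2%N]/(1 + 1)%N.
by apply: ordgeM; exact: ordge_X.
Qed.

(** Division by zero is zero, so the resonant monomials are discarded. *)
Definition homological_inv f : S := fun a => f a / freq a.

Definition vproj (j : nat) f : S := fun a => if qpval a == j then f a else 0.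

(** The representative of a class modulo the square of the ideal of the [q_i p_i]
    which is supported on the monomials outside it. *)
Definition modI2 f : S := fun a => if (qpval a < 2)%N then f a else 0.

Lemma vprojD j f g : vproj j (f + g) = vproj j f + vproj j g.
Proof. by apply/fpsP => a; rewrite fpsDE /vproj fpsDE; case: ifP; rewrite ?addr0. Qed.

Lemma modI2D f g : modI2 (f + g) = modI2 f + modI2 g.
Proof. by apply/fpsP => a; rewrite fpsDE /modI2 fpsDE; case: ifP; rewrite ?addr0. Qed.

Lemma modI2_proj f : modI2 f = vproj 0 f + vproj 1 f.
Proof.
apply/fpsP => a; rewrite fpsDE /modI2 /vproj.
by case: (qpval a) => [|[|k]]; rewrite ?addr0 ?add0r.
Qed.

Lemma ordge_vproj j N f : ordge N f -> ordge N (vproj j f).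
Proof. by move=> fN a aN; rewrite /vproj fN// if_same. Qed.

Lemma ordge_modI2 N f : ordge N f -> ordge N (modI2 f).
Proof. by move=> fN a aN; rewrite /modI2 fN// if_same. Qed.

Lemma vproj_modI2 j f : (j < 2)%N -> vproj j (modI2 f) = vproj j f.
Proof.
by move=> j2; apply/fpsP => a; rewrite /vproj /modI2; case: eqP => // ->; rewrite j2.
Qed.

Lemma ordge_homological_inv N f : ordge N f -> ordge N (homological_inv f).
Proof. by move=> fN a aN; rewrite /homological_inv fN// mul0r. Qed.

Lemma valge_vproj j f : valge j (vproj j f).
Proof. by move=> a aj; rewrite /vproj; case: eqP aj => // ->; rewrite ltnn. Qed.

Lemma valge_homological_inv N f : valge N f -> valge N (homological_inv f).
Proof. by move=> fN a aN; rewrite /homological_inv fN// mul0r. Qed.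

Lemma modI2_eq0 f : modI2 f = 0 <-> valge 2 f.
Proof.
split=> [f0 a a2|f2]; first by have := congr1 (@^~ a) f0; rewrite /modI2 a2.
by apply/fpsP => a; rewrite /modI2; case: ltnP => // /f2.
Qed.

Lemma vproj_valge j f : valge j.+1 f -> vproj j f = 0.
Proof.
by move=> fj; apply/fpsP => a; rewrite /vproj; case: eqP => // aj; rewrite fj// aj.
Qed.

Hypothesis freq_eq0 : forall a, freq a = 0 ->
  forall i, a (lshift n i) = a (rshift n i).

Lemma resonant_mdeg a : freq a = 0 -> mdeg a = (2 * qpval a)%N.
Proof.
move=> /freq_eq0 aE; rewrite /mdeg /qpval big_split_ord /=.
rewrite mul2n -addnn; congr (_ + _)%N; apply: eq_bigr => i _.
  by rewrite aE minnn.
by rewrite -aE minnn.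
Qed.

(** A resonant monomial of valuation at most 1 is constant or some [q_i p_i]; from
    order 3 on no resonance obstructs the homological equation modulo [I^2]. *)
Lemma homological_invP j f : (j < 2)%N -> ordge 3 f ->
  poisson (homological_inv (vproj j f)) quad = vproj j f.
Proof.
move=> j2 f3; apply/fpsP => a; rewrite poisson_quad /homological_inv.
have [a0|a0] := eqVneq (freq a) 0; last by rewrite mulrC divfK.
rewrite a0 mul0r /vproj; case: eqP => // aj; rewrite f3//.
by rewrite resonant_mdeg// aj; case: j j2 {aj} => [|[|]].
Qed.

Section NewtonStep.
Variable P : S.
Hypothesis P3 : ordge 3 P.

(** The equation [{h, quad} = - (P + {h, P})] modulo [I^2], solved up to quadratic
    terms in two stages. [newton_h0] removes the part of [P] outside [I]; its bracket
    with the part of [P] in [I^2] is not small, but lies in [I], and [newton_h1] takes it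
    into account together with the rest of [P]. *)
Definition newton_h0 : S := - homological_inv (vproj 0 P).
Definition newton_h1 : S := - homological_inv (vproj 1 (P + poisson newton_h0 P)).
Definition newton_h : S := newton_h0 + newton_h1.
Definition newton_next : S := lie (poisson newton_h) (quad + P) - quad.

Lemma ordge_newton_h0 k : ordge k.+3 (modI2 P) -> ordge k.+3 newton_h0.
Proof.
move=> Pk; apply/wgeN/ordge_homological_inv.
by rewrite -vproj_modI2//; exact: ordge_vproj.
Qed.

Let P0 : ordge 3 (modI2 P). Proof. exact: ordge_modI2. Qed.

Let bracket_ord k h f : ordge k.+3 h -> ordge 3 f -> ordge k.+4 (poisson h f).
Proof.
move=> hk f3; have le : (k.+4 <= k.+3 + 3 - 2)%N by lia.
by apply: (wge_le le); apply: ordge_poisson.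
Qed.

Lemma ordge_newton_h1 k : ordge k.+3 (modI2 P) -> ordge k.+3 newton_h1.
Proof.
move=> Pk; apply/wgeN/ordge_homological_inv; rewrite vprojD; apply: wgeD.
  by rewrite -vproj_modI2//; exact: ordge_vproj.
apply: ordge_vproj; apply: (@wge_le _ _ _ k.+4) => //.
by apply: bracket_ord => //; exact: ordge_newton_h0.
Qed.

Lemma ordge_newton_h k : ordge k.+3 (modI2 P) -> ordge k.+3 newton_h.
Proof. by move=> Pk; apply: wgeD; [exact: ordge_newton_h0|exact: ordge_newton_h1]. Qed.

Definition newton_quadratic : S :=
  vproj 0 (poisson newton_h0 (modI2 P)) + modI2 (poisson newton_h1 (modI2 P)).

Definition newton_rest : S :=
  lie (poisson newton_h) (quad + P) - lie_trunc (poisson newton_h) 2 (quad + P).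

(** The part of [P] in [I^2] does not get smaller along the iteration. Its bracket with
    [newton_h0] is in [I], so that modulo [I^2] it is a term which [newton_h1] cancels,
    and its bracket with [newton_h1], which is in [I], is in [I^2]. Hence only brackets
    with [modI2 P] remain beside the tail of the Lie series, and these are quadratic in
    [modI2 P]. *)
Lemma newton_residual :
  modI2 newton_next = newton_quadratic + modI2 newton_rest.
Proof.
(* [G] is the part of [P] in the square of the ideal. *)
pose G := P - modI2 P.
have G2 : valge 2 G.
  by move=> a a2; rewrite /G fpsBE /modI2 a2 subrr.
have PE : P = modI2 P + G by rewrite addrC subrK.
have h0G : vproj 0 (poisson newton_h0 G) = 0.
  apply: vproj_valge; apply: (@valge_poisson _ _ 0 2) => //; exact: wge0.
have h1v : valge 1 newton_h1.
  by apply/wgeN/valge_homological_inv/valge_vproj.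
have h1G : modI2 (poisson newton_h1 G) = 0.
  by apply/modI2_eq0; apply: (@valge_poisson _ _ 1 2).
have h0H : poisson newton_h0 quad = - vproj 0 P.
  by rewrite poissonNl homological_invP.
have h1H : poisson newton_h1 quad = - vproj 1 (P + poisson newton_h0 P).
  rewrite poissonNl homological_invP//; apply: wgeD => //.
  apply: (@wge_le _ _ _ 4) => //; apply: bracket_ord => //.
  exact: ordge_newton_h0.
have -> : newton_next = newton_rest + (P + poisson newton_h quad + poisson newton_h P).
  rewrite /newton_next /newton_rest /lie_trunc !big_ord_recl big_ord0 addr0 dpow0.
  rewrite /dpow /= -[(bump 0 0)`!]/1%N invr1 scale1r poissonDr.
  by ring.
rewrite modI2D addrC; congr (_ + _).
have modv j f : (j < 2)%N -> modI2 (vproj j f) = vproj j f.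
  by move=> j2; apply/fpsP => a; rewrite /modI2 /vproj; case: eqP => [->|_];
    rewrite ?j2 ?if_same.
have modN f : modI2 (- f) = - modI2 f.
  by apply/fpsP => a; rewrite fpsNE /modI2 fpsNE; case: ifP; rewrite ?oppr0.
have h1E : modI2 (poisson newton_h1 P) = modI2 (poisson newton_h1 (modI2 P)).
  by rewrite [in LHS]PE poissonDr modI2D h1G addr0.
have h0E : vproj 0 (poisson newton_h0 P) = vproj 0 (poisson newton_h0 (modI2 P)).
  by rewrite [in LHS]PE poissonDr vprojD h0G addr0.
rewrite /newton_quadratic -h1E -h0E /newton_h !poissonDl h0H h1H.
rewrite !modI2D !modN !modv// [modI2 P]modI2_proj.
rewrite [modI2 (poisson newton_h0 P)]modI2_proj vprojD.
by ring.
Qed.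

End NewtonStep.
End Homological.

(** * Norms in the scale of the quadratic part *)

Section ScaledNorm.
Variables (n : nat) (K : numFieldType) (R : realFieldType) (av : absval K R).
Local Notation S := (fps (n + n) K).
Implicit Types (f g h P : S) (k N : nat) (a : mindex (n + n)) (s t u delta M : R).
Local Notation c2 := ((n + n)%:R : R).
Variables (lambda : 'I_n -> K) (r0 : R).
Hypothesis r0_gt0 : 0 < r0.

(** The norm on the polydisc of radius [r0 s], measured in units of [r0 ^+ 2]: in these
    units the quadratic part and the Poisson bracket do not depend on [r0]. *)
Definition nrm s f M := normle av (r0 * s) f (r0 ^+ 2 * M).

Lemma nrm_ge0 s f M : nrm s f M -> 0 <= M.
Proof. by move=> /normle_ge0; rewrite pmulr_rge0// exprn_gt0. Qed.

Lemma nrm_le s f M M' : M <= M' -> nrm s f M -> nrm s f M'.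
Proof. by move=> MM; apply: normle_le; rewrite ler_pM2l ?exprn_gt0. Qed.

Lemma nrm_mono s t f M : 0 <= t -> t <= s -> nrm s f M -> nrm t f M.
Proof.
move=> t0 ts; apply: normle_mono; first by rewrite mulr_ge0// ltW.
by rewrite ler_pM2l.
Qed.

Lemma nrmD s f g A B : 0 <= s -> nrm s f A -> nrm s g B -> nrm s (f + g) (A + B).
Proof.
by move=> s0 fA gB; rewrite /nrm mulrDr; apply: normleD => //; rewrite mulr_ge0// ltW.
Qed.

Lemma nrmN s f A : nrm s f A -> nrm s (- f) A.
Proof. exact: normleN. Qed.

Lemma nrm_coef s f g M : 0 <= s -> (forall a, av (g a) <= av (f a)) ->
  nrm s f M -> nrm s g M.
Proof. by move=> s0; apply: normle_coef; rewrite mulr_ge0// ltW. Qed.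

Lemma nrm_vproj s j f M : 0 <= s -> nrm s f M -> nrm s (vproj j f) M.
Proof.
by move=> s0; apply: nrm_coef => // a; rewrite /vproj; case: ifP; rewrite ?av0 ?av_ge0.
Qed.

Lemma nrm_modI2 s f M : 0 <= s -> nrm s f M -> nrm s (modI2 f) M.
Proof.
by move=> s0; apply: nrm_coef => // a; rewrite /modI2; case: ifP; rewrite ?av0 ?av_ge0.
Qed.

Lemma nrm_poisson s delta f g A B : 0 < delta -> delta <= s ->
  nrm s f A -> nrm s g B -> nrm (s - delta) (poisson f g) (c2 * A * B / delta ^+ 2).
Proof.
move=> d0 ds fA gB; have := @normle_poisson _ _ _ av (r0 * s) (r0 * (s - delta)) _ _ _ _ _ _ fA gB.
have -> : r0 * s - r0 * (s - delta) = r0 * delta by ring.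
have -> : c2 * (r0 ^+ 2 * A / (r0 * delta)) * (r0 ^+ 2 * B / (r0 * delta)) =
  r0 ^+ 2 * (c2 * A * B / delta ^+ 2) by field; rewrite !gt_eqF.
apply; first by rewrite pmulr_rge0// subr_ge0.
by rewrite ltr_pM2l//; lra.
Qed.

Lemma nrm_partial s delta j f A : 0 < delta -> delta <= s ->
  nrm s f A -> normle av (r0 * (s - delta)) (partial j f) (r0 * (A / delta)).
Proof.
move=> d0 ds fA; have := @normle_partial _ _ _ av j (r0 * s) (r0 * (s - delta)) _ _ _ _ fA.
have -> : r0 * s - r0 * (s - delta) = r0 * delta by ring.
have -> : r0 ^+ 2 * A / (r0 * delta) = r0 * (A / delta) by field; rewrite !gt_eqF.
apply; first by rewrite pmulr_rge0// subr_ge0.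
by rewrite ltr_pM2l//; lra.
Qed.

Lemma nrm_lie h u kappa t s theta d f M : ordge 3 h -> 0 <= kappa ->
  (forall j, normle av (r0 * u) (partial j h) (r0 * kappa)) ->
  0 <= t -> t < s -> s <= u -> 4%:R * c2 * kappa / (s - t) <= theta ->
  theta <= 1 / 2%:R -> nrm s f M ->
  nrm t (lie (poisson h) f - lie_trunc (poisson h) d f) (2%:R * theta ^+ d * M).
Proof.
move=> h3 k0 hk t0 ts su th1 th2 fM.
have := @normle_lie _ _ _ av h (r0 * u) (r0 * kappa) h3 _ hk (r0 * s) (r0 * t) theta d f _ _ _ _ _ th2 fM.
rewrite /nrm [r0 ^+ 2 * _]mulrC -[2%:R * theta ^+ d * (M * _)]mulrA => H.
rewrite [r0 ^+ 2 * _]mulrC -!mulrA in H *; apply: H.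
- by rewrite mulr_ge0// ltW.
- by rewrite mulr_ge0// ltW.
- by rewrite ltr_pM2l.
- by rewrite ler_pM2l.
- have st : 0 < s - t by rewrite subr_gt0.
  apply: le_trans th1; rewrite le_eqVlt; apply/orP; left; apply/eqP.
  by rewrite -mulrBr; field; rewrite !gt_eqF.
Qed.

Lemma nrm_X s (j : 'I_(n + n)) : 0 <= s -> normle av (r0 * s) (fps_X K j) (r0 * s).
Proof.
move=> s0 N.
have x0 : 0 <= r0 * s by rewrite mulr_ge0// ltW.
rewrite (eq_bigr (fun a => if a == munit j then r0 * s else 0)); last first.
  move=> a _; rewrite /nterm /fps_X /fps_mon; case: eqP => [->|_].
    by rewrite av1 mdeg_unit mul1r.
  by rewrite av0 mul0r.
have [jN|jN] := boolP (munit j \in box (n + n) N).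
  by rewrite (sum_box1 (fun=> r0 * s)).
rewrite big1_seq// => a /= aN; case: eqP => // aj; by rewrite -aj aN in jN.
Qed.

Definition quad_norm : R := \sum_i av (lambda i).

Lemma nrm_quad s : 0 <= s -> s <= 1 -> nrm s (quad lambda) quad_norm.
Proof.
move=> s0 s1; have x0 : 0 <= r0 * s by rewrite mulr_ge0// ltW.
rewrite /nrm /quad_norm mulr_sumr; apply: normle_sum => // i.
apply: normle_le (normleZ (lambda i) (normleM x0 (nrm_X _ s0) (nrm_X _ s0))).
rewrite mulrC; apply: ler_wpM2r; first exact: av_ge0.
rewrite expr2; apply: ler_pM => //; rewrite ger_pMr//.
Qed.

End ScaledNorm.

(** * The quadratic estimate for a Newton step *)

Section NewtonNorm.
Variables (n : nat) (K : numFieldType) (R : realFieldType) (av : absval K R).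
Local Notation S := (fps (n + n) K).
Implicit Types (f g h P : S) (k N : nat) (a : mindex (n + n)) (s t u delta M : R).
Local Notation c2 := ((n + n)%:R : R).
Variables (lambda : 'I_n -> K) (B : R) (T : nat).
Hypothesis freq_eq0 : forall a, freq lambda a = 0 ->
  forall i, a (lshift n i) = a (rshift n i).
Hypothesis B_ge0 : 0 <= B.
Hypothesis freq_ge : forall a, av (freq lambda a)^-1 <= B * (mdeg a)%:R ^+ T.

(** As a zero frequency has inverse 0, the bound on inverse frequencies holds for all
    monomials, and division costs [T] multiplications by the degree, each on a
    layer of width [delta]. *)
Lemma nrm_homological_inv (r0 : R) s delta f M : 0 < r0 -> 0 < delta ->
  delta * T%:R <= s -> s <= 1 -> nrm av r0 s f M ->
  nrm av r0 (s - delta * T%:R) (homological_inv lambda f) (B * M * delta^-1 ^+ T).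
Proof.
move=> r00 d0 ds s1 fM; have M0 := nrm_ge0 r00 fM.
have s0 : 0 <= s by apply: le_trans ds; rewrite mulr_ge0// ltW.
have e0 : 0 < r0 * delta by rewrite mulr_gt0.
have ex : r0 * delta * T%:R <= r0 * s by rewrite -mulrA ler_pM2l.
have := normle_deg_pow e0 ex fM; rewrite /nrm.
have -> : r0 * (s - delta * T%:R) = r0 * s - r0 * delta * T%:R by ring.
move=> H N.
apply: (@le_trans _ _ (B * (r0 ^+ 2 * M * (r0 * s / (r0 * delta)) ^+ T))); last first.
  have -> : r0 ^+ 2 * (B * M * delta^-1 ^+ T) = B * (r0 ^+ 2 * M * delta^-1 ^+ T).
    by ring.
  apply: ler_wpM2l => //; apply: ler_wpM2l; first by rewrite mulr_ge0// exprn_ge0// ltW.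
  rewrite -mulf_div divff ?gt_eqF// mul1r.
  apply: lerXn2r; first by rewrite nnegrE divr_ge0// ltW.
    by rewrite nnegrE invr_ge0 ltW.
  by rewrite ler_piMl// invr_ge0 ltW.
apply: le_trans (ler_wpM2l B_ge0 (H N)); rewrite mulr_sumr; apply: ler_sum => a _.
rewrite /nterm mulrA; apply: ler_wpM2r.
  by rewrite exprn_ge0// subr_ge0.
have -> : av (iter T (@deg_mul _ K) f a) = (mdeg a)%:R ^+ T * av (f a).
  elim: T => [|j IH]; first by rewrite expr0 mul1r.
  by rewrite /= /deg_mul avM av_nat IH exprS mulrA.
by rewrite /homological_inv avM mulrC mulrA; apply: ler_wpM2r; rewrite ?av_ge0.
Qed.

(** The exponent of [delta^-1] in the estimates: [T] for each of the two divisions by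
    frequencies and 2 for each of the two nested brackets, the one in [newton_h1] and the
    one in which [newton_h] is used. As many layers of width [delta] suffice for the step. *)
Definition newton_loss : nat := (2 * T + 4)%N.
Local Notation E := newton_loss.

(** Bounds the norm of [newton_h] in units of [eps * delta^-1 ^+ (2 * T + 2)]. *)
Definition newton_A : R := B + B * (1 + c2 * B).
(** A sum of the constants of the separate estimates, so that it majorizes each of them;
    the 1 makes it positive. *)
Definition newton_C : R := 4%:R * c2 * newton_A
  + 8%:R * c2 * newton_A * (quad_norm av lambda + 1)
  + 2%:R * c2 * newton_A + 32%:R * (c2 * newton_A) ^+ 2 * (quad_norm av lambda + 1) + 1.

Let A0 : 0 <= newton_A.
Proof. by rewrite /newton_A addr_ge0// mulr_ge0// addr_ge0// mulr_ge0. Qed.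

Let L0 : 0 <= quad_norm av lambda.
Proof. by apply: sumr_ge0 => i _; exact: av_ge0. Qed.

Lemma newton_C_gt0 : 0 < newton_C.
Proof.
have L1 : 0 <= quad_norm av lambda + 1 by exact: addr_ge0.
have cA0 : 0 <= c2 * newton_A by exact: mulr_ge0.
have cAL0 : 0 <= c2 * newton_A * (quad_norm av lambda + 1) by exact: mulr_ge0.
have cAL2 : 0 <= (c2 * newton_A) ^+ 2 * (quad_norm av lambda + 1).
  by rewrite mulr_ge0// exprn_ge0.
rewrite /newton_C; lra.
Qed.

(** The first [2 * T + 2] layers carry the construction of [newton_h] and a derivative
    of it. The change of [P] is then linear in [v], and by [newton_residual] what is left
    modulo [I^2] is quadratic: brackets of [newton_h0] and [newton_h1] with [modI2 P], and
    the terms of the Lie series with at least two brackets. *)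
Lemma newton_norm (r0 : R) s delta eps P : 0 < r0 -> 0 < delta -> delta <= 1 ->
  delta * E%:R <= s -> s <= 1 -> ordge 3 P ->
  nrm av r0 s P 1 -> nrm av r0 s (modI2 P) eps ->
  let v := eps * delta^-1 ^+ E in newton_C * v <= 1 / 2%:R ->
  exists kappa, [/\ 0 <= kappa,
    forall j, normle av (r0 * (s - delta * (2 * T + 2)%:R))
       (partial j (newton_h lambda P)) (r0 * kappa),
    4%:R * c2 * kappa / delta <= newton_C * v,
    nrm av r0 (s - delta * E%:R) (newton_next lambda P - P) (newton_C * v) &
    nrm av r0 (s - delta * E%:R) (modI2 (newton_next lambda P)) (newton_C * v ^+ 2)].
Proof.
move=> r00 d0 d1 dE s1 P3 P1 Reps v vC.
have eps0 := nrm_ge0 r00 Reps.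
set D := delta^-1; have D1 : 1 <= D by rewrite /D -invr1 lef_pV2 ?posrE.
have D0 : 0 < D by rewrite invr_gt0.
have dX (i j : nat) : (i <= j)%N -> delta * i%:R <= delta * j%:R.
  by move=> ij; rewrite ler_pM2l// ler_nat.
have dE' : delta * T%:R + delta * T%:R + delta * 4%:R <= s.
  by move: dE; rewrite /E natrD natrM; lra.
have dT0 : 0 <= delta * T%:R by rewrite mulr_ge0// ltW.
set W := D ^+ (2 * T + 2); have W1 : 1 <= W by rewrite /W; apply: exprn_ege1.
have TW : D ^+ T <= W.
  by rewrite /W ler_weXn2l// mul2n -addnn -addnA leq_addr.
have DT1 : 1 <= D ^+ T by exact: exprn_ege1.
have vE : v = eps * W * D ^+ 2.
  have EE : E = (2 * T + 2 + 2)%N by rewrite /newton_loss -addnA.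
  by rewrite /v EE exprD mulrA.
have D2 : 1 <= D ^+ 2 by exact: exprn_ege1.
have epsW : 0 <= eps * W by rewrite mulr_ge0// (le_trans ler01).
have epsv : eps <= v.
  by rewrite vE -mulrA ler_peMr// mulr_ege1.
have v0 : 0 <= v by exact: le_trans epsv.
have s0 : 0 <= s by lra.
have vP j : (j < 2)%N -> nrm av r0 s (vproj j P) eps.
  by move=> j2; rewrite -vproj_modI2//; exact: nrm_vproj.
have h0_nrm : nrm av r0 (s - delta * T%:R) (newton_h0 lambda P) (B * eps * D ^+ T).
  by apply: nrmN; apply: nrm_homological_inv => //; [lra | exact: vP].
have d2T : delta * (2 * T + 2)%:R = delta * T%:R + delta * T%:R + 2%:R * delta.
  by rewrite natrD natrM; ring.
pose b0 := B * eps * D ^+ T.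
have b0P : b0 <= B * (eps * W).
  by rewrite /b0 -mulrA; apply: ler_wpM2l => //; apply: ler_wpM2l.
have b0_ge0 : 0 <= b0 by exact: nrm_ge0 h0_nrm.
(* The width left after [newton_h0] and its bracket with [P]. *)
pose s1' := s - delta * T%:R - delta.
have h0P : nrm av r0 s1' (poisson (newton_h0 lambda P) P) (c2 * b0 * D ^+ 2).
  have := @nrm_poisson _ _ _ av r0 r00 (s - delta * T%:R) delta _ _ _ _ d0 _ h0_nrm
    (nrm_mono r00 _ _ P1).
  rewrite mulr1 -[delta ^+ 2]invrK -exprVn invrK; apply; lra.
pose b1 := B * (eps + c2 * b0 * D ^+ 2) * D ^+ T.
have h1_nrm : nrm av r0 (s1' - delta * T%:R) (newton_h1 lambda P) b1.
  apply: nrmN; apply: nrm_homological_inv => //; [rewrite /s1'; lra|rewrite /s1'; lra|].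
  rewrite vprojD; apply: nrmD => //; first by rewrite /s1'; lra.
    by apply: (nrm_mono r00 _ _ (vP 1%N isT)); rewrite /s1'; lra.
  by apply: nrm_vproj => //; rewrite /s1'; lra.
have b1P : b1 <= B * (1 + c2 * B) * (eps * W).
  have -> : b1 = B * (eps * D ^+ T + c2 * B * (eps * (D ^+ T * D ^+ T * D ^+ 2))).
    by rewrite /b1 /b0; ring.
  have -> : D ^+ T * D ^+ T * D ^+ 2 = W by rewrite -!exprD /W addnn mul2n.
  rewrite -!mulrA; apply: ler_wpM2l => //; rewrite mulrDl mul1r lerD//.
    exact: ler_wpM2l.
  by rewrite !mulrA.
have b1_ge0 : 0 <= b1 by exact: nrm_ge0 h1_nrm.
pose eta := newton_A * (eps * W).
have b01 : b0 + b1 <= eta by rewrite /eta /newton_A mulrDl lerD.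
have h_nrm : nrm av r0 (s1' - delta * T%:R) (newton_h lambda P) eta.
  apply: (nrm_le r00 b01); apply: nrmD => //; first by rewrite /s1'; lra.
  apply: (nrm_mono r00 _ _ h0_nrm); rewrite /s1'; lra.
have eta0 : 0 <= eta by exact: nrm_ge0 h_nrm.
have h3 : ordge 3 (newton_h lambda P).
  by apply: (@ordge_newton_h _ _ lambda P P3 0); exact: ordge_modI2.
have hk j : normle av (r0 * (s - delta * (2 * T + 2)%:R))
       (partial j (newton_h lambda P)) (r0 * (eta / delta)).
  have := @nrm_partial _ _ _ av r0 r00 _ delta j _ _ d0 _ h_nrm.
  have -> : s1' - delta * T%:R - delta = s - delta * (2 * T + 2)%:R.
    by rewrite /s1' d2T; ring.
  by apply; rewrite /s1'; lra.
have kP : 4%:R * c2 * (eta / delta) / delta = 4%:R * c2 * newton_A * v.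
  by rewrite vE /eta -/D; ring.
(* The ratio of the geometric series that majorizes the Lie series. *)
pose theta := 4%:R * c2 * newton_A * v.
have cA0 : 0 <= c2 * newton_A by exact: mulr_ge0.
have theta0 : 0 <= theta by rewrite /theta -!mulrA mulr_ge0// mulrA mulr_ge0.
have L1 : 0 <= quad_norm av lambda + 1 by exact: addr_ge0.
have cAL0 : 0 <= c2 * newton_A * (quad_norm av lambda + 1) by exact: mulr_ge0.
have cAL2 : 0 <= (c2 * newton_A) ^+ 2 * (quad_norm av lambda + 1).
  by rewrite mulr_ge0// exprn_ge0.
have thC : theta <= newton_C * v.
  rewrite /theta /newton_C; apply: ler_wpM2r => //; lra.
have dE4 : delta * E%:R = delta * (2 * T + 2)%:R + 2%:R * delta.
  by rewrite /E !natrD; ring.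
pose u := s - delta * (2 * T + 2)%:R.
have u0 : 0 <= u by rewrite /u; lra.
have us : u <= s by rewrite /u; lra.
have Fn : nrm av r0 u (quad lambda + P) (quad_norm av lambda + 1).
  by apply: nrmD => //; [apply: nrm_quad => //; lra | exact: nrm_mono P1].
have kappa0 : 0 <= eta / delta by rewrite divr_ge0// ltW.
have th2 : theta <= 1 / 2%:R by exact: le_trans thC vC.
have lieP d : nrm av r0 (s - delta * E%:R)
   (lie (poisson (newton_h lambda P)) (quad lambda + P)
     - lie_trunc (poisson (newton_h lambda P)) d (quad lambda + P))
   (2%:R * theta ^+ d * (quad_norm av lambda + 1)).
  apply: (nrm_mono (s := u - delta) r00); [rewrite /u; lra|rewrite /u; lra|].
  apply: (@nrm_lie _ _ _ _ _ r00 _ u (eta / delta) (u - delta) u) => //.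
  - by rewrite /u; lra.
  - by lra.
  - by rewrite opprB addrC subrK kP.
exists (eta / delta); split => //; first by rewrite kP.
- have -> : newton_next lambda P - P = lie (poisson (newton_h lambda P)) (quad lambda + P)
     - lie_trunc (poisson (newton_h lambda P)) 1 (quad lambda + P).
    rewrite /newton_next /lie_trunc big_ord_recl big_ord0 addr0 dpow0; ring.
  apply: (nrm_le r00 _ (lieP 1%N)); rewrite expr1 /theta.
  have -> : 2%:R * (4%:R * c2 * newton_A * v) * (quad_norm av lambda + 1) =
    8%:R * c2 * newton_A * (quad_norm av lambda + 1) * v by ring.
  by apply: ler_wpM2r => //; rewrite /newton_C; lra.
rewrite newton_residual//.
have q_nrm : nrm av r0 (s - delta * E%:R) (newton_quadratic lambda P)
    (c2 * eta * eps * D ^+ 2 + c2 * eta * eps * D ^+ 2).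
  have t0 : 0 <= s - delta * E%:R by lra.
  have bd h : nrm av r0 (s1' - delta * T%:R) h eta ->
      nrm av r0 (s - delta * E%:R) (poisson h (modI2 P)) (c2 * eta * eps * D ^+ 2).
    move=> hn; have := @nrm_poisson _ _ _ av r0 r00 _ delta _ _ _ _ d0 _ hn
      (nrm_mono r00 _ _ Reps).
    rewrite -[delta ^+ 2]invrK -exprVn invrK -/D => H.
    apply: (nrm_mono (s := s1' - delta * T%:R - delta) r00) => //; last apply: H;
      rewrite /s1'; lra.
  apply: nrmD => //.
    apply: nrm_vproj => //; apply: bd; apply: (@nrm_le _ _ _ _ _ r00 _ _ b0); first lra.
    by apply: (nrm_mono r00 _ _ h0_nrm); rewrite /s1'; lra.
  apply: nrm_modI2 => //; apply: bd; apply: (nrm_le r00 _ h1_nrm); lra.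
have t0 : 0 <= s - delta * E%:R by lra.
have := nrmD r00 t0 q_nrm (nrm_modI2 r00 t0 (lieP 2%N)).
apply: (nrm_le r00).
have -> : c2 * eta * eps * D ^+ 2 = c2 * newton_A * (eps * v).
  by rewrite vE /eta; ring.
have ev : c2 * newton_A * (eps * v) <= c2 * newton_A * v ^+ 2.
  by apply: ler_wpM2l => //; rewrite expr2; apply: ler_wpM2r.
have vv : 0 <= v ^+ 2 by rewrite exprn_ge0.
have cAv := mulr_ge0 cA0 vv; have cALv := mulr_ge0 cAL0 vv.
rewrite /newton_C /theta.
have -> : 2%:R * (4%:R * c2 * newton_A * v) ^+ 2 * (quad_norm av lambda + 1) =
  32%:R * ((c2 * newton_A) ^+ 2 * (quad_norm av lambda + 1)) * v ^+ 2 by ring.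
lra.
Qed.

End NewtonNorm.

(** * The Newton iteration *)

Section NewtonIteration.
Variables (n : nat) (K : numFieldType) (R : realFieldType) (av : absval K R).
Local Notation S := (fps (n + n) K).
Implicit Types (f g h : S) (k N : nat) (a : mindex (n + n)).
Local Notation c2 := ((n + n)%:R : R).
Variables (lambda : 'I_n -> K) (B : R) (T : nat).
Hypothesis freq_eq0 : forall a, freq lambda a = 0 ->
  forall i, a (lshift n i) = a (rshift n i).
Hypothesis B_ge0 : 0 <= B.
Hypothesis freq_ge : forall a, av (freq lambda a)^-1 <= B * (mdeg a)%:R ^+ T.
Variable P0 : S.
Hypothesis P0_ord : ordge 3 P0.

Local Notation H := (quad lambda).
Local Notation E := (newton_loss T).
Local Notation C := (newton_C av lambda B).

Definition newton_seq k : S := iter k (newton_next lambda) P0.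
Definition newton_gen k : S := newton_h lambda (newton_seq k).

Lemma ordge_newton_next k P : ordge 3 P -> ordge k.+3 (modI2 P) ->
  ordge 3 (newton_next lambda P) /\ ordge k.+4 (modI2 (newton_next lambda P)).
Proof.
move=> P3 Pk; have hk := @ordge_newton_h _ _ lambda P P3 k Pk.
have ad_ord N g := @ad_raises _ _ k _ N g hk.
have F2 : ordge 2 (H + P).
  by apply: wgeD; [exact: ordge_quad | exact: (@wge_le _ _ _ 3)].
split.
  have -> : newton_next lambda P =
      (lie (poisson (newton_h lambda P)) (H + P) - (H + P)) + P.
    by rewrite /newton_next; ring.
  apply: wgeD => //; apply: (@wge_le _ _ _ (2 + k.+1)%N) => //.
  exact: (lie_sub ad_ord).
rewrite newton_residual//; apply: wgeD.
  have br h : ordge k.+3 h -> ordge k.+4 (poisson h (modI2 P)).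
    move=> h3; apply: (@wge_le _ _ _ (k.+3 + k.+3 - 2)%N); first lia.
    exact: ordge_poisson.
  apply: wgeD; [apply: ordge_vproj | apply: ordge_modI2]; apply: br.
    exact: ordge_newton_h0.
  exact: ordge_newton_h1.
apply: ordge_modI2; apply: (@wge_le _ _ _ (2 + 2 * k.+1)%N); first lia.
exact: (ordge_lie_tail ad_ord).
Qed.

(** Besides getting small the residual gains an order at each step. Hence the generators
    have increasing orders, and the infinite product of their exponentials makes sense
    without any estimate. *)
Lemma newton_seq_ord k : ordge 3 (newton_seq k) /\ ordge k.+3 (modI2 (newton_seq k)).
Proof.
elim: k => [|k [IH1 IH2]]; first by split => //; exact: ordge_modI2.
exact: ordge_newton_next.
Qed.

Lemma ordge_newton_gen k : ordge k.+3 (newton_gen k).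
Proof. by have [P3 Pk] := newton_seq_ord k; exact: ordge_newton_h. Qed.

Lemma fwd_newton k : fwd newton_gen k (H + P0) = H + newton_seq k.
Proof.
elim: k => [//|k IH]; rewrite -[newton_seq k.+1]/(newton_next lambda (newton_seq k)).
by rewrite /newton_next [RHS]addrC subrK -IH.
Qed.

Lemma modI2_fwd_lim : modI2 (fwd_lim newton_gen (H + P0) - H) = 0.
Proof.
apply/fpsP => a; rewrite /modI2 fps0E; case: ltnP => // a2.
rewrite fpsBE /fwd_lim /oplim fwd_newton fpsDE addrC addKr.
have [_ /(_ a)] := newton_seq_ord (mdeg a).
by rewrite /modI2 a2; apply; rewrite ltnS leqW.
Qed.

Definition newton_a : R := (4%:R * E%:R) ^+ E.
(** With [newton_delta k] halved at each step, the loss [newton_delta k ^- E] is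
    [newton_a] times the [k]-th power of [2 ^ E]. If the residuals decrease by the
    factor [newton_b], then [newton_v k] decreases by [2 ^ E] and its square again by
    [newton_b], so that the quadratic estimate reproduces the rate. *)
Definition newton_b : R := 4%:R ^+ E.
(** Small enough that [C * newton_eps * newton_a ^+ 2 * newton_b <= 1 / 8]: one factor
    [newton_a] for each factor of [newton_v k ^+ 2] and one [newton_b] for the next rate. *)
Definition newton_eps : R := (8%:R * (C + 1) * newton_a ^+ 2 * newton_b)^-1.

Let E_gt0 : (0 : R) < E%:R.
Proof. by rewrite ltr0n /newton_loss; lia. Qed.

Let C0 : 0 < C. Proof. exact: newton_C_gt0. Qed.

Let a1 : 1 <= newton_a.
Proof.
apply: exprn_ege1; rewrite -natrM ler1n /newton_loss; lia.
Qed.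

Let b1 : 1 <= newton_b. Proof. by apply: exprn_ege1; rewrite ler1n. Qed.

Let a0 : 0 < newton_a. Proof. exact: lt_le_trans a1. Qed.

Let b0 : 0 < newton_b. Proof. exact: lt_le_trans b1. Qed.

Let den_gt0 : 0 < 8%:R * (C + 1) * newton_a ^+ 2 * newton_b.
Proof. by rewrite !mulr_gt0// ?exprn_gt0// addr_gt0. Qed.

Lemma newton_eps_gt0 : 0 < newton_eps.
Proof. by rewrite invr_gt0. Qed.

Let eps_le : newton_eps <= 1 / 8%:R.
Proof.
have a2 : 1 <= newton_a ^+ 2 by exact: exprn_ege1.
rewrite div1r lef_pV2 ?posrE// -!mulrA ler_peMr//.
have ab : 1 <= newton_a * (newton_a * newton_b) by rewrite !mulr_ege1.
have C1 : 1 <= C + 1 by rewrite lerDr ltW.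
exact: mulr_ege1.
Qed.

Let eps_q : C * newton_eps * newton_a ^+ 2 * newton_b <= 1 / 8%:R.
Proof.
have e1 : newton_eps * (8%:R * (C + 1) * newton_a ^+ 2 * newton_b) = 1.
  by rewrite mulVf// gt_eqF.
have X0 : 0 <= newton_eps * newton_a ^+ 2 * newton_b.
  by rewrite ltW// !mulr_gt0// newton_eps_gt0.
move: newton_eps newton_a newton_b X0 e1 => e a b X0 e1; nra.
Qed.

Definition newton_z k : R := 2%:R^-1 ^+ k.
(** Half of the polydisc survives the iteration. The loss [newton_z k / 4] at step [k]
    is spread over [E] layers of width [newton_delta k]. *)
Definition newton_radius k : R := (1 + newton_z k) / 2%:R.
Definition newton_delta k : R := newton_z k / (4%:R * E%:R).
Definition newton_v k : R :=
  newton_eps * newton_b^-1 ^+ k * (newton_delta k)^-1 ^+ E.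

Let z_gt0 k : 0 < newton_z k.
Proof. by rewrite exprn_gt0// invr_gt0. Qed.

Let z_le1 k : newton_z k <= 1.
Proof. by rewrite exprn_ile1 ?invr_ge0 ?invf_le1// ler1n. Qed.

Let zS k : newton_z k.+1 = newton_z k / 2%:R.
Proof. by rewrite /newton_z exprSr. Qed.

Let delta_gt0 k : 0 < newton_delta k.
Proof. by rewrite divr_gt0// mulr_gt0. Qed.

Let deltaE k : newton_delta k * E%:R = newton_z k / 4%:R.
Proof. by rewrite /newton_delta; field; rewrite gt_eqF. Qed.

Let delta_le1 k : newton_delta k <= 1.
Proof.
have := deltaE k; have := z_le1 k; have := delta_gt0 k.
have : (1 : R) <= E%:R by rewrite ler1n /newton_loss addnS.
move: (newton_delta k) (E%:R) (newton_z k) => d e z; nra.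
Qed.

Let radiusS k : newton_radius k - newton_delta k * E%:R = newton_radius k.+1.
Proof. by rewrite deltaE /newton_radius zS; field. Qed.

Lemma newton_vE k : newton_v k = newton_eps * newton_a * (2%:R ^+ E)^-1 ^+ k.
Proof.
rewrite /newton_v /newton_delta invf_div.
have -> : 4%:R * E%:R / newton_z k = 4%:R * E%:R * 2%:R ^+ k.
  by rewrite /newton_z exprVn invrK.
rewrite exprMn -/newton_a /newton_b.
have -> : (4%:R : R) ^+ E = 2%:R ^+ E * 2%:R ^+ E by rewrite -exprMn -natrM.
rewrite -exprM mulnC exprM invfM exprMn !exprVn.
set w := (2%:R ^+ E) ^+ k.
have w0 : w != 0 by rewrite !expf_neq0// pnatr_eq0.
by field.
Qed.

Let w_le k : (2%:R ^+ E)^-1 ^+ k <= newton_z k :> R.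
Proof.
rewrite /newton_z; apply: lerXn2r; rewrite ?nnegrE ?invr_ge0 ?exprn_ge0//.
rewrite lef_pV2 ?posrE ?exprn_gt0// -[leLHS]expr1; apply: ler_weXn2l.
  by rewrite ler1n.
by rewrite /newton_loss addnS.
Qed.

Let v_ge0 k : 0 <= newton_v k.
Proof.
rewrite newton_vE; apply: mulr_ge0; last by rewrite exprn_ge0// invr_ge0 exprn_ge0.
by rewrite ltW// mulr_gt0// newton_eps_gt0.
Qed.

Let v_le k : C * newton_v k <= newton_z k / 8%:R.
Proof.
rewrite newton_vE.
have h : C * (newton_eps * newton_a) <= 1 / 8%:R.
  apply: le_trans eps_q; rewrite -!mulrA; apply: ler_wpM2l; first exact: ltW.
  apply: ler_wpM2l; first by rewrite ltW// newton_eps_gt0.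
  by rewrite ler_peMr ?mulr_ege1// ltW.
rewrite mulrA; apply: (@le_trans _ _ (1 / 8%:R * newton_z k)); last lra.
apply: ler_pM; [|by rewrite exprn_ge0// invr_ge0 exprn_ge0|exact: h|exact: w_le].
by rewrite !mulr_ge0// ltW// newton_eps_gt0.
Qed.

Let v_sq k : C * newton_v k ^+ 2 <= newton_eps * newton_b^-1 ^+ k.+1.
Proof.
have -> : C * newton_v k ^+ 2 =
    C * newton_eps * newton_a ^+ 2 * newton_b * (newton_eps * newton_b^-1 ^+ k.+1).
  have bn0 : newton_b != 0 by rewrite gt_eqF.
  have -> : newton_b^-1 ^+ k.+1 = newton_b^-1 * ((2%:R ^+ E)^-1 ^+ k) ^+ 2.
    rewrite exprS; congr (_ * _); rewrite -exprM mulnC exprM; congr (_ ^+ _).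
    by rewrite exprVn -exprM mulnC exprM -natrX.
  rewrite newton_vE; field; exact: bn0.
rewrite ger_pMl; first by apply: le_trans eps_q _; lra.
by rewrite mulr_gt0 ?newton_eps_gt0// exprn_gt0// invr_gt0.
Qed.

Variable r0 : R.
Hypothesis r0_gt0 : 0 < r0.
Hypothesis P0_small : nrm av r0 1 P0 newton_eps.

Local Notation s := newton_radius.

Let s_le1 k : s k <= 1.
Proof. by rewrite /newton_radius; have := z_le1 k; lra. Qed.

Let deltaE_le k : newton_delta k * E%:R <= s k.
Proof. by rewrite deltaE /newton_radius; have := z_le1 k; have := z_gt0 k; lra. Qed.

Let vC k : C * newton_v k <= 1 / 2%:R.
Proof. by apply: le_trans (v_le k) _; have := z_le1 k; have := z_gt0 k; lra. Qed.

(** The whole remainder is only required to stay below 1, whereas its part modulo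
    [I^2] decreases geometrically. *)
Lemma newton_seq_norm k :
  nrm av r0 (s k) (newton_seq k) (1 - newton_z k / 2%:R) /\
  nrm av r0 (s k) (modI2 (newton_seq k)) (newton_eps * newton_b^-1 ^+ k).
Proof.
elim: k => [|k [IH1 IH2]].
  have s0 : s 0 = 1 by rewrite /newton_radius /newton_z expr0; lra.
  rewrite s0 expr0 mulr1; split; last exact: nrm_modI2.
  by apply: (nrm_le r0_gt0 _ P0_small); rewrite /newton_z expr0; have := eps_le; lra.
have [P3 _] := newton_seq_ord k.
have z0 := z_gt0 k.
have IH1' : nrm av r0 (s k) (newton_seq k) 1 by apply: (nrm_le r0_gt0 _ IH1); lra.
have [kappa [_ _ _ nP nR]] := newton_norm freq_eq0 B_ge0 freq_ge r0_gt0 (delta_gt0 k)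
  (delta_le1 k) (deltaE_le k) (s_le1 k) P3 IH1' IH2 (vC k).
rewrite radiusS in nP nR.
have sS0 : 0 <= s k.+1 by rewrite /newton_radius; have := z_gt0 k.+1; lra.
split; last by apply: (nrm_le r0_gt0 _ nR); exact: v_sq.
have sk : s k.+1 <= s k by rewrite /newton_radius zS; lra.
have := nrmD r0_gt0 sS0 (nrm_mono r0_gt0 sS0 sk IH1) nP.
rewrite addrC subrK; apply: (nrm_le r0_gt0); rewrite zS.
have := v_le k; rewrite /newton_v; lra.
Qed.

Lemma newton_gen_partial k : exists kappa, [/\ 0 <= kappa,
    forall j, normle av (r0 * (s k.+1 + newton_delta k)) (partial j (newton_gen k)) (r0 * kappa) &
    4%:R * c2 * kappa / newton_delta k <= newton_z k / 8%:R].
Proof.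
have [IH1 IH2] := newton_seq_norm k.
have [P3 _] := newton_seq_ord k.
have z0 := z_gt0 k.
have IH1' : nrm av r0 (s k) (newton_seq k) 1 by apply: (nrm_le r0_gt0 _ IH1); lra.
have [kappa [k0 hk kP _ _]] := newton_norm freq_eq0 B_ge0 freq_ge r0_gt0 (delta_gt0 k)
  (delta_le1 k) (deltaE_le k) (s_le1 k) P3 IH1' IH2 (vC k).
exists kappa; split => //; last by apply: le_trans kP _; exact: v_le.
move=> j; apply: (@normle_mono _ _ _ _ (r0 * (s k - newton_delta k * (2 * T + 2)%:R))).
- apply: mulr_ge0; first exact: ltW.
  by rewrite /newton_radius; have := z_gt0 k.+1; have := delta_gt0 k; lra.
- rewrite ler_pM2l// -radiusS.
  have -> : E = (2 * T + 2 + 2)%N by rewrite /newton_loss -addnA.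
  by rewrite natrD mulrDr; have := delta_gt0 k; lra.
- exact: hk.
Qed.

Let lie_step h k t t' f M : ordge 3 h ->
  (exists kappa, [/\ 0 <= kappa,
    forall j, normle av (r0 * (s k.+1 + newton_delta k)) (partial j h) (r0 * kappa) &
    4%:R * c2 * kappa / newton_delta k <= newton_z k / 8%:R]) ->
  0 <= t -> t + newton_delta k <= t' -> t' <= s k.+1 + newton_delta k ->
  nrm av r0 t' f M -> nrm av r0 t (lie (poisson h) f) ((1 + newton_z k / 4%:R) * M).
Proof.
move=> h3 [kappa [k0 hk kP]] t0 tt' t's fM; have d0 := delta_gt0 k.
have z0 := z_gt0 k; have z1 := z_le1 k.
have t't : t < t' by apply: lt_le_trans tt'; rewrite ltrDl.
have th2 : newton_z k / 8%:R <= 1 / 2%:R by lra.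
have th1 : 4%:R * c2 * kappa / (t' - t) <= newton_z k / 8%:R.
  apply: le_trans kP; apply: ler_wpM2l; first by rewrite !mulr_ge0.
  by rewrite lef_pV2 ?posrE// ?subr_gt0// lerBrDl.
have := @nrm_lie _ _ _ _ _ r0_gt0 h _ kappa t t' _ 1 f M h3 k0 hk t0 t't t's th1 th2 fM.
rewrite /lie_trunc big_ord_recl big_ord0 addr0 dpow0 => /(nrmD r0_gt0 t0).
move=> /(_ _ _ (nrm_mono r0_gt0 t0 (ltW t't) fM)); rewrite subrK.
by apply: (nrm_le r0_gt0); rewrite expr1; lra.
Qed.

(** The product of the factors [1 + newton_z k / 4] stays below 2, because
    [(1 + z / 4) * (2 - z) <= 2 - z / 2] for [z >= 0]. *)
Lemma nrm_fwd k f M : nrm av r0 1 f M ->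
  nrm av r0 (s k) (fwd newton_gen k f) (M * (2%:R - newton_z k)).
Proof.
move=> fM; have M0 := nrm_ge0 r0_gt0 fM; elim: k => [|k IH].
  have -> : s 0 = 1 by rewrite /newton_radius /newton_z expr0; lra.
  by apply: (nrm_le r0_gt0 _ fM); rewrite /newton_z expr0; lra.
have z0 := z_gt0 k; have z1 := z_le1 k; have d0 := delta_gt0 k.
have h3 : ordge 3 (newton_gen k) by apply: wge_le (@ordge_newton_gen k).
have sS0 : 0 <= s k.+1 by rewrite /newton_radius; have := z_gt0 k.+1; lra.
have sk : s k.+1 + newton_delta k <= s k.
  rewrite -radiusS; have : newton_delta k <= newton_delta k * E%:R.
    by rewrite ler_pMr// ler1n /newton_loss addnS.
  lra.
have IH' := nrm_mono r0_gt0 (addr_ge0 sS0 (ltW d0)) sk IH.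
have := lie_step h3 (newton_gen_partial k) sS0 (lexx _) (lexx _) IH'.
apply: (nrm_le r0_gt0); rewrite zS.
rewrite mulrCA; apply: ler_wpM2l => //; nra.
Qed.

(** As the newest factor of [bwd] acts first, the polydiscs have to grow with [k]; they do
    so from a quarter to half of the initial one, inside those on which the generators
    are bounded. *)
Definition newton_radius' k : R := (2%:R - newton_z k) / 4%:R.
Local Notation t := newton_radius'.

Lemma nrm_bwd k f M : nrm av r0 (t k) f M ->
  nrm av r0 (t 0) (bwd newton_gen k f) (M * (2%:R - newton_z k)).
Proof.
elim: k f M => [|k IH] f M fM; have M0 := nrm_ge0 r0_gt0 fM.
  by apply: (nrm_le r0_gt0 _ fM); rewrite /newton_z expr0; lra.
have z0 := z_gt0 k; have z1 := z_le1 k; have d0 := delta_gt0 k.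
have h3 : ordge 3 (- newton_gen k).
  by apply/wgeN; apply: wge_le (@ordge_newton_gen k).
have [kappa [k0 hk kP]] := newton_gen_partial k.
have hN : exists kappa, [/\ 0 <= kappa,
    forall j, normle av (r0 * (s k.+1 + newton_delta k)) (partial j (- newton_gen k)) (r0 * kappa) &
    4%:R * c2 * kappa / newton_delta k <= newton_z k / 8%:R].
  by exists kappa; split => // j; rewrite partialN; exact: normleN.
have t0 : 0 <= t k by rewrite /newton_radius'; lra.
have dz : newton_delta k <= newton_z k / 16%:R.
  have := deltaE k; have : (4%:R : R) <= E%:R by rewrite ler_nat /newton_loss leq_addl.
  by move: (newton_delta k) d0 (E%:R : R) => d d0 e; nra.
have tt : t k + newton_delta k <= t k.+1 by rewrite /newton_radius' zS; lra.
have ts : t k.+1 <= s k.+1 + newton_delta k.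
  by rewrite /newton_radius' /newton_radius zS; lra.
have := IH _ _ (lie_step h3 hN t0 tt ts fM).
apply: (nrm_le r0_gt0); rewrite zS.
rewrite [(1 + _) * M]mulrC -mulrA; apply: ler_wpM2l => //; nra.
Qed.

Lemma fwd_lim_X_norm (j : 'I_(n + n)) :
  normle av (r0 / 4%:R) (fwd_lim newton_gen (fps_X K j)) (r0 * 2%:R).
Proof.
apply: normle_oplim; first by move=> k f; apply: fwd_stable; exact: ordge_newton_gen.
move=> k; have X1 : nrm av r0 1 (fps_X K j) r0^-1.
  rewrite /nrm expr2 mulrK ?unitfE ?gt_eqF//.
  by have := nrm_X av r0_gt0 j ler01; rewrite mulr1.
have z0 := z_gt0 k; have := nrm_fwd k X1.
have sk : 1 / 4%:R <= s k by rewrite /newton_radius; lra.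
move=> /(nrm_mono r0_gt0 _ sk) => /(_ ltac:(lra)); rewrite /nrm div1r.
apply: normle_le; rewrite mulrA expr2 mulrK ?unitfE ?gt_eqF//.
by rewrite ler_pM2l//; lra.
Qed.

Lemma bwd_lim_X_norm (j : 'I_(n + n)) :
  normle av (r0 / 4%:R) (bwd_lim newton_gen (fps_X K j)) (r0 * 2%:R).
Proof.
apply: normle_oplim; first by move=> k f; apply: bwd_stable; exact: ordge_newton_gen.
move=> k; have z0 := z_gt0 k; have z1 := z_le1 k.
have X1 : nrm av r0 (t k) (fps_X K j) r0^-1.
  rewrite /nrm expr2 mulrK ?unitfE ?gt_eqF//.
  have tk0 : 0 <= t k by rewrite /newton_radius'; lra.
  apply: normle_le (nrm_X av r0_gt0 j tk0).
  by rewrite ger_pMr// /newton_radius'; lra.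
have := nrm_bwd X1; have -> : t 0 = 4%:R^-1.
  by rewrite /newton_radius' /newton_z expr0; lra.
apply: normle_le; rewrite mulrA expr2 mulrK ?unitfE ?gt_eqF//.
by rewrite ler_pM2l//; lra.
Qed.

End NewtonIteration.

(** A perturbation of order 3 is of size [r0] in units of [r0 ^+ 2], hence small enough
    for the iteration on a small polydisc. Of the convergence of the two automorphisms
    only the images of the coordinates are recorded: these are the components of the
    maps by which the automorphisms substitute. *)
Theorem convergent_normal_form (n : nat) (K : numFieldType) (R : realFieldType)
  (av : absval K R) (lambda : 'I_n -> K) (B : R) (T : nat) (P : fps (n + n) K)
  (rho M : R) :
  (forall a, freq lambda a = 0 -> forall i, a (lshift n i) = a (rshift n i)) ->
  0 <= B -> (forall a, av (freq lambda a)^-1 <= B * (mdeg a)%:R ^+ T) ->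
  ordge 3 P -> 0 < rho -> normle av rho P M ->
  exists phi psi : fps (n + n) K -> fps (n + n) K,
  [/\ poisson_auto phi, poisson_auto psi,
     (forall f, phi (psi f) = f) /\ (forall f, psi (phi f) = f),
     exists r A : R, 0 < r /\ forall j, normle av r (phi (fps_X K j)) A /\
                                     normle av r (psi (fps_X K j)) A &
     valge 2 (phi (quad lambda + P) - quad lambda)].
Proof.
move=> freq_eq0 B0 freq_ge P3 rho0 PM; have M0 := normle_ge0 PM.
pose e := newton_eps av lambda B T; have e0 : 0 < e by exact: newton_eps_gt0.
(* A radius with [M * (r0 / rho) ^+ 3 <= e * r0 ^+ 2] and [r0 <= rho]. *)
pose r0 := rho / (1 + M / (e * rho ^+ 2)).
have q0 : 0 <= M / (e * rho ^+ 2) by rewrite divr_ge0// mulr_ge0 ?exprn_ge0 ?ltW.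
have r00 : 0 < r0 by rewrite divr_gt0//; lra.
have r0rho : r0 <= rho by rewrite ler_pdivrMr ?ler_pMr//; lra.
have small : nrm av r0 1 P e.
  rewrite /nrm mulr1; have := normle_order rho0 (ltW r00) r0rho P3 PM.
  apply: normle_le; rewrite expr_div_n exprSr.
  have -> : M * (r0 ^+ 2 * r0 / rho ^+ 3) = r0 ^+ 2 * (M / rho ^+ 3 * r0) by ring.
  apply: ler_wpM2l; first by rewrite exprn_ge0// ltW.
  rewrite /r0 mulrA ler_pdivrMr; last lra.
  have -> : M / rho ^+ 3 * rho = e * (M / (e * rho ^+ 2)).
    by field; rewrite !gt_eqF.
  by rewrite ler_pM2l// lerDr.
have go := @ordge_newton_gen _ _ _ lambda B freq_eq0 B0 P P3.
exists (fwd_lim (newton_gen lambda P)), (bwd_lim (newton_gen lambda P)); split.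
- exact: fwd_lim_auto.
- exact: bwd_lim_auto.
- by split=> f; [exact: bwd_limK | exact: fwd_limK].
- exists (r0 / 4%:R), (r0 * 2%:R); split; first by rewrite divr_gt0.
  by move=> j; split; [exact: (fwd_lim_X_norm freq_eq0 B0 freq_ge)|exact: (bwd_lim_X_norm freq_eq0 B0 freq_ge)].
- by apply/modI2_eq0; exact: (modI2_fwd_lim freq_eq0 B0 P3).
Qed.

(** * Modulus and completeness of the complex numbers *)

(** The properties of the complex numbers on which the summation of series rests, with
    estimates in [R] instead of the partially ordered field [C]. *)
Record complete_modulus (R : realType) (C : numClosedFieldType) := CompleteModulus {
  cm_av : absval C R;
  cm_emb : R -> C;
  cm_norm : forall x, `|x| = cm_emb (cm_av x);
  cm_le : forall x y, (cm_emb x <= cm_emb y) = (x <= y);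
  cm_add : forall x y, cm_emb (x + y) = cm_emb x + cm_emb y;
  cm_mul : forall x y, cm_emb (x * y) = cm_emb x * cm_emb y;
  cm_real : forall x : C, 0 <= x -> x = cm_emb (cm_av x);
  cm_complete : forall u : nat -> C,
    (forall e : R, 0 < e -> exists N, forall k, (N <= k)%N -> cm_av (u k - u N) <= e) ->
    exists l, forall e : R, 0 < e -> exists N, forall k, (N <= k)%N -> cm_av (u k - l) <= e }.

Lemma real_cauchy (R : realType) (u : nat -> R) :
  (forall e : R, 0 < e -> exists N, forall k, (N <= k)%N -> `|u k - u N| <= e) ->
  exists l, forall e : R, 0 < e -> exists N, forall k, (N <= k)%N -> `|u k - l| <= e.
Proof.
move=> uc; have : cvg (u @ \oo).
  apply/cauchy_cvgP/cauchy_exP => e e0.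
  have [N uN] := uc (e / 2%:R) (divr_gt0 e0 (ltr0n _ 2)).
  exists (u N); exists N => // k /= Nk.
  rewrite -ball_normE /=; rewrite distrC; apply: le_lt_trans (uN k Nk) _; lra.
move=> /cvgrPdist_le ul; exists (lim (u @ \oo)) => e e0.
have [N _ hN] := ul e e0; exists N => k Nk; rewrite distrC; exact: hN.
Qed.

Section ComplexModulus.
Import complex.
Variable R : realType.
Local Notation C := R[i].

Lemma normc_nat k : ComplexField.Normc.normc (k%:R : C) = k%:R.
Proof.
have : (ComplexField.Normc.normc (k%:R : C))%:C%C = (k%:R : R)%:C%C.
  by rewrite -[LHS]/`|k%:R : C| normr_nat rmorph_nat.
by move=> /complexI.
Qed.

Lemma normc_eq0 (x : C) : (ComplexField.Normc.normc x == 0) = (x == 0).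
Proof.
apply/eqP/eqP => [/ComplexField.Normc.eq0_normc//|->]; exact: ComplexField.Normc.normc0.
Qed.

Lemma normc_triangle (x y : C) : ComplexField.Normc.normc (x + y) <=
  ComplexField.Normc.normc x + ComplexField.Normc.normc y.
Proof. exact: le_normcD. Qed.

Lemma normc_opp (x : C) : ComplexField.Normc.normc (- x) = ComplexField.Normc.normc x.
Proof. exact: normcN. Qed.

Lemma normc_ge0 (x : C) : 0 <= ComplexField.Normc.normc x.
Proof. by case: x => a b; exact: sqrtr_ge0. Qed.

Lemma Re_le_normc (x : C) : `|complex.Re x| <= ComplexField.Normc.normc x.
Proof. by have := normc_ge_Re x; rewrite lecR. Qed.

Lemma Im_le_normc (x : C) : `|complex.Im x| <= ComplexField.Normc.normc x.
Proof.
case: x => a b /=; rewrite -sqrtr_sqr ler_sqrt; last by rewrite addr_ge0 ?sqr_ge0.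
by rewrite lerDr sqr_ge0.
Qed.

Lemma normc_le_ReIm (x : C) :
  ComplexField.Normc.normc x <= `|complex.Re x| + `|complex.Im x|.
Proof.
case: x => a b /=; rewrite -[leRHS]ger0_norm ?addr_ge0// -sqrtr_sqr ler_sqrt ?sqr_ge0//.
rewrite sqrrD !real_normK ?num_real// addrAC lerDl; by rewrite mulrn_wge0// mulr_ge0.
Qed.

Lemma complex_complete (u : nat -> C) :
  (forall e : R, 0 < e -> exists N, forall k, (N <= k)%N ->
     ComplexField.Normc.normc (u k - u N) <= e) ->
  exists l, forall e : R, 0 < e -> exists N, forall k, (N <= k)%N ->
     ComplexField.Normc.normc (u k - l) <= e.
Proof.
move=> uc.
have [|a ha] := @real_cauchy R (fun k => complex.Re (u k)).
  move=> e e0; have [N hN] := uc e e0; exists N => k Nk.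
  apply: le_trans (hN k Nk); apply: le_trans (Re_le_normc _).
  by case: (u k) (u N) => ? ? [? ?].
have [|b hb] := @real_cauchy R (fun k => complex.Im (u k)).
  move=> e e0; have [N hN] := uc e e0; exists N => k Nk.
  apply: le_trans (hN k Nk); apply: le_trans (Im_le_normc _).
  by case: (u k) (u N) => ? ? [? ?].
exists (a +i* b)%C => e e0.
have e2 : 0 < e / 2%:R by rewrite divr_gt0.
have [N1 h1] := ha _ e2; have [N2 h2] := hb _ e2.
exists (maxn N1 N2) => k; rewrite geq_max => /andP[k1 k2].
apply: le_trans (normc_le_ReIm _) _.
have := lerD (h1 k k1) (h2 k k2); rewrite -splitr.
by case: (u k).
Qed.

Definition complex_av : absval C R :=
  @AbsVal C R (@ComplexField.Normc.normc R) normc_ge0 normc_triangle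
   (@ComplexField.Normc.normcM R) normc_opp normc_nat normc_eq0.


Lemma complex_modulus : complete_modulus R R[i].
Proof.
apply: (@CompleteModulus R R[i] complex_av (fun x => x%:C%C)).
- by [].
- by move=> x y; rewrite lecR.
- by move=> x y; rewrite rmorphD.
- by move=> x y; rewrite rmorphM.
- by move=> x x0; rewrite -[LHS](ger0_norm x0).
- exact: complex_complete.
Qed.

End ComplexModulus.

Lemma Cplx_modulus (R : realType) : complete_modulus R (Cplx R).
Proof. rewrite CplxE; exact: complex_modulus. Qed.

(** * Absolutely summable families *)

Lemma real_gap (R : realType) (x : nat -> R) M :
  (forall n k, (n <= k)%N -> x n <= x k) -> (forall n, x n <= M) ->
  forall e, 0 < e -> exists N, forall n, (N <= n)%N -> x n - x N <= e.
Proof.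
move=> xh xM e e0.
have xcv : cvgn x.
  by apply: nondecreasing_is_cvgn => //; exists M => _ [n _ <-].
have /cvgrPdist_lt/(_ _ e0)[N _ /(_ N (leqnn N)) /= hN] := xcv.
exists N => n Nn; have xn : x n <= limn x by exact: nondecreasing_cvgn_le.
by have := le_lt_trans (ler_norm _) hN; lra.
Qed.

Section Sums.
Variables (R : realType) (C : numClosedFieldType) (cm : complete_modulus R C) (m : nat).
Local Notation av := (cm_av cm).
Local Notation emb := (cm_emb cm).
Local Notation S := (fps m C).
Implicit Types (u v : S) (s t : C) (a b : mindex m) (N k : nat).

Lemma cm_emb0 : emb 0 = 0.
Proof. by have := cm_norm cm 0; rewrite normr0 av0. Qed.

Lemma cm_lt (x y : R) : (emb x < emb y) = (x < y).
Proof. by rewrite !lt_leAnge !cm_le. Qed.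

Lemma cm_gt0 (x : R) : (0 < emb x) = (0 < x).
Proof. by rewrite -cm_emb0 cm_lt. Qed.

Lemma cm_av_emb (x : R) : 0 <= x -> av (emb x) = x.
Proof.
move=> x0; have e0 : 0 <= emb x by rewrite -cm_emb0 cm_le.
by apply/eqP; rewrite eq_le -!(cm_le cm) -(cm_real cm e0) lexx.
Qed.

Lemma cm_sum I (r : seq I) (P : pred I) (F : I -> R) :
  emb (\sum_(i <- r | P i) F i) = \sum_(i <- r | P i) emb (F i).
Proof. exact: (big_morph emb (cm_add cm) cm_emb0). Qed.

Lemma cm_norm_le (x : C) (y : R) : (`|x| <= emb y) = (av x <= y).
Proof. by rewrite (cm_norm cm) cm_le. Qed.

Lemma av_dist x y : av (x - y) = av (y - x).
Proof. by rewrite -avN opprB. Qed.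

Definition bsum N u : C := \sum_(a <- box m N) u a.
Definition absum N u : R := \sum_(a <- box m N) av (u a).

Lemma box_sumE N u : box_sum N u = bsum N u.
Proof. by rewrite /box_sum /bsum /box /image_mem big_map big_enum. Qed.

(** The absolute summability of [abs_sum] with its estimates in [R]. *)
Definition sums u s :=
  (exists M, forall N, absum N u <= M) /\
  forall e : R, 0 < e -> exists N, forall k, (N <= k)%N -> av (bsum k u - s) <= e.

Lemma box_sum_norm N u : box_sum N (fun a => `|u a|) = emb (absum N u).
Proof.
rewrite (box_sumE N (fun a => `|u a|)) /absum cm_sum; apply: eq_bigr => a _.
exact: cm_norm.
Qed.

Lemma abs_sumP u s : abs_sum u s <-> sums u s.
Proof.
split=> [[[M uM] us]|[[M uM] us]]; split.
- exists (av M) => N; have := uM N; rewrite box_sum_norm => uN.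
  have M0 : 0 <= M.
    by apply: le_trans uN; rewrite -cm_emb0 cm_le; apply: sumr_ge0 => a _; exact: av_ge0.
  by rewrite -(cm_le cm) -(cm_real cm M0).
- move=> e e0; have /cvgrPdist_le/(_ (emb e)) := us; rewrite cm_gt0 => /(_ e0).
  move=> [N _ hN]; exists N => k Nk; rewrite av_dist -cm_norm_le -box_sumE; exact: hN.
- by exists (emb M) => N; rewrite box_sum_norm cm_le.
- apply/cvgrPdist_le => e e0; have eE := cm_real cm (ltW e0).
  have : 0 < av e by rewrite -(cm_gt0) -eE.
  move=> /us[N hN]; exists N => // k /= Nk.
  by rewrite eE cm_norm_le av_dist box_sumE; exact: hN.
Qed.

Lemma absum_homo N k u : (N <= k)%N -> absum N u <= absum k u.
Proof.
move=> Nk; apply: sum_sub_le; rewrite ?uniq_box//; last by move=> a; exact: av_ge0.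
by move=> a; exact: box_le.
Qed.

Lemma bsum_dist N k u : (N <= k)%N -> av (bsum k u - bsum N u) <= absum k u - absum N u.
Proof.
move=> Nk; rewrite /bsum /absum.
have E (V : nmodType) (F : mindex m -> V) :
    \sum_(a <- box m N) F a = \sum_(a <- box m k | a \in box m N) F a.
  by rewrite -(sum_box_cond xpredT F Nk); apply: eq_bigl => a; rewrite andbT.
rewrite !E.
rewrite [X in av (X - _)](bigID (mem (box m N))) [X in _ <= X - _](bigID (mem (box m N))) /=.
by rewrite ![_ + _ - _]addrAC !subrr !add0r; exact: av_sum.
Qed.

Lemma sums_exists u M : (forall N, absum N u <= M) -> exists s, sums u s.
Proof.
move=> uM; have [|s us] := @cm_complete _ _ cm (fun N => bsum N u).
  move=> e e0.
  have [N hN] := real_gap (fun n k => @absum_homo n k u) uM e0.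
  by exists N => k Nk; apply: le_trans (bsum_dist u Nk) (hN k Nk).
by exists s; split; [exists M | exact: us].
Qed.

Lemma sums_le u s (M : R) : (forall N, absum N u <= M) -> sums u s -> av s <= M.
Proof.
move=> uM [_ us]; apply/ler_addgt0Pr => e e0; have [N hN] := us e e0.
have -> : s = bsum N u + (s - bsum N u) by rewrite addrC subrK.
apply: le_trans (avD _ _ _) _; rewrite lerD//.
  by apply: le_trans (uM N); exact: av_sum.
by rewrite av_dist; exact: hN.
Qed.

Lemma sums_unique u s t : sums u s -> sums u t -> s = t.
Proof.
move=> [_ us] [_ ut]; apply/eqP; rewrite -subr_eq0 -(av_eq0 av).
rewrite eq_le av_ge0 andbT; apply/ler_addgt0Pr => e e0; rewrite add0r.
have e2 : 0 < e / 2%:R by rewrite divr_gt0.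
have [N1 h1] := us _ e2; have [N2 h2] := ut _ e2.
have -> : s - t = (s - bsum (maxn N1 N2) u) + (bsum (maxn N1 N2) u - t) by rewrite addrA subrK.
apply: le_trans (avD _ _ _) _; rewrite av_dist [leRHS]splitr lerD//.
  by apply: h1; rewrite leq_maxl.
by apply: h2; rewrite leq_maxr.
Qed.

Lemma sumsD u v s t : sums u s -> sums v t -> sums (u + v) (s + t).
Proof.
move=> [[M uM] us] [[M' vM] vt]; split.
  exists (M + M') => N; apply: le_trans (lerD (uM N) (vM N)).
  by rewrite -big_split; apply: ler_sum => a _; exact: avD.
move=> e e0; have e2 : 0 < e / 2%:R by rewrite divr_gt0.
have [N1 h1] := us _ e2; have [N2 h2] := vt _ e2.
exists (maxn N1 N2) => k; rewrite geq_max => /andP[k1 k2].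
have -> : bsum k (u + v) - (s + t) = (bsum k u - s) + (bsum k v - t).
  by rewrite /bsum big_split /=; ring.
by apply: le_trans (avD _ _ _) _; rewrite [leRHS]splitr lerD// ?h1 ?h2.
Qed.

Lemma sumsZ (l : C) u s : sums u s -> sums (l *: u) (l * s).
Proof.
move=> [[M uM] us]; split.
  exists (av l * M) => N; apply: le_trans (ler_wpM2l (av_ge0 av l) (uM N)).
  by rewrite mulr_sumr; apply: ler_sum => a _; rewrite fpsZE avM.
move=> e e0; have l1 : 0 < av l + 1 by rewrite ltr_wpDl ?av_ge0.
have [N h] := us _ (divr_gt0 e0 l1); exists N => k /h {}h.
have -> : bsum k (l *: u) - l * s = l * (bsum k u - s).
  by rewrite /bsum mulrBr mulr_sumr.
rewrite avM; apply: (@le_trans _ _ ((av l + 1) * (e / (av l + 1)))).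
  by apply: ler_pM; rewrite ?av_ge0// lerDl.
by rewrite mulrC divfK// gt_eqF.
Qed.

Lemma cm_gap (x : nat -> C) : (forall n, 0 <= x n) ->
  (forall n k, (n <= k)%N -> x n <= x k) -> (exists M, forall n, x n <= M) ->
  forall e, 0 < e -> exists N, forall n, (N <= n)%N -> x n - x N <= e.
Proof.
move=> x0 xh [M xM] e e0.
have xE n : x n = emb (av (x n)) by exact: cm_real.
have ME : M = emb (av M) by apply: cm_real; apply: le_trans (xM 0%N).
have eE : e = emb (av e) by apply/cm_real/ltW.
have [|n||N hN] := @real_gap R (fun n => av (x n)) (av M) _ _ (av e).
- by move=> n k nk; rewrite -(cm_le cm) -!xE; exact: xh.
- by rewrite -(cm_le cm) -xE -ME.
- by rewrite -cm_gt0 -eE.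
exists N => n Nn; rewrite eE xE [x N]xE.
by rewrite lerBlDr -cm_add cm_le -lerBlDr hN.
Qed.

Lemma conv_fpsM u v : Defs.conv u v = u * v.
Proof.
apply/fpsP => g; pose N := (mdeg g).+1.
have gN : g \in box m N by exact: mdeg_box.
rewrite (fpsME _ _ gN) /Defs.conv.
pose F (a : mindex m) := u a * v [ffun i => g i - a i]%N.
have -> : \sum_(a : {ffun 'I_m -> 'I_(\sum_i g i).+1} | [forall i, (a i <= g i)%N])
    u [ffun i => val (a i)] * v [ffun i => g i - a i]%N =
  \sum_(a <- box m N | [forall i, (a i <= g i)%N]) F a.
  rewrite /box /image_mem big_map big_enum_cond /=; apply: eq_big => [a|a _].
    by apply: eq_forallb => i; rewrite ffunE.
  by congr (_ * v _); apply/ffunP => i; rewrite !ffunE.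
rewrite big_mkcond; apply: eq_bigr => a _; case: ifPn => [/forallP ag|/forallPn[i]].
  have gE b : (a + b == g) = (b == [ffun i => g i - a i]%N).
    apply/eqP/eqP => [<-|->]; apply/ffunP => i; rewrite ?mindexDE ffunE.
      by rewrite mindexDE addKn.
    by rewrite subnKC.
  under eq_bigr => b _ do rewrite gE.
  rewrite (sum_box1 (fun b => u a * v b))//.
  apply: (@box_addr _ _ a); rewrite (_ : a + _ = g)//.
  by apply/eqP; rewrite gE.
rewrite -ltnNge => ga; rewrite big1// => b _; case: eqP => // abg.
by move: ga; rewrite -abg mindexDE ltnNge leq_addr.
Qed.

Lemma sumsM u v s t : sums u s -> sums v t -> sums (u * v) (s * t).
Proof.
move=> /abs_sumP us /abs_sumP vt; apply/abs_sumP; rewrite -conv_fpsM.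
exact: abs_sumM cm_gap us vt.
Qed.

Lemma sums_finite N u : (forall a, a \notin box m N -> u a = 0) -> sums u (bsum N u).
Proof.
move=> u0; have E k : (N <= k)%N -> bsum k u = bsum N u by move=> Nk; exact: sum_box_widen.
split; last by move=> e e0; exists N => k Nk; rewrite E// subrr av0 ltW.
exists (absum N u) => k; have [kN|/ltnW Nk] := leqP k N; first exact: absum_homo.
by rewrite /absum (sum_box_widen Nk)// => a aN; rewrite u0// av0.
Qed.

End Sums.

(** * Evaluation of power series *)

Section Evaluation.
Variables (R : realType) (C : numClosedFieldType) (cm : complete_modulus R C) (m : nat).
Local Notation av := (cm_av cm).
Local Notation emb := (cm_emb cm).
Local Notation S := (fps m C).
Local Notation V := 'rV[C]_m.
Implicit Types (f g : S) (s t : C) (a b c : mindex m) (N k : nat) (x y M : R) (z w : V).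

Lemma monomialD z a b : monomial z (a + b) = monomial z a * monomial z b.
Proof. by rewrite /monomial -big_split; apply: eq_bigr => i _; rewrite mindexDE exprD. Qed.

Lemma monomial0 z : monomial z 0 = 1.
Proof. by rewrite /monomial big1// => i _; rewrite ffunE expr0. Qed.

Lemma monomial_unit z i : monomial z (munit i) = z 0 i.
Proof.
rewrite /monomial (bigD1 i)//= ffunE eqxx expr1 big1 ?mulr1// => j /negbTE ji.
by rewrite ffunE ji expr0.
Qed.

Definition polydisc x z := forall i, av (z 0 i) <= x.

Lemma polydisc_le x y z : x <= y -> polydisc x z -> polydisc y z.
Proof. by move=> xy zx i; apply: le_trans (zx i) xy. Qed.

Lemma polydiscD x y z w : polydisc x z -> polydisc y w -> polydisc (x + y) (z + w).
Proof. by move=> zx wy i; rewrite mxE; apply: le_trans (avD _ _ _) _; rewrite lerD. Qed.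

Lemma av_prod I (r : seq I) (P : pred I) (F : I -> C) :
  av (\prod_(i <- r | P i) F i) = \prod_(i <- r | P i) av (F i).
Proof. by apply: (big_morph av (avM av)); exact: av1. Qed.

Lemma av_monomial x z a : polydisc x z -> av (monomial z a) <= x ^+ mdeg a.
Proof.
move=> zx; rewrite /monomial av_prod /mdeg -prodrXr; apply: ler_prod => i _.
have x0 : 0 <= x by apply: le_trans (zx i); exact: av_ge0.
by rewrite avX exprn_ge0 ?av_ge0//= lerXn2r// nnegrE ?av_ge0.
Qed.

Definition eterm f z : S := fun a => f a * monomial z a.

Definition ev f z : C := xget 0 [set s | sums cm (eterm f z) s].

Lemma absum_eterm x f z M N : polydisc x z -> normle av x f M ->
  absum cm N (eterm f z) <= M.
Proof.
move=> zx fM; apply: le_trans (fM N); apply: ler_sum => a _.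
by rewrite /nterm /eterm avM ler_wpM2l ?av_ge0 ?av_monomial.
Qed.

Lemma evP x f z M : polydisc x z -> normle av x f M -> sums cm (eterm f z) (ev f z).
Proof.
move=> zx fM; rewrite /ev; case: xgetP => [//|no].
have [s us] := @sums_exists _ _ cm _ _ M (fun N => absum_eterm N zx fM).
by case: (no s).
Qed.

Lemma ev_eq f z s : sums cm (eterm f z) s -> ev f z = s.
Proof.
move=> us; rewrite /ev; case: xgetP => [y _ /= uy|no]; first exact: sums_unique uy us.
by case: (no s).
Qed.

Lemma ev_le x f z M : polydisc x z -> normle av x f M -> av (ev f z) <= M.
Proof. by move=> zx fM; apply: sums_le (evP zx fM) => N; exact: absum_eterm fM. Qed.

Lemma evD x f g z A B : polydisc x z -> normle av x f A -> normle av x g B ->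
  ev (f + g) z = ev f z + ev g z.
Proof.
move=> zx fA gB; apply: ev_eq.
rewrite (_ : eterm (f + g) z = eterm f z + eterm g z); first by apply: sumsD; [exact: evP fA|exact: evP gB].
by apply/fpsP => a; rewrite fpsDE /eterm fpsDE mulrDl.
Qed.

Lemma evZ x l f z M : polydisc x z -> normle av x f M -> ev (l *: f) z = l * ev f z.
Proof.
move=> zx fM; apply: ev_eq.
rewrite (_ : eterm (l *: f) z = l *: eterm f z); first by apply: sumsZ; exact: evP fM.
by apply/fpsP => a; rewrite fpsZE /eterm fpsZE mulrA.
Qed.

Lemma evN x f z M : polydisc x z -> normle av x f M -> ev (- f) z = - ev f z.
Proof. by move=> zx fM; rewrite -scaleN1r (evZ _ zx fM) mulN1r. Qed.

Lemma evB x f g z A B : polydisc x z -> normle av x f A -> normle av x g B ->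
  ev (f - g) z = ev f z - ev g z.
Proof.
by move=> zx fA gB; rewrite (evD zx fA (normleN gB)) (evN zx gB).
Qed.

Lemma etermM f g z : eterm (f * g) z = eterm f z * eterm g z.
Proof.
apply/fpsP => c; have cN := mdeg_box (ltnSn (mdeg c)).
rewrite /eterm !(fpsME _ _ cN) mulr_suml; apply: eq_bigr => a _.
rewrite mulr_suml; apply: eq_bigr => b _; case: eqP => [<-|_]; last by rewrite mul0r.
by rewrite monomialD; ring.
Qed.

Lemma evM x f g z A B : polydisc x z -> normle av x f A -> normle av x g B ->
  ev (f * g) z = ev f z * ev g z.
Proof.
move=> zx fA gB; apply: ev_eq; rewrite etermM.
by apply: sumsM; [exact: evP fA|exact: evP gB].
Qed.

Lemma ev_mon (l : C) a z : ev (l *: fps_mon C a) z = l * monomial z a.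
Proof.
apply: ev_eq; have aN := mdeg_box (ltnSn (mdeg a)).
have E b : eterm (l *: fps_mon C a) z b = if b == a then l * monomial z a else 0.
  by rewrite /eterm fpsZE /fps_mon; case: eqP => [->|_]; rewrite ?mulr1// mulr0 mul0r.
have -> : l * monomial z a = bsum (mdeg a).+1 (eterm (l *: fps_mon C a) z).
  rewrite /bsum; under eq_bigr => b _ do rewrite E.
  by rewrite (sum_box1 (fun=> l * monomial z a)).
by apply: sums_finite => b bN; rewrite E; case: eqP => // ba; rewrite ba aN in bN.
Qed.

Lemma ev_C (l : C) z : ev l%:A z = l.
Proof. by rewrite -fps_mon0 ev_mon monomial0 mulr1. Qed.

Lemma ev_1 z : ev 1 z = 1.
Proof. by rewrite -[X in ev X]scale1r ev_C. Qed.

Lemma ev_0 z : ev 0 z = 0.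
Proof. by rewrite -(scale0r 1) ev_C. Qed.

Lemma ev_X i z : ev (fps_X C i) z = z 0 i.
Proof. by rewrite -[fps_X C i]scale1r ev_mon mul1r monomial_unit. Qed.

Lemma ev_sum x I (r : seq I) (F : I -> S) (M : I -> R) z : 0 <= x -> polydisc x z ->
  (forall i, normle av x (F i) (M i)) ->
  ev (\sum_(i <- r) F i) z = \sum_(i <- r) ev (F i) z.
Proof.
move=> x0 zx FM; elim: r => [|i r IH]; first by rewrite !big_nil ev_0.
by rewrite !big_cons (evD zx (FM i) (normle_sum r x0 FM)) IH.
Qed.

Lemma normle_mon x a : 0 <= x -> normle av x (fps_mon C a) (x ^+ mdeg a).
Proof.
move=> x0 N.
rewrite (eq_bigr (fun b => if b == a then x ^+ mdeg a else 0)); last first.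
  move=> b _; rewrite /nterm /fps_mon; case: eqP => [->|_]; first by rewrite av1 mul1r.
  by rewrite av0 mul0r.
have [aN|aN] := boolP (a \in box m N); first by rewrite (sum_box1 (fun=> x ^+ mdeg a)).
rewrite big1_seq ?exprn_ge0// => b /= bN; case: eqP => // ba; by rewrite -ba bN in aN.
Qed.

Definition trunc N f : S := fun a => if a \in box m N then f a else 0.

Lemma truncE N f : trunc N f = \sum_(a <- box m N) f a *: fps_mon C a.
Proof.
apply/fpsP => b; rewrite fps_sumE /trunc; case: ifPn => bN.
  rewrite -[LHS](@sum_box1 _ _ N b f)//; apply: eq_bigr => a _.
  by rewrite fpsZE /fps_mon eq_sym; case: ifP => _; rewrite ?mulr1 ?mulr0.
rewrite big1_seq// => a /= aN; rewrite fpsZE /fps_mon; case: eqP => [ba|_].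
  by rewrite ba aN in bN.
by rewrite mulr0.
Qed.

(** The bounded increasing partial sums of the norm have arbitrarily small increments. *)
Lemma normle_tail x f M e : 0 <= x -> normle av x f M -> 0 < e ->
  exists N, normle av x (f - trunc N f) e.
Proof.
move=> x0 fM e0.
pose X N := \sum_(a <- box m N) nterm av x f a.
have Xh N k : (N <= k)%N -> X N <= X k.
  move=> Nk; apply: sum_sub_le; rewrite ?uniq_box//; last by move=> a; exact: nterm_ge0.
  by move=> a; exact: box_le.
have [N hN] := real_gap Xh fM e0; exists N => k.
have [kN|/ltnW Nk] := leqP k N.
  rewrite big1_seq ?ltW// => a /= ak.
  by rewrite /nterm fpsBE /trunc (box_le kN ak) subrr av0 mul0r.
apply: le_trans (hN k Nk); rewrite lerBrDr /X.
have -> : \sum_(a <- box m N) nterm av x f a = \sum_(a <- box m k) nterm av x (trunc N f) a.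
  rewrite (sum_box_widen Nk); last first.
    by move=> a /negbTE aN; rewrite /nterm /trunc aN av0 mul0r.
  by apply: eq_big_seq => a aN; rewrite /nterm /trunc aN.
rewrite -big_split; apply: ler_sum => a _ /=; rewrite /nterm fpsBE /trunc.
by case: ifP => _; rewrite ?subrr ?subr0 ?av0 ?mul0r ?add0r ?addr0.
Qed.

End Evaluation.

(** * Recentering *)

Section MultiBinomial.
Variables (m : nat).
Implicit Types (a b c : mindex m).

Definition mbin b c : nat := (\prod_i 'C(b i + c i, b i))%N.

Lemma mbin_unit j c : mbin (munit j) c = (c j).+1.
Proof.
rewrite /mbin (bigD1 j)//= big1 ?muln1 => [|i /negbTE ij].
  by rewrite ffunE eqxx bin1.
by rewrite ffunE ij bin0.
Qed.

Lemma multibinomial (A : comNzRingType) (p q : 'I_m -> A) N c : c \in box m N ->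
  \prod_i (p i + q i) ^+ c i =
  \sum_(b <- box m N) \sum_(d <- box m N)
    (if b + d == c then (mbin b d)%:R * (\prod_i p i ^+ d i) * (\prod_i q i ^+ b i) else 0).
Proof.
move=> cN; have cNi i : (c i < N)%N by move: cN; rewrite mem_box => /forallP.
pose F i (j : nat) : A := if (j <= c i)%N then p i ^+ (c i - j) * q i ^+ j *+ 'C(c i, j) else 0.
transitivity (\prod_i \sum_(j < N) F i j).
  apply: eq_bigr => i _; rewrite exprDn.
  rewrite (big_ord_widen N (fun j => p i ^+ (c i - j) * q i ^+ j *+ 'C(c i, j)))//.
  by rewrite big_mkcond; apply: eq_bigr => j _; rewrite /F ltnS.
rewrite bigA_distr_bigA /=.
transitivity (\sum_(b <- box m N) \prod_i F i (b i)).
  rewrite [in RHS]/box /image_mem big_map big_enum /=; apply: eq_bigr => f _.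
  by apply: eq_bigr => i _; rewrite ffunE.
apply: eq_bigr => b _.
have [/forallP bc|/forallPn[i]] := boolP [forall i, (b i <= c i)%N].
  pose d0 : mindex m := [ffun i => c i - b i]%N.
  have gE d : (b + d == c) = (d == d0).
    apply/eqP/eqP => [bdc|->]; apply/ffunP => i.
      by rewrite /d0 ffunE -bdc mindexDE addKn.
    by rewrite mindexDE [d0 i]ffunE subnKC.
  have d0N : d0 \in box m N.
    by apply: (@box_addr _ _ b); rewrite (_ : b + d0 = c)//; apply/eqP; rewrite gE.
  under [RHS]eq_bigr => d _ do rewrite gE.
  rewrite (sum_box1 (fun d => (mbin b d)%:R * (\prod_i p i ^+ d i) * \prod_i q i ^+ b i))//.
  rewrite /mbin natr_prod -!big_split; apply: eq_bigr => i _ /=.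
  by rewrite /F bc [d0 i]ffunE subnKC// -mulr_natl mulrA.
rewrite -ltnNge => cb; rewrite (bigD1 i)//= {1}/F leqNgt cb mul0r big1// => d _.
case: eqP => // bd; move: cb; rewrite -bd mindexDE ltnNge leq_addr//.
Qed.

End MultiBinomial.

Section Recenter.
Variables (R : realType) (C : numClosedFieldType) (cm : complete_modulus R C) (m : nat).
Local Notation av := (cm_av cm).
Local Notation S := (fps m C).
Local Notation V := 'rV[C]_m.
Implicit Types (f g : S) (a b c : mindex m) (N k : nat) (x y M : R) (z w : V).

(** The derivative of multi-index [b] divided by the factorials of [b]. *)
Definition divpart b f : S := fun c => (mbin b c)%:R * f (b + c).

(** The Taylor coefficients at [z] of the sum of [f]. *)
Definition recenter f z : S := fun b => ev cm (divpart b f) z.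

Lemma divpart_unit j f : divpart (munit j) f = partial j f.
Proof. by apply/fpsP => c; rewrite /divpart mbin_unit addrC. Qed.

Lemma divpartD b f g : divpart b (f + g) = divpart b f + divpart b g.
Proof. by apply/fpsP => c; rewrite fpsDE /divpart fpsDE mulrDr. Qed.

(** By the multinomial form of the binomial formula for [x + y], the left-hand side is a
    regrouping of part of the norm of [f] at [x + y]. *)
Lemma divpart_sum_le x y f M N L : 0 <= x -> 0 <= y -> normle av (x + y) f M ->
  \sum_(b <- box m N) (\sum_(c <- box m L) nterm av x (divpart b f) c) * y ^+ mdeg b <= M.
Proof.
move=> x0 y0 fM; have xy0 : 0 <= x + y by exact: addr_ge0.
apply: le_trans (fM (N + L)%N).
pose G b d : R := (mbin b d)%:R * x ^+ mdeg d * y ^+ mdeg b.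
have G0 b d : 0 <= G b d by rewrite !mulr_ge0 ?exprn_ge0.
apply: (@le_trans _ _ (\sum_(b <- box m (N + L)) \sum_(d <- box m (N + L))
   \sum_(c <- box m (N + L)) (if c == b + d then av (f c) * G b d else 0))).
  apply: (@le_trans _ _ (\sum_(b <- box m N) \sum_(d <- box m (N + L))
   \sum_(c <- box m (N + L)) (if c == b + d then av (f c) * G b d else 0))).
    rewrite big_seq [leRHS]big_seq; apply: ler_sum => b bN.
    rewrite mulr_suml.
    apply: (@le_trans _ _ (\sum_(d <- box m L)
      \sum_(c <- box m (N + L)) (if c == b + d then av (f c) * G b d else 0))).
      rewrite big_seq [leRHS]big_seq; apply: ler_sum => d dL.
      rewrite (sum_box1 (fun c => av (f c) * G b d)); last exact: box_add.
      by rewrite /nterm /divpart avM av_nat /G le_eqVlt; apply/orP; left; apply/eqP; ring.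
    apply: sum_sub_le; rewrite ?uniq_box//.
      by move=> d; apply: box_le; rewrite leq_addl.
    by move=> d; apply: sumr_ge0 => c _; case: ifP => // _; rewrite mulr_ge0 ?av_ge0.
  apply: sum_sub_le; rewrite ?uniq_box//.
    by move=> b; apply: box_le; rewrite leq_addr.
  move=> b; do 2!apply: sumr_ge0 => ? _; case: ifP => // _.
  by rewrite mulr_ge0 ?av_ge0.
under eq_bigr => b _ do rewrite exchange_big /=.
rewrite exchange_big /= big_seq [leRHS]big_seq; apply: ler_sum => c cN.
rewrite /nterm /mdeg -prodrXr.
rewrite (multibinomial (fun=> x) (fun=> y) cN) mulr_sumr; apply: ler_sum => b _.
rewrite mulr_sumr; apply: ler_sum => d _; rewrite eq_sym; case: ifP => _; last by rewrite mulr0.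
by rewrite /G !prodrXr.
Qed.

Lemma normle_divpart x y b f M : 0 <= x -> 0 < y -> normle av (x + y) f M ->
  normle av x (divpart b f) (M / y ^+ mdeg b).
Proof.
move=> x0 y0 fM L; rewrite ler_pdivlMr ?exprn_gt0//.
apply: le_trans (divpart_sum_le (mdeg b).+1 L x0 (ltW y0) fM).
rewrite [leRHS](bigD1_seq b) ?uniq_box ?mdeg_box//= lerDl; apply: sumr_ge0 => d _.
apply: mulr_ge0; last by rewrite exprn_ge0// ltW.
by apply: sumr_ge0 => c _; exact: nterm_ge0.
Qed.

Lemma normle_recenter x y f z M : 0 <= x -> 0 < y -> polydisc cm x z ->
  normle av (x + y) f M -> normle av y (recenter f z) M.
Proof.
move=> x0 y0 zx fM N.
have lim_le (r : seq (mindex m)) e : 0 < e -> exists L, forall k, (L <= k)%N ->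
  \sum_(b <- r) av (recenter f z b) * y ^+ mdeg b <=
  \sum_(b <- r) (\sum_(c <- box m k) nterm av x (divpart b f) c) * y ^+ mdeg b + e.
  elim: r e => [|b r IH] e e0; first by exists 0%N => k _; rewrite !big_nil add0r ltW.
  have e2 : 0 < e / 2%:R by rewrite divr_gt0.
  have yb : 0 < y ^+ mdeg b by rewrite exprn_gt0.
  have [L1 h1] := IH _ e2.
  have [_ /(_ _ (divr_gt0 e2 yb)) [L2 h2]] := evP zx (normle_divpart b x0 y0 fM).
  exists (maxn L1 L2) => k; rewrite geq_max => /andP[k1 k2].
  rewrite !big_cons [e]splitr addrACA lerD ?h1//.
  rewrite -ler_pdivlMr// mulrDl mulfK ?gt_eqF//.
  have := h2 k k2; rewrite av_dist; set u := bsum _ _ => hu.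
  have -> : recenter f z b = u + (recenter f z b - u) by rewrite addrC subrK.
  apply: le_trans (avD _ _ _) _; rewrite lerD//.
  apply: le_trans (av_sum _ _ _ _) _; apply: ler_sum => c _.
  by rewrite /eterm avM /nterm ler_wpM2l ?av_ge0 ?av_monomial.
apply/ler_addgt0Pr => e e0; have [L /(_ L (leqnn L)) hL] := lim_le (box m N) e e0.
by apply: le_trans hL _; rewrite lerD2r; exact: (divpart_sum_le N L x0 (ltW y0) fM).
Qed.

Lemma ev_recenter_trunc N f z w :
  ev cm (recenter (trunc N f) z) w = ev cm (trunc N f) (z + w).
Proof.
have t0 a : a \notin box m N -> trunc N f a = 0 by rewrite /trunc => /negbTE->.
have recE b : recenter (trunc N f) z b =
    \sum_(c <- box m N) (mbin b c)%:R * trunc N f (b + c) * monomial z c.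
  apply: ev_eq; apply: sums_finite => c cN; rewrite /eterm /divpart t0 ?mulr0 ?mul0r//.
  by apply: contra cN; exact: box_addr.
transitivity (\sum_(b <- box m N) \sum_(c <- box m N)
   (mbin b c)%:R * trunc N f (b + c) * monomial z c * monomial w b).
  apply: ev_eq; rewrite (_ : \sum_(b <- _) _ = bsum N (eterm (recenter (trunc N f) z) w)).
    apply: sums_finite => b bN; rewrite /eterm recE big1 ?mul0r// => c _.
    by rewrite t0 ?mulr0 ?mul0r//; apply: contra bN; exact: box_addl.
  by apply: eq_bigr => b _; rewrite /eterm recE mulr_suml.
apply/esym/ev_eq; rewrite (_ : \sum_(b <- _) _ = bsum N (eterm (trunc N f) (z + w))).
  by apply: sums_finite => a aN; rewrite /eterm t0 ?mul0r.
rewrite /bsum; transitivity (\sum_(a <- box m N) \sum_(b <- box m N) \sum_(c <- box m N)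
   (if b + c == a then trunc N f a * ((mbin b c)%:R * monomial z c * monomial w b) else 0)).
  rewrite [RHS]exchange_big /=; apply: eq_bigr => b _.
  rewrite [RHS]exchange_big /=; apply: eq_bigr => c _.
  have [bcN|bcN] := boolP (b + c \in box m N).
    under [RHS]eq_bigr => a _ do rewrite eq_sym.
    rewrite (sum_box1 (fun a => trunc N f a * ((mbin b c)%:R * monomial z c * monomial w b)))//.
    by ring.
  rewrite t0// mulr0 !mul0r big1_seq// => a /= aN; case: eqP => // bca.
  by rewrite bca aN in bcN.
apply: eq_big_seq => a aN; rewrite /eterm /monomial.
under [in RHS]eq_bigr => i _ do rewrite mxE.
rewrite (multibinomial (fun i => z 0 i) (fun i => w 0 i) aN) mulr_sumr.
apply: eq_bigr => b _; rewrite mulr_sumr; apply: eq_bigr => c _.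
by case: ifP => _; rewrite ?mulr0.
Qed.

(** For truncations this is a finite computation; the tails contribute little on either
    side, as recentering does not increase the norm. *)
Lemma ev_recenter x y f z w M : 0 <= x -> 0 < y -> polydisc cm x z -> polydisc cm y w ->
  normle av (x + y) f M -> ev cm (recenter f z) w = ev cm f (z + w).
Proof.
move=> x0 y0 zx wy fM; have xy0 : 0 <= x + y by rewrite addr_ge0// ltW.
have y0' := ltW y0; have zwxy := polydiscD zx wy.
apply/eqP; rewrite -subr_eq0 -(av_eq0 av) eq_le av_ge0 andbT.
apply/ler_addgt0Pr => e e0; rewrite add0r.
have e2 : 0 < e / 2%:R by rewrite divr_gt0.
have [N fN] := normle_tail xy0 fM e2; pose g := f - trunc N f.
have fE : f = trunc N f + g by rewrite /g addrC subrK.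
have tM : normle av (x + y) (trunc N f) M.
  apply: normle_coef fM => // a; rewrite /trunc; case: ifP => _ //.
  by rewrite av0 av_ge0.
have recD : recenter f z = recenter (trunc N f) z + recenter g z.
  apply/fpsP => b; rewrite fpsDE /recenter.
  rewrite -(evD zx (normle_divpart b x0 y0 tM) (normle_divpart b x0 y0 fN)).
  by rewrite -divpartD -fE.
rewrite recD (evD wy (normle_recenter x0 y0 zx tM) (normle_recenter x0 y0 zx fN)).
rewrite ev_recenter_trunc.
have -> : ev cm f (z + w) = ev cm (trunc N f) (z + w) + ev cm g (z + w).
  by rewrite -(evD zwxy tM fN) -fE.
rewrite opprD addrACA subrr add0r [leRHS]splitr.
apply: le_trans (avD _ _ _) _; rewrite avN lerD//.
  exact: ev_le (normle_recenter x0 y0 zx fN).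
exact: ev_le fN.
Qed.

End Recenter.

(** * Power series of holomorphic germs *)

Section Polydiscs.
Variables (R : realType) (C : numClosedFieldType) (cm : complete_modulus R C) (m : nat).
Local Notation av := (cm_av cm).
Local Notation emb := (cm_emb cm).
Local Notation S := (fps m C).
Local Notation V := 'rV[C]_m.
Implicit Types (f g : S) (x y M : R) (z w a : V).

Lemma polydisc_normP x z : 0 <= x -> (`|z| <= emb x) <-> polydisc cm x z.
Proof.
move=> x0; have e0 : 0 <= emb x by rewrite -(cm_emb0 cm) cm_le.
split=> [zx i|zx].
  rewrite -(cm_norm_le cm); apply: le_trans zx.
  rewrite -[leRHS]/(mx_norm z) mx_normE.
  by apply: (le_bigmax _ (fun j : 'I_1 * 'I_m => `|z j.1 j.2|%:nng) (0, i)).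
rewrite -[leLHS]/(mx_norm z) mx_normE; have [e eE] : exists e : {nonneg C}, emb x = e%:num by exists (NngNum e0).
rewrite eE num_le; apply/bigmax_leP; split=> [|[j i] _] /=.
  by rewrite -num_le /= -eE.
by rewrite -num_le /= -eE [j]ord1 cm_norm_le; exact: zx.
Qed.

Lemma near_polydisc a y : 0 < y -> \forall z \near a, polydisc cm y (z - a).
Proof.
move=> y0; have e0 : 0 < emb y by rewrite cm_gt0.
near=> z; apply/polydisc_normP; first exact: ltW.
rewrite distrC; near: z; exact: cvgr_dist_le.
Unshelve. all: by end_near. Qed.

Lemma nbhs_polydisc a (P : set V) : (\forall z \near a, P z) ->
  exists y, 0 < y /\ forall z, polydisc cm y (z - a) -> P z.
Proof.
move=> /nbhs_ballP[e /= e0 eP]; have eE := cm_real cm (ltW e0).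
have ae0 : 0 < av e by rewrite -(cm_gt0 cm) -eE.
exists (av e / 2%:R); split; first by rewrite divr_gt0.
move=> z za; apply: eP; rewrite -ball_normE /= distrC.
apply: (@le_lt_trans _ _ (emb (av e / 2%:R))).
  by apply/polydisc_normP => //; rewrite divr_ge0// ltW.
by rewrite [ltRHS]eE cm_lt; lra.
Qed.

(** The absolute summability is required up to the radius [x], in the form of a bound on
    the norm: smaller polydiscs and recentered series inherit it. *)
Definition represents (F : V -> C) f x :=
  [/\ 0 < x, exists M, normle av x f M & forall z, polydisc cm x z -> F z = ev cm f z].

Lemma represents_le F f x y : 0 < y -> y <= x -> represents F f x -> represents F f y.
Proof.
move=> y0 yx [x0 [M fM] Ff]; split=> //.
  by exists M; apply: normle_mono yx fM; exact: ltW.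
by move=> z zy; apply: Ff; exact: polydisc_le zy.
Qed.

Lemma analytic_at_represents F a : analytic_at F a ->
  exists f x, represents (fun w => F (a + w)) f x.
Proof.
move=> [c /nbhs_polydisc[y [y0 cy]]]; exists c, y; split => //.
  (* At the point all of whose coordinates are [y], the moduli of the terms are those of
     the norm of radius [y]. *)
  pose w : V := const_mx (emb y).
  have wy : polydisc cm y (a + w - a).
    by move=> i; rewrite addrC addKr mxE cm_av_emb// ltW.
  have [[M cM] _] := (abs_sumP cm _ _).1 (cy _ wy).
  exists M => N; apply: le_trans (cM N); apply: ler_sum => b _.
  rewrite /nterm avM ler_wpM2l ?av_ge0// /monomial av_prod /mdeg -prodrXr.
  apply: ler_prod => i _; rewrite avX exprn_ge0 ?(ltW y0)//=.
  by rewrite addrC addKr mxE cm_av_emb// ltW.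
move=> z zy; have zya : polydisc cm y (a + z - a) by rewrite addrC addKr.
have /abs_sumP H := cy _ zya; apply/esym/ev_eq.
by rewrite [a + z - a]addrC addKr in H; exact: H.
Qed.

Lemma holomorphic_represents F : holomorphic_germ F -> exists f x, represents F f x.
Proof.
move=> /nbhs_singleton/analytic_at_represents[f [x Ff]]; exists f, x.
by rewrite (_ : F = (fun w => F (0 + w)))//; apply/funext => w; rewrite add0r.
Qed.

Lemma represents_recenter F f x a : represents F f x -> polydisc cm (x / 2%:R) a ->
  represents (fun w => F (a + w)) (recenter cm f a) (x / 2%:R).
Proof.
move=> [x0 [M fM] Ff] ax; have x2 : 0 < x / 2%:R by rewrite divr_gt0.
rewrite [x]splitr in fM; split=> //.
  by exists M; apply: normle_recenter (ltW x2) x2 ax fM.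
move=> w wx; rewrite (ev_recenter (ltW x2) x2 ax wx fM); apply: Ff.
by rewrite [x]splitr; exact: polydiscD.
Qed.

Lemma represents_analytic F f x a : represents (fun w => F (a + w)) f x -> analytic_at F a.
Proof.
move=> [x0 [M fM] Ff]; exists f; near=> z; apply/(abs_sumP cm).
have zx : polydisc cm x (z - a) by near: z; exact: near_polydisc.
have -> : F z = ev cm f (z - a) by rewrite -Ff// subrKC.
exact: evP zx fM.
Unshelve. all: by end_near. Qed.

Lemma represents_holomorphic F f x : represents F f x -> holomorphic_germ F.
Proof.
move=> Ff; have [x0 _ _] := Ff; have x2 : 0 < x / 2%:R by rewrite divr_gt0.
rewrite /holomorphic_germ; near=> a; apply: represents_analytic.
apply: represents_recenter Ff _; rewrite -[a]subr0; near: a; exact: near_polydisc.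
Unshelve. all: by end_near. Qed.

End Polydiscs.

(** * Differentials *)

Section Linearization.
Variables (R : realType) (C : numClosedFieldType) (cm : complete_modulus R C) (m : nat).
Local Notation av := (cm_av cm).
Local Notation emb := (cm_emb cm).
Local Notation S := (fps m C).
Local Notation V := 'rV[C]_m.
Implicit Types (f g : S) (x y M : R) (z w a : V).

Lemma ev_at0 f : ev cm f 0 = f 0.
Proof.
apply: ev_eq; have E (b : mindex m) : eterm f 0 b = if b == 0 then f 0 else 0.
  rewrite /eterm; case: eqP => [->|/eqP b0]; first by rewrite monomial0 mulr1.
  have [i ai] := mindex_neq0 b0.
  by rewrite /monomial (bigD1 i)//= mxE expr0n (negbTE ai) mul0r mulr0.
have b0 : (0 : mindex m) \in box m 1 by rewrite mdeg_box// mdeg0.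
rewrite (_ : f 0 = bsum 1 (eterm f 0)).
  apply: sums_finite => b b1; rewrite E; case: eqP => // e0; by rewrite e0 b0 in b1.
rewrite /bsum; under eq_bigr => b _ do rewrite E.
by rewrite (sum_box1 (fun=> f 0)).
Qed.

Definition affine_part f : S := (f 0)%:A + \sum_i f (munit i) *: fps_X C i.

Lemma ordge_affine_part f : ordge 2 (f - affine_part f).
Proof.
move=> a a2; rewrite fpsBE /affine_part fpsDE fps_sumE fpsZE fps1E.
have [->|a0] := eqVneq a 0.
  rewrite mulr1 big1 ?addr0 ?subrr// => i _.
  by rewrite fpsZE /fps_X /fps_mon eq_sym -mdeg_eq0 mdeg_unit mulr0.
have [i ai] : exists i, a = munit i.
  have [i ai] := mindex_neq0 a0.
  exists i; apply/ffunP => j; rewrite ffunE.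
  move: a2; rewrite /mdeg (bigD1 i)//= => a2.
  have [->|ji] := eqVneq j i; first by lia.
  by move: a2; rewrite (bigD1 j)//=; lia.
rewrite mulr0 add0r ai (bigD1 i)//= fpsZE /fps_X {1}/fps_mon eqxx mulr1.
rewrite big1 ?addr0 ?subrr// => j ji; rewrite fpsZE /fps_mon.
case: eqP => [/ffunP/(_ i)|_]; last by rewrite mulr0.
by rewrite !ffunE eqxx eq_sym (negbTE ji).
Qed.

Lemma normle_affine_part f x : 0 <= x ->
  normle av x (affine_part f) (av (f 0) + \sum_i av (f (munit i)) * x).
Proof.
move=> x0; apply: normleD => //.
  rewrite -[X in normle _ _ _ X]mulr1; apply: normleZ.
  by have := @normle_mon _ _ cm m x 0 x0; rewrite mdeg0 expr0.
apply: normle_sum => // i; apply: normleZ.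
by have := @normle_mon _ _ cm m x (munit i) x0; rewrite mdeg_unit expr1.
Qed.

Lemma ev_affine_part f x w : 0 <= x -> polydisc cm x w ->
  ev cm (affine_part f) w = f 0 + \sum_i w 0 i * f (munit i).
Proof.
move=> x0 wx; have Xn i := @normle_mon _ _ cm m x (munit i) x0.
rewrite /affine_part.
have h1 : normle av x ((f 0)%:A : S) (av (f 0) * x ^+ mdeg (0 : mindex m)).
  by apply: normleZ; exact: normle_mon.
have h2 i : normle av x (f (munit i) *: fps_X C i) (av (f (munit i)) * x ^+ mdeg (munit i)).
  by apply: normleZ; exact: normle_mon.
rewrite (evD wx h1 (normle_sum _ x0 h2)) ev_C (ev_sum _ x0 wx h2); congr (_ + _).
by apply: eq_bigr => i _; rewrite (evZ _ wx (Xn i)) ev_X mulrC.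
Qed.

End Linearization.

Section Differential.
Variables (R : realType) (C : numClosedFieldType) (cm : complete_modulus R C) (m m' : nat).
Local Notation av := (cm_av cm).
Local Notation emb := (cm_emb cm).
Local Notation V := 'rV[C]_m.
Local Notation W := 'rV[C]_m'.
Implicit Types (x y M : R) (z w a : V).

Lemma mulmxr_continuous (A : 'M[C]_(m, m')) : continuous (mulmxr A : V -> W).
Proof.
apply: bounded_linear_continuous; apply/linear_boundedP.
pose M : R := \sum_i \sum_j av (A i j).
have M0 : 0 <= M by do 2!apply: sumr_ge0 => ? _; exact: av_ge0.
near=> r => w; apply: (@le_trans _ _ (emb M * `|w|)); last first.
  apply: ler_wpM2r => //; near: r; apply: nbhs_pinfty_ge.
  by rewrite ger0_real// -(cm_emb0 cm) cm_le.
have wE := cm_real cm (normr_ge0 w); rewrite wE -(cm_mul cm).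
have w0 : 0 <= av `|w| by exact: av_ge0.
apply/polydisc_normP; first exact: mulr_ge0.
have wp : polydisc cm (av `|w|) w by apply/polydisc_normP => //; rewrite -wE.
move=> j; rewrite /= mxE; apply: le_trans (av_sum _ _ _ _) _.
rewrite /M mulr_suml; apply: ler_sum => i _; rewrite avM mulrC.
apply: ler_pM; rewrite ?av_ge0//.
by rewrite (bigD1 j)//= lerDl; apply: sumr_ge0 => k _; exact: av_ge0.
Unshelve. all: by end_near. Qed.

(** Subtracting the affine part leaves a series of order 2, which is of size [rho ^+ 2] on
    the polydisc of radius [rho]. *)
Lemma diff_represents (F : V -> W) a (g : 'I_m' -> fps m C) x : 0 < x ->
  (forall j, represents cm (fun w => F (a + w) 0 j) (g j) x) ->
  'd F a = mulmxr (\matrix_(i, j) g j (munit i)) :> (V -> W).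
Proof.
move=> x0 Fg; apply: diff_unique; first exact: mulmxr_continuous.
apply/eqaddoP => e e0 /=; have eE := cm_real cm (ltW e0).
have /choice[M gM] : forall j, exists M, normle av x (g j) M by move=> j; have [] := Fg j.
pose g2 j := g j - affine_part (g j).
pose N j := M j + (av (g j 0) + \sum_i av (g j (munit i)) * x).
have g2N j : normle av x (g2 j) (N j).
  by apply: normleB; [exact: ltW|exact: gM|apply: normle_affine_part; exact: ltW].
have N0 j : 0 <= N j by exact: normle_ge0 (g2N j).
pose Nt := \sum_j N j + 1.
have Nt0 : 0 < Nt by rewrite ltr_wpDl// sumr_ge0.
have Ntj j : N j <= Nt.
  by rewrite /Nt (bigD1 j)//= -addrA lerDl addr_ge0// sumr_ge0.
have ae0 : 0 < av e by rewrite -(cm_gt0 cm) -eE.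
(* For [rho <= d] the remainder [Nt * (rho / x) ^+ 2] is at most [av e * rho]. *)
pose d := Num.min x (av e * x ^+ 2 / Nt).
have d0 : 0 < d by rewrite lt_min x0 divr_gt0// mulr_gt0// exprn_gt0.
near=> w; have wd : polydisc cm d w.
  by rewrite -[w]subr0; near: w; exact: near_polydisc.
have wE := cm_real cm (normr_ge0 w); set rho := av `|w| in wE.
have rho0 : 0 <= rho by exact: av_ge0.
have wrho : polydisc cm rho w by apply/(polydisc_normP cm) => //; rewrite -wE.
have rhod : rho <= d.
  by rewrite -(cm_le cm) -wE; apply/(polydisc_normP cm) => //; exact: ltW.
have rhox : rho <= x by apply: le_trans rhod _; rewrite ge_min lexx.
have rhoe : Nt * rho <= av e * x ^+ 2.
  rewrite mulrC -ler_pdivlMr//; apply: le_trans rhod _.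
  by rewrite ge_min lexx orbT.
rewrite eE wE -(cm_mul cm); apply/(polydisc_normP cm).
  by rewrite mulr_ge0// ltW.
move=> j; have wx := polydisc_le rhox wrho.
have -> : ((F \o shift a) - (cst (F a) + mulmxr (\matrix_(i, j) g j (munit i)))) w 0 j =
    ev cm (g2 j) w.
  have [_ _ Fj] := Fg j.
  rewrite /g2 (evB wx (gM j) (normle_affine_part cm _ (ltW x0))).
  rewrite (ev_affine_part _ (ltW x0) wx) -(Fj _ wx).
  have -> : g j 0 = F a 0 j.
    rewrite -(ev_at0 cm) -Fj ?addr0// => i; by rewrite mxE av0 ltW.
  rewrite -[LHS]/((F (w + a) - (F a + w *m (\matrix_(i, j) g j (munit i)))) 0 j).
  rewrite !mxE [w + a]addrC; congr (_ - (_ + _)).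
  by apply: eq_bigr => i _; rewrite mxE.
apply: le_trans (ev_le wrho (normle_order x0 rho0 rhox (@ordge_affine_part _ _ (g j)) (g2N j))) _.
apply: (@le_trans _ _ (Nt * (rho / x) ^+ 2)).
  by apply: ler_wpM2r; rewrite ?exprn_ge0 ?divr_ge0 ?(ltW x0).
rewrite expr_div_n mulrA ler_pdivrMr ?exprn_gt0//.
by have := ler_wpM2r rho0 rhoe; clear; lra.
Unshelve. all: by end_near. Qed.

End Differential.

(** * Automorphisms as substitutions *)

Lemma mindex_ind m (P : mindex m -> Prop) : P 0 ->
  (forall i a, P a -> P (munit i + a)) -> forall a, P a.
Proof.
move=> P0 PS a; move: {-1}(mdeg a) (leqnn (mdeg a)) => k.
elim: k a => [|k IH] a; first by rewrite leqn0 mdeg_eq0 => /eqP->.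
move=> ak; have [->//|a0] := eqVneq a 0.
have [i ai] := mindex_neq0 a0.
have aE : a = munit i + [ffun j => a j - munit i j]%N.
  by apply: mindex_subK => j; rewrite ffunE; case: eqP => [->|]; rewrite ?lt0n.
rewrite aE; apply/PS/IH.
by move: ak; rewrite {1}aE mdegD mdeg_unit add1n.
Qed.

Section Substitution.
Variables (R : realType) (C : numClosedFieldType) (cm : complete_modulus R C) (n : nat).
Local Notation m := (n + n)%N.
Local Notation av := (cm_av cm).
Local Notation S := (fps m C).
Local Notation V := 'rV[C]_m.
Implicit Types (f g : S) (x y M : R) (z w : V).
Variables (T : S -> S) (r A : R).
Hypothesis T_auto : poisson_auto T.
Hypothesis r_gt0 : 0 < r.
Hypothesis TX_norm : forall j, normle av r (T (fps_X C j)) A.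

Definition auto_map z : V := \row_j ev cm (T (fps_X C j)) z.

Let Tl := pa_lin T_auto.

(** The series [T X_j] have order 1 and are therefore small on small polydiscs. *)
Lemma auto_radius rho : 0 < rho -> exists s, [/\ 0 < s, s <= r &
  forall j, normle av s (T (fps_X C j)) rho].
Proof.
move=> rho0; pose B := Num.max A 0; have B0 : 0 <= B by rewrite le_max lexx orbT.
have q0 : 0 < rho / (B + 1) by rewrite divr_gt0//; lra.
exists (Num.min r (r * (rho / (B + 1)))); split.
- by rewrite lt_min r_gt0 mulr_gt0.
- by rewrite ge_min lexx.
set s := Num.min _ _ => j.
have s0 : 0 <= s by rewrite le_min !ltW// mulr_gt0.
have sr : s <= r by rewrite ge_min lexx.
have T1 : ordge 1 (T (fps_X C j)) by apply: (pa_ord T_auto); exact: ordge_X.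
have := normle_order r_gt0 s0 sr T1 (@TX_norm j); apply: normle_le; rewrite expr1.
apply: (@le_trans _ _ ((B + 1) * (s / r))).
  apply: ler_wpM2r; first by rewrite divr_ge0// ltW.
  by apply: (@le_trans _ _ B); [rewrite le_max lexx | lra].
rewrite -ler_pdivlMl; last lra.
by rewrite ler_pdivrMr// mulrC [_^-1 * _]mulrC ge_min lexx orbT.
Qed.

Section Radius.
Variables (rho s : R).
Hypotheses (rho_gt0 : 0 < rho) (s_gt0 : 0 < s).
Hypothesis TXs : forall j, normle av s (T (fps_X C j)) rho.

Lemma auto_map_polydisc z : polydisc cm s z -> polydisc cm rho (auto_map z).
Proof. by move=> zs j; rewrite mxE; apply: ev_le zs (@TXs j). Qed.

Lemma auto_mon a : normle av s (T (fps_mon C a)) (rho ^+ mdeg a) /\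
  forall z, polydisc cm s z -> ev cm (T (fps_mon C a)) z = monomial (auto_map z) a.
Proof.
elim/mindex_ind: a => [|i a [IH1 IH2]].
  rewrite fps_mon0 (pa_1 T_auto) mdeg0 expr0; split.
    by have := @normle_mon _ _ cm m s 0 (ltW s_gt0); rewrite mdeg0 expr0.
  by move=> z _; rewrite ev_1 monomial0.
rewrite -fps_monM (pa_mul T_auto) mdegD mdeg_unit add1n exprS; split.
  by apply: normleM => //; [exact: ltW | exact: TXs].
by move=> z zs; rewrite (evM zs (@TXs i) IH1) IH2// monomialD monomial_unit mxE.
Qed.

Lemma auto_trunc N f : T (trunc N f) = \sum_(a <- box m N) f a *: T (fps_mon C a).
Proof. by rewrite truncE (lin_sum _ _ _ Tl); apply: eq_bigr => a _; rewrite linZ. Qed.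

Lemma ordge_trunc_sub N f : ordge N (f - trunc N f).
Proof. by move=> a aN; rewrite fpsBE /trunc mdeg_box// subrr. Qed.

(** For polynomials the bound follows from that on monomials. A finite set of
    coefficients of [T f] only depends on a truncation of [f], because [T] preserves
    orders. *)
Lemma auto_norm f M : normle av rho f M -> normle av s (T f) M.
Proof.
move=> fM N; pose L := (m * N).+1.
have tr : normle av s (T (trunc L f)) (\sum_(a <- box m L) nterm av rho f a).
  rewrite auto_trunc; apply: normle_sum => [|a]; first exact: ltW.
  by apply: normleZ; have [] := auto_mon a.
apply: le_trans (fM L); apply: le_trans (tr N).
rewrite big_seq [leRHS]big_seq; apply: ler_sum => a /box_mdeg aN.
rewrite /nterm; have -> // : T f a = T (trunc L f) a.
apply: (@ordge_trunc _ _ L) => //; rewrite -(linB _ _ Tl).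
by apply: (pa_ord T_auto); exact: ordge_trunc_sub.
Qed.

(** Both sides are ring homomorphisms in [f] and agree on the coordinates, hence on
    truncations of [f]; the tails are small by [auto_norm]. *)
Lemma auto_ev f z M : normle av rho f M -> polydisc cm s z ->
  ev cm (T f) z = ev cm f (auto_map z).
Proof.
move=> fM zs; apply/eqP; rewrite -subr_eq0 -(av_eq0 av) eq_le av_ge0 andbT.
apply/ler_addgt0Pr => e e0; rewrite add0r.
have e2 : 0 < e / 2%:R by rewrite divr_gt0.
have [N fN] := normle_tail (ltW rho_gt0) fM e2.
have tM : normle av rho (trunc N f) M.
  apply: normle_coef fM => [|a]; first exact: ltW.
  by rewrite /trunc; case: ifP => _ //; rewrite av0 av_ge0.
have zr := auto_map_polydisc zs.
have trE : ev cm (T (trunc N f)) z = ev cm (trunc N f) (auto_map z).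
  have Tn a : normle av s (f a *: T (fps_mon C a)) (av (f a) * rho ^+ mdeg a).
    by apply: normleZ; have [] := auto_mon a.
  have mn a : normle av rho (f a *: fps_mon C a) (av (f a) * rho ^+ mdeg a).
    by apply: normleZ; apply: normle_mon; exact: ltW.
  rewrite auto_trunc (ev_sum _ (ltW s_gt0) zs Tn) truncE (ev_sum _ (ltW rho_gt0) zr mn).
  apply: eq_bigr => a _; have [h1 h2] := auto_mon a.
  by rewrite (evZ _ zs h1) h2// ev_mon.
have := evB zr fM tM; have := evB zs (auto_norm fM) (auto_norm tM).
rewrite -(linB _ _ Tl) trE => h1 h2.
have -> : ev cm (T f) z - ev cm f (auto_map z) =
   ev cm (T (f - trunc N f)) z - ev cm (f - trunc N f) (auto_map z).
  by rewrite h1 h2; ring.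
rewrite [leRHS]splitr; apply: le_trans (avD _ _ _) _; rewrite avN lerD//.
  exact: ev_le (auto_norm fN).
exact: ev_le fN.
Qed.

End Radius.

Lemma auto_map0 : auto_map 0 = 0.
Proof.
apply/rowP => j; rewrite !mxE ev_at0.
have T1 : ordge 1 (T (fps_X C j)) by apply: (pa_ord T_auto); exact: ordge_X.
by apply: T1; rewrite mdeg0.
Qed.

Lemma auto_map_represents j : represents cm (fun z => auto_map z 0 j) (T (fps_X C j)) r.
Proof. by split=> // [|z _]; [exists A; exact: TX_norm | rewrite mxE]. Qed.

Lemma auto_represents F f x : represents cm F f x ->
  exists s, represents cm (F \o auto_map) (T f) s.
Proof.
move=> [x0 [M fM] Ff]; have [s [s0 sr TXs]] := auto_radius x0.
exists s; split=> //; first by exists M; exact: auto_norm TXs _ _ fM.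
by move=> z zs /=; rewrite (auto_ev x0 s0 TXs fM zs) Ff//; exact: auto_map_polydisc TXs _ zs.
Qed.

End Substitution.

(** * Germs, their series and the ideal of the products q_i p_i *)

Section GermSeries.
Variables (R : realType) (m : nat).
Local Notation C := (Cplx R).
Local Notation cm := (Cplx_modulus R).
Local Notation av := (cm_av cm).
Local Notation S := (fps m C).
Local Notation V := 'rV[C]_m.
Implicit Types (f g : S) (u v : germ R m) (x y M : R).

Lemma represents_near (F G : V -> C) f x : represents cm F f x ->
  (\forall z \near (0 : V), F z = G z) -> exists y, represents cm G f y.
Proof.
move=> Ff /(nbhs_polydisc cm)[y [y0 FG]]; have [x0 _ _] := Ff.
have xy0 : 0 < Num.min x y by rewrite lt_min x0.
have xyx : Num.min x y <= x by rewrite ge_min lexx.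
have [_ fM Fz] := represents_le xy0 xyx Ff.
exists (Num.min x y); split=> // z zxy; rewrite -Fz// FG// subr0.
by apply: polydisc_le zxy; rewrite ge_min lexx orbT.
Qed.

Definition germ_series u f := exists x, represents cm (germ_fun u) f x.

Lemma germ_series_of (F : holo R m) f x : represents cm F f x -> germ_series (germ_of F) f.
Proof.
move=> Ff; apply: represents_near Ff _.
have := germ_fun_of F; apply: filterS => z -> //.
Qed.

Lemma germ_series_exists u : exists f, germ_series u f.
Proof.
have /asboolP := valP (repr u : holo R m).
by move=> /(holomorphic_represents cm)[f [x Ff]]; exists f, x.
Qed.

Lemma germ_series_inj u v f : germ_series u f -> germ_series v f -> u = v.
Proof.
move=> [x [x0 _ uf]] [y [y0 _ vf]]; rewrite -(germ_funK u) -(germ_funK v).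
apply/germ_of_eqP; near=> z.
have zx : polydisc cm x z by rewrite -[z]subr0; near: z; exact: near_polydisc.
have zy : polydisc cm y z by rewrite -[z]subr0; near: z; exact: near_polydisc.
by rewrite -[LHS]/(germ_fun u z) -[RHS]/(germ_fun v z) uf// vf.
Unshelve. all: by end_near. Qed.

Lemma germ_series_intro f x M : 0 < x -> normle av x f M -> exists u, germ_series u f.
Proof.
move=> x0 fM; have Ff : represents cm (ev cm f) f x by split=> //; exists M.
have Fh : ev cm f \in @holomorphic_pred R m.
  by apply/asboolP; exact: represents_holomorphic Ff.
by exists (germ_of (Holo Fh)); apply: (@germ_series_of (Holo Fh) f x); exact: Ff.
Qed.

Lemma germ_funD u v : \forall z \near (0 : V), germ_fun (u + v) z = germ_fun u z + germ_fun v z.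
Proof.
have -> : u + v = germ_of (repr u + repr v).
  by rewrite -{1}(germ_funK u) -{1}(germ_funK v) /germ_of !piE.
exact: germ_fun_of.
Qed.

Lemma germ_funM u v : \forall z \near (0 : V), germ_fun (u * v) z = germ_fun u z * germ_fun v z.
Proof.
have -> : u * v = germ_of (repr u * repr v).
  by rewrite -{1}(germ_funK u) -{1}(germ_funK v) /germ_of !piE.
exact: germ_fun_of.
Qed.

Lemma germ_fun1 : \forall z \near (0 : V), germ_fun (1 : germ R m) z = 1.
Proof.
have -> : (1 : germ R m) = germ_of (1 : holo R m) by rewrite /germ_of !piE.
exact: germ_fun_of.
Qed.

Lemma germ_seriesD u v f g : germ_series u f -> germ_series v g -> germ_series (u + v) (f + g).
Proof.
move=> [x uf] [y vg]; have [x0 _ _] := uf; have [y0 _ _] := vg.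
have s0 : 0 < Num.min x y by rewrite lt_min x0.
have sx : Num.min x y <= x by rewrite ge_min lexx.
have sy : Num.min x y <= y by rewrite ge_min lexx orbT.
have [_ [M fM] uz] := represents_le s0 sx uf.
have [_ [N gN] vz] := represents_le s0 sy vg.
apply: (@represents_near (fun z => germ_fun u z + germ_fun v z) _ _ (Num.min x y)).
  split=> //; first by exists (M + N); apply: normleD => //; exact: ltW.
  by move=> z zs; rewrite uz// vz// (evD zs fM gN).
by have := germ_funD u v; apply: filterS => z ->.
Qed.

Lemma germ_seriesM u v f g : germ_series u f -> germ_series v g -> germ_series (u * v) (f * g).
Proof.
move=> [x uf] [y vg]; have [x0 _ _] := uf; have [y0 _ _] := vg.
have s0 : 0 < Num.min x y by rewrite lt_min x0.
have sx : Num.min x y <= x by rewrite ge_min lexx.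
have sy : Num.min x y <= y by rewrite ge_min lexx orbT.
have [_ [M fM] uz] := represents_le s0 sx uf.
have [_ [N gN] vz] := represents_le s0 sy vg.
apply: (@represents_near (fun z => germ_fun u z * germ_fun v z) _ _ (Num.min x y)).
  split=> //; first by exists (M * N); apply: normleM => //; exact: ltW.
  by move=> z zs; rewrite uz// vz// (evM zs fM gN).
by have := germ_funM u v; apply: filterS => z ->.
Qed.

Lemma germ_series_cst (l : C) : germ_series (germ_cst m l) l%:A.
Proof.
apply: (@germ_series_of _ _ 1); split=> //; last by move=> z _; rewrite ev_C.
exists (av l * 1 ^+ mdeg (0 : mindex m)).
by apply: normleZ; exact: (@normle_mon _ _ cm m 1 0 ler01).
Qed.

Lemma germ_series_coord i : germ_series (germ_coord R i) (fps_X C i).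
Proof.
apply: (@germ_series_of _ _ 1); split=> //; last by move=> z _; rewrite ev_X.
exists (1 ^+ mdeg (munit i)); exact: (@normle_mon _ _ cm m 1 (munit i) ler01).
Qed.

Lemma germ_series0 : germ_series 0 0.
Proof.
have := germ_series_cst 0; rewrite scale0r; suff -> : germ_cst m (0 : C) = 0 by [].
transitivity (germ_of (0 : holo R m)); last by rewrite /germ_of !piE.
by apply/germ_of_eqP; near=> z.
Unshelve. all: by end_near. Qed.

Lemma germ_seriesN u f : germ_series u f -> germ_series (- u) (- f).
Proof.
move=> uf; have := germ_seriesM (germ_series_cst (-1)) uf.
rewrite -scalerAl mul1r scaleN1r; suff -> : germ_cst m (-1 : C) = -1 by rewrite mulN1r.
transitivity (germ_of (-1 : holo R m)); last by rewrite /germ_of !piE.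
by apply/germ_of_eqP; near=> z.
Unshelve. all: by end_near. Qed.

Lemma germ_series_sum I (r : seq I) (U : I -> germ R m) (F : I -> S) :
  (forall i, germ_series (U i) (F i)) ->
  germ_series (\sum_(i <- r) U i) (\sum_(i <- r) F i).
Proof.
move=> UF; elim: r => [|i r IH]; first by rewrite !big_nil; exact: germ_series0.
by rewrite !big_cons; exact: germ_seriesD.
Qed.

Lemma maximal_ideal_series k u : ideal_exp (@maximal_ideal R m) k u ->
  exists2 f, germ_series u f & ordge k f.
Proof.
elim: k u => [|k IH] u; first by move=> _; have [f uf] := germ_series_exists u; exists f.
move=> [l [a [b [ab ->]]]].
have /choice[F FP] : forall i, exists f, germ_series (a i * b i) f /\ ordge k.+1 f.
  move=> i; have [ai /IH[g bg gk]] := ab i; have [f af] := germ_series_exists (a i).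
  exists (f * g); split; first exact: germ_seriesM.
  rewrite -add1n; apply: ordgeM => //.
  have [x [x0 _ fz]] := af.
  move=> c; rewrite ltnS leqn0 mdeg_eq0 => /eqP->.
  rewrite -(ev_at0 cm) -fz; first exact: ai.
  by move=> j; rewrite mxE av0 ltW.
exists (\sum_i F i); first by apply: germ_series_sum => i; have [] := FP i.
by apply: wge_sum => i _; have [] := FP i.
Qed.

End GermSeries.

Section QPIdeal.
Variables (R : realType) (n : nat).
Local Notation C := (Cplx R).
Local Notation cm := (Cplx_modulus R).
Local Notation av := (cm_av cm).
Local Notation m := (n + n)%N.
Local Notation S := (fps m C).
Implicit Types (f g : S) (u v : germ R m).

Lemma germ_series_quad (lambda : 'rV[C]_n) :
  germ_series (quadratic_hamiltonian lambda) (quad (fun i => lambda 0 i)).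
Proof.
apply: germ_series_sum => i; rewrite /germ_q /germ_p -mulrA.
rewrite -[X in germ_series _ X]mul1r -scalerAr scalerAl.
by do 2?apply: germ_seriesM; [exact: germ_series_cst|exact: germ_series_coord|exact: germ_series_coord].
Qed.

(** A monomial divisible by several products [q_j p_j] is divided by exactly one of them,
    the one that the choice operator returns. *)
Definition qp_quotient f (i : 'I_n) : S := fun c =>
  if [pick j | (0 < minn ((c + qpunit i)%R (lshift n j)) ((c + qpunit i)%R (rshift n j)))%N] == Some i
  then f (c + qpunit i) else 0.

Lemma qp_quotientE f : valge 1 f -> f = \sum_i fps_mon C (qpunit i) * qp_quotient f i.
Proof.
move=> f1; apply/fpsP => a; rewrite fps_sumE.
case E : [pick j | (0 < minn (a (lshift n j)) (a (rshift n j)))%N] => [i|].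
  have ai : exists c, a = qpunit i + c.
    move: E; case: pickP => // j; rewrite leq_min => /andP[jq jp] [ij].
    rewrite {}ij in jq jp; eexists; apply: mindex_subK => l; rewrite mindexDE !ffunE.
    case: eqP => [->|_]; first by rewrite eq_lrshift addn0.
    by case: eqP => [->|_].
  rewrite (bigD1 i)//= big1 ?addr0.
    by case: ai => c ac; rewrite {2}ac fps_monME /qp_quotient addrC -ac E eqxx.
  move=> j ji; have [/forallP ja|/forallPn[l]] := boolP [forall l, (qpunit j l <= a l)%N].
    have ac := mindex_subK ja.
    rewrite {1}ac fps_monME /qp_quotient addrC -ac E.
    by case: eqP => // -[ij]; rewrite ij eqxx in ji.
  by rewrite -ltnNge => la; exact: fps_monM_eq0 la.
rewrite f1; last first.
  move: E; case: pickP => // a0 _; rewrite /qpval big1// => j _.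
  by apply/eqP; rewrite -leqn0 leqNgt a0.
rewrite big1// => j _.
have [/forallP ja|/forallPn[l]] := boolP [forall l, (qpunit j l <= a l)%N].
  have ac := mindex_subK ja.
  by rewrite {1}ac fps_monME /qp_quotient addrC -ac E.
by rewrite -ltnNge => la; exact: fps_monM_eq0 la.
Qed.

Lemma valge_qp_quotient k f i : valge k.+1 f -> valge k (qp_quotient f i).
Proof.
by move=> fk c ck; rewrite /qp_quotient; case: eqP => // _; rewrite fk// qpval_qpunit ltnS.
Qed.

Lemma normle_qp_quotient x f M i : 0 < x -> normle av x f M ->
  normle av x (qp_quotient f i) (M / x ^+ 2).
Proof.
move=> x0 fM N; rewrite ler_pdivlMr ?exprn_gt0// mulr_suml.
apply: le_trans (fM (N + (mdeg (qpunit i)).+1)%N).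
apply: le_trans (@sum_box_shift _ _ N (nterm av x f) (qpunit i) _); last first.
  by move=> a; apply: nterm_ge0; exact: ltW.
apply: ler_sum => a _; rewrite /nterm mdegD [mdeg (qpunit i)]mdegD !mdeg_unit exprD mulrA.
apply: ler_wpM2r; first by rewrite exprn_ge0// ltW.
apply: ler_wpM2r; first by rewrite exprn_ge0// ltW.
by rewrite /qp_quotient; case: eqP => // _; rewrite av0 av_ge0.
Qed.

(** Division by a monomial of degree 2 divides the norm by at most [x ^+ 2], so that the
    quotients of a convergent series converge. *)
Lemma valge_germ_decomp k u f : germ_series u f -> valge k.+1 f ->
  exists (v : 'I_n -> germ R m) (g : 'I_n -> S),
    u = \sum_i germ_q R i * germ_p R i * v i /\
    forall i, germ_series (v i) (g i) /\ valge k (g i).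
Proof.
move=> uf fk; have [x [x0 [M fM] _]] := uf.
have /choice[v vP] : forall i, exists v, germ_series v (qp_quotient f i).
  by move=> i; exact: germ_series_intro x0 (normle_qp_quotient i x0 fM).
exists v, (qp_quotient f); split; last first.
  by move=> i; split; [exact: vP | exact: valge_qp_quotient].
apply: (germ_series_inj uf).
rewrite {1}(qp_quotientE (wge_le (ltn0Sn k) fk)).
apply: germ_series_sum => i; rewrite /qpunit -fps_monM.
by do 2?apply: germ_seriesM => //; exact: germ_series_coord.
Qed.

Lemma qp_in_ideal i : ideal_qp (germ_q R i * germ_p R i : germ R m).
Proof.
exists (fun j => (j == i)%:R); rewrite (bigD1 i)//= eqxx mul1r big1 ?addr0//.
by move=> j /negbTE->; rewrite mul0r.
Qed.

Lemma valge_ideal_exp u f k : germ_series u f -> valge k f -> ideal_exp (@ideal_qp R n) k u.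
Proof.
elim: k u f => [//|k IH] u f uf fk.
have [v [g [-> vg]]] := valge_germ_decomp uf fk.
exists n, (fun i => germ_q R i * germ_p R i), v; split=> // i.
by split; [exact: qp_in_ideal | have [vi gi] := vg i; exact: IH vi gi].
Qed.

End QPIdeal.

(** * Pullbacks and symplectic germs *)

Section Pullback.
Variables (R : realType) (m : nat).
Local Notation C := (Cplx R).
Local Notation V := 'rV[C]_m.
Variable Phi : V -> V.
Hypothesis Phi_near : forall P : set V, (\forall z \near (0 : V), P z) ->
  \forall z \near (0 : V), P (Phi z).
Hypothesis Phi_holo : forall F : holo R m, (F \o Phi) \in @holomorphic_pred R m.

Definition pullback (u : germ R m) : germ R m := germ_of (Holo (Phi_holo (repr u))).

Lemma pullbackE u : \forall z \near (0 : V), germ_fun (pullback u) z = germ_fun u (Phi z).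
Proof. exact: germ_fun_of. Qed.

Lemma germ_eqP (u v : germ R m) :
  (\forall z \near (0 : V), germ_fun u z = germ_fun v z) -> u = v.
Proof. by move=> uv; rewrite -(germ_funK u) -(germ_funK v); apply/germ_of_eqP. Qed.

Lemma pullbackD u v : pullback (u + v) = pullback u + pullback v.
Proof.
apply: germ_eqP; have := germ_funD u v => /Phi_near h.
near=> z; have -> : germ_fun (pullback (u + v)) z = germ_fun (u + v) (Phi z).
  by near: z; exact: pullbackE.
have -> : germ_fun (pullback u + pullback v) z = germ_fun (pullback u) z + germ_fun (pullback v) z.
  by near: z; exact: germ_funD.
have -> : germ_fun (pullback u) z = germ_fun u (Phi z) by near: z; exact: pullbackE.
have -> : germ_fun (pullback v) z = germ_fun v (Phi z) by near: z; exact: pullbackE.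
by near: z.
Unshelve. all: by end_near. Qed.

Lemma pullbackM u v : pullback (u * v) = pullback u * pullback v.
Proof.
apply: germ_eqP; have := germ_funM u v => /Phi_near h.
near=> z; have -> : germ_fun (pullback (u * v)) z = germ_fun (u * v) (Phi z).
  by near: z; exact: pullbackE.
have -> : germ_fun (pullback u * pullback v) z = germ_fun (pullback u) z * germ_fun (pullback v) z.
  by near: z; exact: germ_funM.
have -> : germ_fun (pullback u) z = germ_fun u (Phi z) by near: z; exact: pullbackE.
have -> : germ_fun (pullback v) z = germ_fun v (Phi z) by near: z; exact: pullbackE.
by near: z.
Unshelve. all: by end_near. Qed.

Lemma pullback1 : pullback 1 = 1.
Proof.
apply: germ_eqP; have := germ_fun1 R m => /Phi_near h.
near=> z; have -> : germ_fun (pullback 1) z = germ_fun (1 : germ R m) (Phi z).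
  by near: z; exact: pullbackE.
have -> : germ_fun (1 : germ R m) z = 1 by near: z; exact: germ_fun1.
by near: z.
Unshelve. all: by end_near. Qed.

Lemma pullback_zmod_morphism : zmod_morphism pullback.
Proof.
move=> u v; rewrite pullbackD; congr (_ + _).
apply/eqP; rewrite -addr_eq0 -pullbackD addNr.
by have := pullbackD 0 0; rewrite addr0 => /eqP; rewrite -subr_eq0 opprD addNKr oppr_eq0.
Qed.

HB.instance Definition _ := GRing.isZmodMorphism.Build _ _ pullback pullback_zmod_morphism.
HB.instance Definition _ := GRing.isMonoidMorphism.Build _ _ pullback (pullback1, pullbackM).

Definition pullback_rmorphism : {rmorphism germ R m -> germ R m} := pullback.

End Pullback.

Section SymplecticMatrix.
Variables (K : comUnitRingType) (n : nat).

Definition symp_mx : 'M[K]_(n + n) := block_mx 0 1%:M (- 1%:M) 0.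

Lemma symp_mxK : symp_mx *m symp_mx = - 1%:M.
Proof.
rewrite /symp_mx mulmx_block !mul0mx !mulmx0 !mul1mx !mulmx1 !add0r !addr0.
by rewrite -[RHS]scaleN1r scalar_mx_block scale_block_mx !scaler0 !scaleN1r.
Qed.

Lemma mul_symp_mx p (u : 'M[K]_(p, n + n)) : u *m symp_mx = row_mx (- rsubmx u) (lsubmx u).
Proof.
rewrite -{1}[u]hsubmxK /symp_mx mul_row_block !mulmx0 !mulmx1 add0r addr0.
by rewrite mulmxN mulmx1.
Qed.

(** The hypothesis exhibits a left inverse of [J], which is also a right inverse. *)
Lemma symp_mx_adjoint (J : 'M[K]_(n + n)) : J^T *m symp_mx *m J = symp_mx ->
  J *m symp_mx *m J^T = symp_mx.
Proof.
move=> JJ; have h : (- (symp_mx *m J^T *m symp_mx)) *m J = 1%:M.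
  rewrite mulNmx -!mulmxA [J^T *m _]mulmxA JJ.
  by apply/eqP; rewrite eqr_oppLR; apply/eqP; exact: symp_mxK.
have XO : J *m symp_mx *m J^T *m symp_mx = - 1%:M.
  have := mulmx1C h; rewrite mulmxN !mulmxA => /eqP; rewrite eqr_oppLR.
  by move=> /eqP.
have : J *m symp_mx *m J^T *m (symp_mx *m symp_mx) = - (J *m symp_mx *m J^T).
  by rewrite symp_mxK mulmxN mulmx1.
by rewrite mulmxA XO mulNmx mul1mx => /oppr_inj.
Qed.

End SymplecticMatrix.

Section AutoGerm.
Variables (R : realType) (n : nat).
Local Notation C := (Cplx R).
Local Notation cm := (Cplx_modulus R).
Local Notation av := (cm_av cm).
Local Notation m := (n + n)%N.
Local Notation S := (fps m C).
Local Notation V := 'rV[C]_m.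

Local Notation Omega := (symp_mx C n).

Section OneAutomorphism.
Variables (T : S -> S) (r A : R).
Hypothesis T_auto : poisson_auto T.
Hypothesis r_gt0 : 0 < r.
Hypothesis TX_norm : forall j, normle av r (T (fps_X C j)) A.
Local Notation Phi := (auto_map cm T).

Lemma auto_map_near (P : set V) : (\forall z \near (0 : V), P z) ->
  \forall z \near (0 : V), P (Phi z).
Proof.
move=> /(nbhs_polydisc cm)[y [y0 yP]].
have [s [s0 _ TXs]] := auto_radius T_auto r_gt0 TX_norm y0.
near=> z; apply: yP; rewrite subr0; apply: auto_map_polydisc TXs _ _.
by rewrite -[z]subr0; near: z; exact: near_polydisc.
Unshelve. all: by end_near. Qed.

Lemma auto_map_holo (F : holo R m) : (F \o Phi) \in @holomorphic_pred R m.
Proof.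
have /asboolP/(holomorphic_represents cm)[f [x Ff]] := valP F.
have [s Fs] := auto_represents T_auto r_gt0 TX_norm Ff.
by apply/asboolP; exact: represents_holomorphic Fs.
Qed.

Lemma auto_map_holomorphic : holomorphic_map_germ Phi.
Proof. by move=> j; exact: represents_holomorphic (auto_map_represents r_gt0 TX_norm j). Qed.

Lemma auto_map_comp (U : S -> S) f M : normle av r f M -> (forall g, T (U g) = g) ->
  forall j, f = U (fps_X C j) -> \forall z \near (0 : V), ev cm f (Phi z) = z 0 j.
Proof.
move=> fM TU j fE; have [s [s0 _ TXs]] := auto_radius T_auto r_gt0 TX_norm r_gt0.
near=> z; have zs : polydisc cm s z by rewrite -[z]subr0; near: z; exact: near_polydisc.
by rewrite -(auto_ev T_auto r_gt0 s0 TXs fM zs) fE TU ev_X.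
Unshelve. all: by end_near. Qed.

Lemma symplectic_formE (u v : V) : symplectic_form u v = (u *m Omega *m v^T) 0 0.
Proof.
rewrite mul_symp_mx.
rewrite mxE big_split_ord /= -big_split; apply: eq_bigr => i _ /=.
by rewrite row_mxEl row_mxEr !mxE; ring.
Qed.

(** Rows are indexed by the variables and columns by the components, as the differential
    acts on row vectors. Preservation of brackets is then a statement about
    [J^T Omega J], and preservation of the symplectic form one about [J Omega J^T]. *)
Definition jacobian z : 'M[C]_m := \matrix_(i, j) ev cm (partial i (T (fps_X C j))) z.

Lemma auto_map_diff z : polydisc cm (r / 2%:R) z ->
  'd Phi z = mulmxr (jacobian z) :> (V -> V).
Proof.
move=> zr; have r2 : 0 < r / 2%:R by rewrite divr_gt0.
rewrite (@diff_represents _ _ cm _ _ _ _ (fun j => recenter cm (T (fps_X C j)) z) _ r2).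
  congr (mulmxr _ : V -> V); apply/matrixP => i j.
  by rewrite !mxE /recenter divpart_unit.
move=> j; exact: (represents_recenter (auto_map_represents r_gt0 TX_norm j) zr).
Qed.

Lemma poisson_X (j k : 'I_m) : poisson (fps_X C j) (fps_X C k) = (Omega j k)%:A.
Proof.
rewrite /poisson /dq /dp /symp_mx.
under eq_bigr => i _ do rewrite !partial_X.
case: (split_ordP j) => {}j ->; case: (split_ordP k) => {}k ->.
- rewrite block_mxEul mxE scale0r big1// => i _.
  by rewrite !eq_lshift !eq_rlshift mulr0 mul0r subrr.
- rewrite block_mxEur mxE (bigD1 j)//= big1.
    rewrite eq_lshift eq_rshift eqxx eq_rlshift eq_lrshift mul1r mul0r subr0 addr0.
    by case: eqP => _; rewrite ?scale1r ?scale0r.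
  move=> i ij; rewrite eq_lshift (negbTE ij) eq_rlshift !mul0r subrr//.
- rewrite block_mxEdl !mxE (bigD1 j)//= big1.
    rewrite eq_lshift eq_rshift eqxx eq_rlshift eq_lrshift mul1r mul0r sub0r addr0.
    by case: eqP => _; rewrite ?scaleN1r ?oppr0 ?scale0r.
  move=> i ij; rewrite eq_rshift (negbTE ij) eq_lrshift !mul0r subrr//.
- rewrite block_mxEdr mxE scale0r big1// => i _.
  by rewrite !eq_rshift !eq_lrshift mulr0 mul0r subrr.
Qed.

(** The brackets of the components of the map are the series
    [{T X_j, T X_k} = T {X_j, X_k}], and [{X_j, X_k}] is the constant [Omega j k]. *)
Lemma jacobian_symp z : polydisc cm (r / 2%:R) z ->
  (jacobian z)^T *m Omega *m jacobian z = Omega.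
Proof.
move=> zr; have r2 : 0 < r / 2%:R by rewrite divr_gt0.
have r2r : r / 2%:R < r by lra.
have dn i j : normle av (r / 2%:R) (partial i (T (fps_X C j))) (A / (r - r / 2%:R)).
  by apply: normle_partial => //; exact: ltW.
set B := A / _ in dn.
apply/matrixP => j k.
have -> : Omega j k = ev cm (poisson (T (fps_X C j)) (T (fps_X C k))) z.
  by rewrite -(pa_poisson T_auto) poisson_X (linZ _ _ (pa_lin T_auto)) (pa_1 T_auto) ev_C.
have pn i : normle av (r / 2%:R) (dq i (T (fps_X C j)) * dp i (T (fps_X C k))
   - dp i (T (fps_X C j)) * dq i (T (fps_X C k))) (B * B + B * B).
  by apply: normleB; [exact: ltW| |]; apply: normleM; rewrite ?(ltW r2)//; exact: dn.
rewrite (ev_sum _ (ltW r2) zr pn).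
rewrite mul_symp_mx.
rewrite mxE big_split_ord /= addrC -big_split; apply: eq_bigr => i _ /=.
rewrite row_mxEl row_mxEr !mxE.
have mn (i1 i2 : 'I_m) : normle av (r / 2%:R)
    (partial i1 (T (fps_X C j)) * partial i2 (T (fps_X C k))) (B * B).
  by apply: normleM; rewrite ?(ltW r2).
rewrite (evB zr (mn _ _) (mn _ _)) !(evM zr (dn _ _) (dn _ _)) mulNr.
by [].
Qed.

Lemma auto_map_symplectic : symplectic_germ Phi.
Proof.
have r2 : 0 < r / 2%:R by rewrite divr_gt0.
rewrite /symplectic_germ; near=> z => u v.
have zr : polydisc cm (r / 2%:R) z by rewrite -[z]subr0; near: z; exact: near_polydisc.
rewrite auto_map_diff// !symplectic_formE /= trmx_mul.
have := symp_mx_adjoint (jacobian_symp zr) => JJ.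
have -> : u *m jacobian z *m Omega *m ((jacobian z)^T *m v^T) =
    u *m (jacobian z *m Omega *m (jacobian z)^T) *m v^T by rewrite !mulmxA.
by rewrite JJ.
Unshelve. all: by end_near. Qed.

End OneAutomorphism.
End AutoGerm.

(** * Diophantine vectors and the normal form of germs *)

Section Diophantine.
Variables (R : realType) (n : nat) (lambda : 'rV[Cplx R]_n).
Local Notation C := (Cplx R).
Local Notation cm := (Cplx_modulus R).
Local Notation av := (cm_av cm).
Local Notation lam := (fun i => lambda 0 i).
Hypothesis dioph : diophantine lambda.

Let vec (a : mindex (n + n)) : 'rV[int]_n :=
  \row_k ((a (lshift n k))%:Z - (a (rshift n k))%:Z).

Let freqE a : freq lam a = \sum_(k < n) lambda 0 k * (vec a 0 k)%:~R.
Proof. by apply: eq_bigr => k _; rewrite mxE rmorphB. Qed.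

Let sigma_le a : (sigma (vec a) <= mdeg a)%N.
Proof.
rewrite /sigma /mdeg big_split_ord /= -big_split leq_sum// => k _ /=; rewrite mxE.
move: (a (lshift n k)) (a (rshift n k)) => x y; lia.
Qed.

Let sigma_gt0 (i : 'rV[int]_n) : i != 0 -> (0 < sigma i)%N.
Proof.
move=> i0; rewrite lt0n; apply: contra i0; rewrite sum_nat_eq0 => /forallP h.
by apply/eqP/rowP => k; rewrite mxE; apply/eqP; rewrite -absz_eq0; exact: h.
Qed.

(** The frequency of [q^a p^b] is the pairing of [lambda] with [a - b], an integer vector
    whose size [sigma] is at most the degree [|a| + |b|] of the monomial. *)
Lemma diophantine_freq : (forall a, freq lam a = 0 -> forall i, a (lshift n i) = a (rshift n i)) /\
  exists B T, 0 <= B /\ forall a, av (freq lam a)^-1 <= B * (mdeg a)%:R ^+ T.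
Proof.
have [c [tau [c0 cP]]] := dioph.
have ac0 : 0 < av c by rewrite -(cm_gt0 cm) -(cm_real cm (ltW c0)).
have bound a : vec a != 0 -> av c / (sigma (vec a))%:R ^+ tau <= av (freq lam a).
  move=> va; have := cP _ va; rewrite -freqE.
  have t0 : 0 <= c / (sigma (vec a))%:R ^+ tau by rewrite divr_ge0 ?exprn_ge0 ?ler0n// ltW.
  by rewrite (cm_norm cm) [leLHS](cm_real cm t0) cm_le avM avV avX av_nat.
split=> [a a0 i|].
  have [va|va] := eqVneq (vec a) 0.
    move/rowP/(_ i): va; rewrite !mxE => /eqP; rewrite subr_eq0 => /eqP[]//.
  have := bound a va; rewrite a0 av0 leNgt divr_gt0// exprn_gt0// ltr0n.
  exact: sigma_gt0.
exists (av c)^-1, tau; split=> [|a]; first by rewrite invr_ge0 ltW.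
have [va|va] := eqVneq (vec a) 0.
  rewrite freqE big1 => [|k _]; last by rewrite va mxE mulr0.
  by rewrite invr0 av0 mulr_ge0 ?invr_ge0 ?exprn_ge0// ltW.
have s0 : 0 < (sigma (vec a))%:R ^+ tau :> R by rewrite exprn_gt0// ltr0n sigma_gt0.
apply: (@le_trans _ _ ((av c)^-1 * (sigma (vec a))%:R ^+ tau)).
  rewrite avV -[leRHS]invrK invfM invrK lef_pV2 ?posrE.
  - exact: bound.
  - by apply: lt_le_trans (bound a va); rewrite divr_gt0.
  - by rewrite divr_gt0.
apply: ler_wpM2l; first by rewrite invr_ge0 ltW.
by apply: lerXn2r; rewrite ?nnegrE// ler_nat.
Qed.

End Diophantine.

Theorem proposition2 (R : realType) (n : nat) (lambda : 'rV[Cplx R]_n) :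
  diophantine lambda ->
  forall r : germ R (n + n),
    ideal_exp (@maximal_ideal R (n + n)) 3 r ->
    exists phi : {rmorphism germ R (n + n) -> germ R (n + n)},
      symplectic_automorphism phi /\
      ideal_exp (@ideal_qp R n) 2
        (phi (quadratic_hamiltonian lambda + r) - quadratic_hamiltonian lambda).
Proof.
move=> dioph r r3.
have [freq0 [B [T [B0 freqB]]]] := diophantine_freq dioph.
have [P [x rP] P3] := maximal_ideal_series r3.
have [x0 [M PM] _] := rP.
have [phi0 [psi0 [phiA psiA [phiK psiK] [s [A [s0 XA]] val2]]]] :=
  convergent_normal_form freq0 B0 freqB P3 x0 PM.
have phiX j : normle (cm_av (Cplx_modulus R)) s (phi0 (fps_X (Cplx R) j)) A by have [] := XA j.
have psiX j : normle (cm_av (Cplx_modulus R)) s (psi0 (fps_X (Cplx R) j)) A by have [] := XA j.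
pose Phi := auto_map (Cplx_modulus R) phi0; pose Psi := auto_map (Cplx_modulus R) psi0.
have Phi_near := auto_map_near phiA s0 phiX; have Psi_near := auto_map_near psiA s0 psiX.
have Phi_holo := auto_map_holo phiA s0 phiX; have Psi_holo := auto_map_holo psiA s0 psiX.
have PsiPhi : \forall z \near (0 : 'rV[Cplx R]_(n + n)), Psi (Phi z) = z.
  have h j := auto_map_comp phiA s0 phiX (psiX j) phiK erefl.
  near=> z; apply/rowP => j; rewrite mxE; move: j; near: z.
  by apply: filter_forall => j; exact: h.
have PhiPsi : \forall z \near (0 : 'rV[Cplx R]_(n + n)), Phi (Psi z) = z.
  have h j := auto_map_comp psiA s0 psiX (phiX j) psiK erefl.
  near=> z; apply/rowP => j; rewrite mxE; move: j; near: z.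
  by apply: filter_forall => j; exact: h.
exists (pullback_rmorphism Phi_near Phi_holo); split; last first.
  apply: valge_ideal_exp val2; apply: germ_seriesD; last first.
    exact/germ_seriesN/germ_series_quad.
  have [y Fy] := germ_seriesD (germ_series_quad lambda) (ex_intro _ x rP : germ_series _ _).
  have [t Ft] := auto_represents phiA s0 phiX Fy.
  apply: represents_near Ft _.
  by have := pullbackE Phi_holo (quadratic_hamiltonian lambda + r); apply: filterS => z ->.
split.
  exists (pullback Psi_holo) => u; apply: germ_eqP.
    have h := Psi_near _ (pullbackE Phi_holo u).
    near=> z; have -> : germ_fun (pullback Psi_holo (pullback Phi_holo u)) z =
        germ_fun (pullback Phi_holo u) (Psi z) by near: z; exact: pullbackE.
    have -> : germ_fun (pullback Phi_holo u) (Psi z) = germ_fun u (Phi (Psi z)) by near: z.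
    by congr germ_fun; near: z.
  have h := Phi_near _ (pullbackE Psi_holo u).
  near=> z; have -> : germ_fun (pullback Phi_holo (pullback Psi_holo u)) z =
      germ_fun (pullback Psi_holo u) (Phi z) by near: z; exact: pullbackE.
  have -> : germ_fun (pullback Psi_holo u) (Phi z) = germ_fun u (Psi (Phi z)) by near: z.
  by congr germ_fun; near: z.
exists Phi; split.
- split.
  + exact: auto_map0.
  + exact: auto_map_holomorphic s0 phiX.
  + exists Psi; split=> //; first exact: auto_map0.
    exact: auto_map_holomorphic s0 psiX.
- exact: auto_map_symplectic phiA s0 phiX.
- by move=> u; exact: pullbackE.
Unshelve. all: by end_near. Qed.
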